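(* Let $G$ be a ribbon graph in $\mathbb{R}^3$, with vertices of degrees $2$ and $3$. Let $V$ and $E$ be the numbers of vertices and edges of $G$, let $V_3$ be the number of trivalent vertices of $G$, let $\chi(G)=V-E$ be the Euler characteristic of $G$, and set $E'=V_3-\chi(G)$. Then the Yamada polynomial $R_G$ satisfies $$R_G(e^{\pi i/5})=(-1)^{V-E}\,\phi^{E'}\,R_G(e^{-2\pi i/5})^2,$$ where $\phi=(1+\sqrt5)/2$.
   Context: Flow polynomial. For a finite graph $H$ (loops and multiple edges allowed), $F_H(Q)=\sum_{A\subseteq E(H)}(-1)^{|E(H)|-|A|}Q^{|A|-|V(H)|+c(A)}$, where $c(A)$ is the number of connected components of the spanning subgraph $(V(H),A)$. A vertex-free circle component is treated as one vertex with one loop (it contributes a factor $Q-1$). Ribbon graphs in $\mathbb{R}^3$. A ribbon graph is a graph $G$ with a $2$-dimensional thickening, encoded by a cyclic ordering of the half-edges at each vertex; a ribbon graph in $\mathbb{R}^3$ is such a thickened graph embedded in $\mathbb{R}^3$, up to isotopy. It is represented by a planar diagram: a generic immersion of $G$ in the plane, whose only singularities are transverse double points in the interiors of edges with over/under information, the ribbon being the planar (blackboard) thickening. Yamada polynomial. $R_G(q)\in\mathbb{Z}[q,q^{-1}]$ is computed from a planar diagram as follows. If the diagram has no crossings, i.e. it is a planar graph $H$, then $R_H(q)=(-1)^{|V(H)|-|E(H)|}F_H(q+2+q^{-1})$; this is equivalent to the contraction-deletion rule $R_H=R_{H/e}+R_{H\smallsetminus e}$ for non-loop edges $e$, together with the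 rule that adding a disjoint circle multiplies $R$ by $q+1+q^{-1}$, that $R_{G\vee H}=-R_GR_H$, and multiplicativity under disjoint union. In general, at each crossing, $R=q\,R_{0}+R_{\times}+q^{-1}R_{1}$, where the three diagrams differ from the original only near the crossing: ''$0$'' is the smoothing joining the two regions swept out when the over-strand is rotated counterclockwise until it meets the under-strand, ''$1$'' is the other planar smoothing, and ''$\times$'' replaces the crossing by a $4$-valent vertex. (The opposite convention for the two smoothings replaces $q$ by $q^{-1}$.) $R_G$ is an isotopy invariant of the ribbon graph $G$ in $\mathbb{R}^3$. *)

(* Defs.v *)
From HB Require Import structures.
From mathcomp Require Import all_boot all_order all_algebra all_fingroup.
From mathcomp Require Import all_classical all_reals all_analysis.
From mathcomp Require Import complex.

Set Implicit Arguments.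
Unset Strict Implicit.
Unset Printing Implicit Defensive.

Import Order.TTheory GRing.Theory Num.Theory.
Local Open Scope ring_scope.
Local Open Scope complex_scope.

(* A finite graph, given by its incidence relation: an edge is incident to two
   vertices, or to a single one when it is a loop.  Parallel edges are distinct
   elements of [edge] with the same incident vertices. *)
Record mgraph := MGraph {
  vertex : finType;
  edge : finType;
  inc : vertex -> edge -> bool
}.

Definition adj (H : mgraph) (A : {set edge H}) : rel (vertex H) :=
  [rel u v | [exists e in A, inc u e && inc v e]].

Definition ncomp (H : mgraph) (A : {set edge H}) : nat :=
  n_comp (adj A) (vertex H).

(* The exponent |A| - |V(H)| + c(A) is never negative, so the truncated
   subtraction is harmless. *)
Definition flow_poly (H : mgraph) : {poly int} :=
  \sum_(A : {set edge H})
    (-1) ^+ (#|edge H| - #|A|) *: 'X^(#|A| + ncomp A - #|vertex H|).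

Definition euler_char (H : mgraph) : int := #|vertex H|%:Z - #|edge H|%:Z.

Definition planar_yamada (K : fieldType) (H : mgraph) (q : K) : K :=
  (-1) ^ euler_char H * (map_poly intr (flow_poly H)).[q + 2 + q^-1].

(* A planar diagram of a ribbon graph in space, as a combinatorial map.  The
   double points and the vertices of the graph ("nodes") cut the immersed graph
   into arcs; a dart is an end of an arc at a node.  [arc] exchanges the two ends
   of an arc, [rot] sends a dart to the next one counterclockwise around its
   node, so nodes are the orbits of [rot].  [crossing] is the set of darts lying
   at a double point and [over] marks those of the over-strand; [over] is
   irrelevant at the other darts.  The last field is Euler's formula
   V - E + F = 2c, with faces the orbits of [d |-> rot (arc d)]: it says that
   every connected component of the map is drawn on a sphere.  The relative
   position of the components of a disconnected diagram is not recorded, since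
   it changes neither the ribbon graph up to isotopy nor its invariants.
   A circle bearing neither a vertex nor a double point has no darts and must be
   given one bivalent vertex, i.e. be drawn as one vertex with one loop. *)
Record diagram := Diagram {
  dart : finType;
  arc : {perm dart};
  rot : {perm dart};
  crossing : {set dart};
  over : {set dart};
  arcK : involutive arc;
  arc_neq : forall d, arc d != d;
  crossing_rot : forall d, (rot d \in crossing) = (d \in crossing);
  crossing_card : forall d, d \in crossing -> #|porbit rot d| = 4%N;
  over_rot : forall d, d \in crossing -> (rot d \in over) = (d \notin over);
  planar_euler :
    (#|porbits rot| + #|porbits (arc * rot)%g|
     = #|porbits arc|
       + (n_comp [rel x y | (y == arc x) || (y == rot x)] dart).*2)%N
}.

Definition node (D : diagram) (d : dart D) : {set dart D} := porbit (rot D) d.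

Definition crossings (D : diagram) : {set {set dart D}} :=
  [set node d | d in crossing D].

Definition vertices (D : diagram) : {set {set dart D}} :=
  [set node d | d in ~: crossing D].

(* A strand reaching a node through the dart [d] leaves it through [pass d], or
   stops there, at a vertex, when [pass d = d]. *)
Definition strands (D : diagram) (pass : dart D -> dart D) :
    {set {set dart D}} :=
  equivalence_partition
    (connect [rel x y | (y == arc D x) || (y == pass x)]) [set: dart D].

(* The vertices are the nodes at which strands stop, and one vertex for each
   strand that never stops: such a closed strand is a vertex-free circle, treated
   as one vertex with one loop. *)
Definition graph_vertices (D : diagram) (pass : dart D -> dart D) :
    {set {set dart D}} :=
  [set node d | d in [set d | pass d == d]]
    :|: [set S in strands pass | [forall d in S, pass d != d]].

(* All vertices and edges being sets of darts, incidence is non-disjointness. *)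
Definition strand_graph (D : diagram) (pass : dart D -> dart D) : mgraph :=
  {| vertex := {v : {set dart D} | v \in graph_vertices pass};
     edge := {S : {set dart D} | S \in strands pass};
     inc := fun v S => ~~ [disjoint val v & val S] |}.

(* The underlying graph: strands go straight across the double points. *)
Definition underlying_graph (D : diagram) : mgraph :=
  strand_graph
    (fun d : dart D => if d \in crossing D then rot D (rot D d) else d).

Definition num_trivalent (D : diagram) : nat :=
  #|[set v in vertices D | #|v| == 3%N]|.

(* [Fuse] turns a crossing into a 4-valent vertex. *)
Inductive resolution := Smooth0 | Smooth1 | Fuse.

Definition resolution_code (r : resolution) : option bool :=
  match r with Smooth0 => Some false | Smooth1 => Some true | Fuse => None end.

Definition resolution_decode (o : option bool) : resolution :=
  match o with
  | Some false => Smooth0 | Some true => Smooth1 | None => Fuse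
  end.

Lemma resolution_codeK : cancel resolution_code resolution_decode.
Proof. by case. Qed.

HB.instance Definition _ :=
  Finite.copy resolution (can_type resolution_codeK).

(* A state is only meaningful when it is [Fuse] outside [crossings D], so that
   the vertices of the graph remain vertices. *)
Definition state (D : diagram) := {ffun {set dart D} -> resolution}.

(* Rotating the over-strand counterclockwise sweeps the corners between each over
   dart [d] and [rot d].  Joining these two regions separates [d] from [rot d]:
   [Smooth0] links every over dart to the preceding dart, and every under dart
   to the next one. *)
Definition state_pass (D : diagram) (s : state D) (d : dart D) : dart D :=
  match s (node d) with
  | Smooth0 => if d \in over D then (rot D)^-1%g d else rot D d
  | Smooth1 => if d \in over D then rot D d else (rot D)^-1%g d
  | Fuse => d
  end.

Definition weight (K : fieldType) (q : K) (r : resolution) : K :=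
  match r with Smooth0 => q | Smooth1 => q^-1 | Fuse => 1 end.

(* The value at q of the Yamada polynomial, all crossings being expanded by
   R = q R_0 + R_x + q^-1 R_1. *)
Definition yamada (K : fieldType) (D : diagram) (q : K) : K :=
  \sum_(s in pffun_on Fuse (mem (crossings D)) predT)
    (\prod_(c in crossings D) weight q (s c))
    * planar_yamada (strand_graph (state_pass s)) q.

Definition expi (R : realType) (t : R) : R[i] := cos t +i* sin t.

Definition golden_ratio (R : realType) : R := (1 + Num.sqrt 5) / 2.

(* Main.v *)
Require Import Defs.
From mathcomp Require Import all_boot all_order all_algebra all_fingroup.
From mathcomp Require Import all_classical all_reals all_analysis.
From mathcomp Require Import complex.
From mathcomp Require Import ring lra zify.

Set Implicit Arguments.
Unset Strict Implicit.
Unset Printing Implicit Defensive.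

Import Order.TTheory GRing.Theory Num.Theory.
Local Open Scope ring_scope.
Local Open Scope complex_scope.

Section Linked.
Variable T : finType.
Implicit Types (L W A : seq (T * T)) (x y a b : T) (M : {pred T}).

Definition bond L : rel T := [rel x y | ((x, y) \in L) || ((y, x) \in L)].
Definition linked L : rel T := connect (bond L).
Definition ncl L : nat := n_comp (bond L) T.

Lemma linked_csym L : connect_sym (bond L).
Proof. by apply: sym_connect_sym => x y; rewrite /bond /= orbC. Qed.

Lemma linkedC L x y : linked L x y = linked L y x.
Proof. exact: linked_csym. Qed.

Lemma linked_refl L x : linked L x x.
Proof. exact: connect0. Qed.

Lemma linked_trans L : transitive (linked L).
Proof. exact: connect_trans. Qed.

Lemma linked_mem L x y : (x, y) \in L -> linked L x y.
Proof. by move=> xyL; apply: connect1; rewrite /bond /= xyL. Qed.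

Lemma linked_eql L x y z : linked L x y -> linked L x z = linked L y z.
Proof. by move=> xy; apply: (same_connect (linked_csym L)). Qed.

Lemma linked_eqr L x y z : linked L x y -> linked L z x = linked L z y.
Proof. by move=> xy; rewrite ![linked L z _]linkedC (linked_eql _ xy). Qed.

Definition closed_under L M := {in L, forall e, (e.1 \in M) = (e.2 \in M)}.

Lemma linked_closed L M x y :
  closed_under L M -> linked L x y -> (x \in M) = (y \in M).
Proof.
move=> clM; apply: (@closed_connect _ (bond L) M) => u v /orP[] /clM //=.
Qed.

Lemma closed_class L x : closed_under L (linked L x).
Proof. by case=> u v /linked_mem/linked_eqr; apply. Qed.

Lemma linked_sub L L' :
  {in L, forall e, linked L' e.1 e.2} -> subrel (linked L) (linked L').
Proof.
move=> LL'; apply: connect_sub => x y /orP[] /LL' //=.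
by rewrite -/(linked L' x y) linkedC.
Qed.

Lemma linked_cons a b L x y :
  linked ((a, b) :: L) x y =
  [|| linked L x y, linked L x a && linked L b y | linked L x b && linked L a y].
Proof.
have incl: subrel (linked L) (linked ((a, b) :: L)).
  by apply: linked_sub => -[u v] uvL /=; apply: linked_mem; rewrite inE uvL orbT.
have ab: linked ((a, b) :: L) a b by apply: linked_mem; rewrite mem_head.
apply/idP/idP; last first.
  case/or3P => [/incl//|/andP[/incl xa /incl by_]|/andP[/incl xb /incl ay]].
    exact: linked_trans xa (linked_trans ab by_).
  by apply: linked_trans xb (linked_trans _ ay); rewrite linkedC.
pose M := [pred z | [|| linked L x z, linked L x a && linked L b z
                      | linked L x b && linked L a z]].
move=> xy; have: x \in M -> y \in M.
  rewrite (@linked_closed ((a, b) :: L) M x y) // => -[u v].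
  rewrite inE => /predU1P[[-> ->]|uvL] /=; rewrite !inE.
    rewrite !linked_refl !andbT.
    have [xa|xa] /= := boolP (linked L x a);
      by have [xb|xb] /= := boolP (linked L x b); rewrite ?orbT.
  by rewrite !(linked_eqr _ (linked_mem uvL)).
by rewrite !inE; apply; rewrite linked_refl.
Qed.

Lemma eq_ncl L L' : linked L =2 linked L' -> ncl L = ncl L'.
Proof. by move=> LL'; apply: (eq_n_comp (LL' : connect _ =2 connect _)). Qed.

Lemma eq_linked_cons L L' e :
  linked L =2 linked L' -> linked (e :: L) =2 linked (e :: L').
Proof. by case: e => a b LL' x y; rewrite !linked_cons !LL'. Qed.

Lemma eq_linked_mem L L' : L =i L' -> linked L =2 linked L'.
Proof. by move=> LL' x y; apply: (@eq_connect T) => u v; rewrite /bond /= !LL'. Qed.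

Lemma linked_consA e f L : linked (e :: f :: L) =2 linked (f :: e :: L).
Proof. by apply: eq_linked_mem => z; rewrite !inE orbCA. Qed.

Lemma linked_cat_perm L L' L2 : perm_eq L L' -> linked (L ++ L2) =2 linked (L' ++ L2).
Proof. by move=> LL'; apply: eq_linked_mem => z; rewrite !mem_cat (perm_mem LL'). Qed.

Lemma linked_cons_id a b L : linked L a b -> linked ((a, b) :: L) =2 linked L.
Proof.
move=> ab x y; rewrite linked_cons; have [//|nxy] := boolP (linked L x y).
rewrite (linked_eqr x ab) -(linked_eql y ab) orbb.
apply: contraNF nxy => /andP[xb ay].
by apply: linked_trans xb _; rewrite -(linked_eql y ab).
Qed.

Lemma eq_linked_pair a b a' b' L :
  linked L a a' -> linked L b b' -> linked ((a, b) :: L) =2 linked ((a', b') :: L).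
Proof.
move=> aa bb x y; rewrite !linked_cons.
by rewrite !(linked_eqr _ aa) !(linked_eqr _ bb) !(linked_eql _ aa) !(linked_eql _ bb).
Qed.

Lemma linked_flip a b L : linked ((a, b) :: L) =2 linked ((b, a) :: L).
Proof. by move=> x y; rewrite !linked_cons; congr (_ || _); rewrite orbC. Qed.

Lemma ncl_cons a b L : (ncl ((a, b) :: L) + ~~ linked L a b)%N = ncl L.
Proof.
have sL := linked_csym L; have sL' := linked_csym ((a, b) :: L).
pose A : pred T := closure_mem (bond L) (mem (pred2 a b)).
have AE x : (x \in A) = linked L x a || linked L x b.
  rewrite unfold_in /A /closure_mem; apply/pred0Pn/orP => /=.
    by case=> z /andP[xz /pred2P[] zE]; [left|right]; rewrite -zE.
  by case=> h; [exists a|exists b]; apply/andP; split=> //; rewrite !inE eqxx ?orbT.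
have clA: fingraph.closed_mem (bond L) (mem A) by apply: closure_closed.
have eqC: n_comp (bond ((a, b) :: L)) [predC A] = n_comp (bond L) [predC A].
  apply: eq_card => x; rewrite !inE; have [//|xA] := boolP (x \in A); first by rewrite !andbF.
  rewrite !andbT /roots /root /=; congr (odflt _ _ == _).
  apply: eq_pick => y /=; rewrite -/(linked _ x y) -/(linked L x y) linked_cons.
  by move: xA; rewrite AE negb_or => /andP[/negPf-> /negPf->]; rewrite orbF.
have eqA: n_comp (bond ((a, b) :: L)) A = 1%N.
  have ab: linked ((a, b) :: L) a b by apply: linked_mem; rewrite mem_head.
  rewrite -(n_comp_connect sL' a); apply: eq_n_comp_r => x.
  have -> : (x \in connect (bond ((a, b) :: L)) a) = linked ((a, b) :: L) a x by [].
  rewrite linked_cons linked_refl AE.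
  rewrite [linked L x a]linkedC [linked L x b]linkedC.
  have [xa|xa] //= := boolP (linked L a x).
  by rewrite andbF orbF.
rewrite /ncl (n_compC A) (n_compC A (bond L)) eqC eqA n_comp_closure2 //.
by rewrite -/(linked L a b); lia.
Qed.

Lemma ncl_cat_le L L' : (ncl L' <= size L + ncl (L ++ L'))%N.
Proof.
elim: L => [|[a b] L IH] //=.
by have := ncl_cons a b (L ++ L'); case: (linked _ _ _) => /=; lia.
Qed.

Lemma ncl_sub L L' : subrel (linked L) (linked L') -> (ncl L' <= ncl L)%N.
Proof.
move=> sLL'; have <-: ncl (L' ++ L) = ncl L'.
  apply: eq_ncl => x y; apply/idP/idP; apply: linked_sub => -[u v] /=.
    by rewrite mem_cat => /orP[/linked_mem//|/linked_mem/sLL'].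
  by move=> uv; apply: linked_mem; rewrite mem_cat uv.
elim: (L') => [//|[a b] A IH] /=.
by have := ncl_cons a b (A ++ L); lia.
Qed.

Lemma ncl_sub_eq L L' :
  subrel (linked L) (linked L') -> ncl L = ncl L' -> linked L =2 linked L'.
Proof.
move=> sLL' eqn x y; apply/idP/idP => [/sLL'//|xy].
apply: contra_eqT eqn => nxy; rewrite neq_ltn; apply/orP; right.
have := ncl_cons x y L; rewrite nxy addn1 => <-; rewrite ltnS.
apply: ncl_sub; apply: linked_sub => -[u v].
by rewrite inE => /predU1P[[-> ->]|/linked_mem/sLL'].
Qed.

Lemma ncl_nil : ncl [::] = #|T|.
Proof.
apply: eq_card => x; rewrite !inE andbT; apply/eqP/esym.
have := connect_root (bond [::]) x => /(@linked_closed [::] (pred1 x)).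
by rewrite !inE eqxx => h; apply/eqP; rewrite eq_sym -h.
Qed.

End Linked.

Definition ends (T : finType) (W : seq (T * T)) : seq T :=
  flatten [seq [:: e.1; e.2] | e <- W].
#[global] Arguments ends : simpl never.

Fixpoint Z (K : comNzRingType) (Q : K) (T : finType) (W L : seq (T * T)) : K :=
  if W is e :: W' then Q * Z Q W' (e :: L) - Z Q W' L else Q ^+ ncl L.

Section StateSum.
Variables (K : comNzRingType) (Q : K) (T : finType).
Implicit Types (L W A : seq (T * T)) (x y a b : T) (M : {pred T}).

Lemma ends_cons e W : ends (e :: W) = e.1 :: e.2 :: ends W.
Proof. by []. Qed.

Lemma ends_cat W W' : ends (W ++ W') = ends W ++ ends W'.
Proof. by rewrite /ends map_cat flatten_cat. Qed.

Lemma ends_perm W W' : perm_eq W W' -> perm_eq (ends W) (ends W').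
Proof. by move=> WW'; apply/perm_flatten/perm_map. Qed.

Lemma mem_ends W x : reflect (exists2 e, e \in W & (x == e.1) || (x == e.2)) (x \in ends W).
Proof.
apply: (iffP flatten_mapP) => -[e eW].
  by rewrite !inE => h; exists e.
by move=> h; exists e => //; rewrite !inE.
Qed.

Lemma size_ends W : size (ends W) = (size W).*2.
Proof. by elim: W => // e W IH; rewrite ends_cons /= IH doubleS. Qed.

Lemma Z_cons e W L : Z Q (e :: W) L = Q * Z Q W (e :: L) - Z Q W L.
Proof. by []. Qed.

Lemma Z_ext W L L' : linked L =2 linked L' -> Z Q W L = Z Q W L'.
Proof.
elim: W L L' => [|e W IH] L L' LL' /=; first by rewrite (eq_ncl LL').
by rewrite (IH _ _ LL') (IH _ _ (eq_linked_cons _ LL')).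
Qed.

Lemma Z_swap e f W L : Z Q (e :: f :: W) L = Z Q (f :: e :: W) L.
Proof. by rewrite !Z_cons (Z_ext W (linked_consA f e L)); ring. Qed.

Lemma Z_rem e W L : e \in W -> Z Q W L = Z Q (e :: rem e W) L.
Proof.
elim: W L => // f W IH L; rewrite inE eq_sym /=; case: eqP => [->//|_ /= eW].
by rewrite -[RHS]/(Z Q (e :: f :: rem e W) L) Z_swap Z_cons -!IH.
Qed.

Lemma Z_perm W W' L : perm_eq W W' -> Z Q W L = Z Q W' L.
Proof.
elim: W W' L => [|e W IH] W' L; first by rewrite perm_sym => /perm_nilP->.
move=> eW; have eW' : e \in W' by rewrite -(perm_mem eW) mem_head.
have := perm_to_rem eW' => /(perm_trans eW); rewrite perm_cons => WW'.
by rewrite (Z_rem L eW') !Z_cons !(IH _ _ WW').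
Qed.

Lemma Z_pair a b a' b' W L :
  linked L a a' -> linked L b b' -> Z Q ((a, b) :: W) L = Z Q ((a', b') :: W) L.
Proof. by move=> aa bb; rewrite !Z_cons (Z_ext W (eq_linked_pair aa bb)). Qed.

Lemma Z_flip a b W L : Z Q ((a, b) :: W) L = Z Q ((b, a) :: W) L.
Proof. by rewrite !Z_cons (Z_ext W (linked_flip a b L)). Qed.

Lemma Z_loop a b W L : linked L a b -> Z Q ((a, b) :: W) L = (Q - 1) * Z Q W L.
Proof. by move=> ab; rewrite Z_cons (Z_ext W (linked_cons_id ab)); ring. Qed.

Lemma Z_cut M a b W L :
  closed_under L M -> closed_under W M -> a \in M -> b \notin M ->
  Z Q ((a, b) :: W) L = 0.
Proof.
move=> + + aM bM; elim: W L => [|f W IH] L clL clW.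
  rewrite /= -(ncl_cons a b L); case: (boolP (linked L a b)) => [|_].
    by move/(linked_closed clL); rewrite aM (negPf bM).
  by rewrite addn1 exprS; ring.
have clW' : closed_under W M by move=> g gW; apply: clW; rewrite inE gW orbT.
rewrite Z_swap Z_cons !IH ?mulr0 ?subr0 // => g.
by rewrite inE => /predU1P[->|/clL//]; apply: clW; rewrite mem_head.
Qed.

Lemma Z_pendant M a b W L :
  closed_under L M -> {in ends W, forall x, x \notin M} -> a \in M -> b \notin M ->
  Q * Z Q W ((a, b) :: L) = Z Q W L.
Proof.
move=> + + aM bM; elim: W L => [|f W IH] L clL clW.
  rewrite /= -(ncl_cons a b L); case: (boolP (linked L a b)) => [|_].
    by move/(linked_closed clL); rewrite aM (negPf bM).
  by rewrite addn1 exprS.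
have clW' : {in ends W, forall x, x \notin M}.
  by move=> x xW; apply: clW; rewrite ends_cons !inE xW !orbT.
rewrite !Z_cons -(IH L) // -(IH (f :: L)) //.
  by rewrite (Z_ext _ (linked_consA f (a, b) L)); ring.
move=> g; rewrite inE => /predU1P[->|/clL//].
by rewrite (negPf (clW f.1 _)) ?(negPf (clW f.2 _)) // ends_cons !inE eqxx ?orbT.
Qed.

End StateSum.

Definition graph (T : finType) (s : {perm T}) : seq (T * T) := [seq (x, s x) | x <- enum T].

Definition swaps (T : finType) (W : seq (T * T)) : {perm T} :=
  (\prod_(e <- W) tperm e.1 e.2)%g.

Definition planar (T : finType) (W : seq (T * T)) (s : {perm T}) : Prop :=
  (#|porbits s| + #|porbits (swaps W * s)%g| = size W + (ncl (W ++ graph s)).*2)%N.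

Section Planar.
Variable T : finType.
Implicit Types (L W A : seq (T * T)) (x y a b : T) (M : {pred T}) (s t u : {perm T}).

Lemma eq_linked_cat W L L' : linked L =2 linked L' -> linked (W ++ L) =2 linked (W ++ L').
Proof. by elim: W => //= e W IH LL'; apply/eq_linked_cons/IH. Qed.

Lemma mem_graph s x : (x, s x) \in graph s.
Proof. by apply/mapP; exists x; rewrite ?mem_enum. Qed.

Lemma closed_graph s M : (forall x, (s x \in M) = (x \in M)) -> closed_under (graph s) M.
Proof. by move=> clM _ /mapP[x _ ->] /=; rewrite clM. Qed.

Lemma linked_graph1 s x : linked (graph s) x (s x).
Proof. by apply/linked_mem/mem_graph. Qed.

Lemma linked_porbit L s x y :
  (forall z, linked L z (s z)) -> y \in porbit s x -> linked L x y.
Proof.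
move=> Ls /porbitP[i ->]; rewrite permX; elim: i => [|i IH]; first exact: linked_refl.
by rewrite iterS; apply: linked_trans IH (Ls _).
Qed.

Lemma linked_permM L s t x :
  (forall z, linked L z (s z)) -> (forall z, linked L z (t z)) -> linked L x ((s * t)%g x).
Proof. move=> Ls Lt; rewrite permM; apply: linked_trans (Ls _) (Lt _). Qed.

Lemma linked_graph s x y : linked (graph s) x y = (y \in porbit s x).
Proof.
apply/idP/porbitP => [xy|[i ->]].
  have cl : closed_under (graph s) [pred z | z \in porbit s x].
    by apply: closed_graph => z; rewrite !inE -!eq_porbit_mem -(porbit_perm s 1 z) expg1.
  by apply/porbitP; have := linked_closed cl xy; rewrite !inE porbit_id => <-.
by apply: linked_porbit; [apply: linked_graph1|apply/porbitP; exists i].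
Qed.

Lemma ncl_graph s : ncl (graph s) = #|porbits s|.
Proof.
rewrite /ncl /n_comp_mem; set e := bond _.
have csym : connect_sym e by apply: linked_csym.
have -> : porbits s = porbit s @: [set x | roots e x].
  apply/setP => B; apply/imsetP/imsetP => -[x _ ->]; last by exists x.
  exists (fingraph.root e x); first by rewrite inE roots_root.
  by apply/eqP; rewrite eq_porbit_mem porbit_sym -linked_graph; apply: connect_root.
rewrite card_in_imset; first by apply: eq_card => x; rewrite !inE andbT.
move=> x y; rewrite !inE => /eqP rx /eqP ry /eqP.
rewrite eq_porbit_mem -linked_graph linkedC -{2}rx -{2}ry => xy.
exact/(fingraph.rootP csym).
Qed.

Lemma tpermMK a b s : (tperm a b * (tperm a b * s) = s)%g.
Proof. by rewrite mulgA tperm2 mul1g. Qed.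

Lemma porbit_merge s a b :
  a \notin porbit s b -> #|porbits s| = #|porbits (tperm a b * s)%g|.+1.
Proof.
move=> ab; have := porbits_mul_tperm s a b; rewrite ab /=.
have -> : a != b by apply: contraNneq ab => ->; apply: porbit_id.
by rewrite /=; lia.
Qed.

Lemma porbit_split s a b :
  a != b -> a \in porbit s b -> #|porbits (tperm a b * s)%g| = #|porbits s|.+1.
Proof. by move=> ab aob; have := porbits_mul_tperm s a b; rewrite aob ab /=; lia. Qed.

Lemma porbit_merged s a b :
  a \notin porbit s b -> a \in porbit (tperm a b * s)%g b.
Proof.
move=> ab; have := porbits_mul_tperm (tperm a b * s)%g a b.
rewrite /= tpermMK (porbit_merge ab); case: (a \in _) => //=.
by case: (a != b); lia.
Qed.

Lemma porbit_splitted s a b :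
  a != b -> a \in porbit s b -> a \notin porbit (tperm a b * s)%g b.
Proof.
move=> ab aob; have := porbits_mul_tperm (tperm a b * s)%g a b.
rewrite /= tpermMK (porbit_split ab aob) ab; case: (a \in _) => //=; lia.
Qed.

Lemma linked_merge s a b :
  a \notin porbit s b -> linked (graph (tperm a b * s)%g) =2 linked ((a, b) :: graph s).
Proof.
move=> ab; apply: ncl_sub_eq.
  apply: linked_sub => _ /mapP[x _ ->] /=; rewrite permM linked_cons.
  case: tpermP => [->|->|_ _].
  - by rewrite linked_refl linked_graph1 /= orbT.
  - by rewrite linked_refl linked_graph1 /= !orbT.
  - by rewrite linked_graph1.
have := ncl_cons a b (graph s); rewrite linked_graph porbit_sym ab !ncl_graph.
by rewrite (porbit_merge ab); lia.
Qed.

Lemma porbits_mulC s t : #|porbits (s * t)%g| = #|porbits (t * s)%g|.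
Proof.
rewrite -!ncl_graph; pose e' : T -> T := s.
have -> : (t * s = (s * t) ^ s)%g by rewrite conjgE mulgA mulKg.
rewrite !ncl_graph.
have orbJ x : porbit ((s * t) ^ s)%g (s x) = s @: porbit (s * t)%g x.
  apply/setP => y; apply/porbitP/imsetP.
    by case=> i ->; exists (((s * t) ^+ i)%g x); rewrite ?mem_porbit // -conjXg permJ.
  by case=> _ /porbitP[i ->] ->; exists i; rewrite -conjXg permJ.
have -> : porbits ((s * t) ^ s)%g = (fun B : {set T} => s @: B) @: porbits (s * t)%g.
  apply/setP => B; apply/imsetP/imsetP => -[x].
    move=> _ ->; exists (porbit (s * t)%g (s^-1 x)%g); first exact: imset_f.
    by rewrite -orbJ permKV.
  by case/imsetP=> y _ -> ->; exists (s y); rewrite ?orbJ.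
by rewrite card_imset //; apply/imset_inj/perm_inj.
Qed.

Lemma swaps_cons e W : swaps (e :: W) = (tperm e.1 e.2 * swaps W)%g.
Proof. by rewrite /swaps big_cons. Qed.

Lemma swaps_cat W W' : swaps (W ++ W') = (swaps W * swaps W')%g.
Proof. by rewrite /swaps big_cat. Qed.

Lemma swaps_nil : swaps [::] = 1%g :> {perm T}.
Proof. by rewrite /swaps big_nil. Qed.

Lemma linked_swaps L W x : {subset W <= L} -> linked L x (swaps W x).
Proof.
move=> WL; elim: W WL => [|[a b] W IH] WL in x *; first by rewrite swaps_nil perm1 linked_refl.
have {}IH z : linked L z (swaps W z) by apply: IH => e eW; apply: WL; rewrite inE eW orbT.
have ab : linked L a b by apply/linked_mem/WL/mem_head.
rewrite swaps_cons; apply: linked_permM => // z; case: tpermP => [->|->|_ _] //.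
- by rewrite linkedC.
- exact: linked_refl.
Qed.

Lemma linked_graph_sub L s x : {subset graph s <= L} -> linked L x (s x).
Proof. by move=> sL; apply/linked_mem/sL/mem_graph. Qed.

Lemma genus_mono W1 a b W2 s :
  (#|porbits (swaps (W1 ++ (a, b) :: W2) * s)%g| + (ncl (W1 ++ W2 ++ graph s)).*2
   <= #|porbits (swaps (W1 ++ W2) * s)%g| + (ncl (W1 ++ (a, b) :: W2 ++ graph s)).*2 + 1)%N.
Proof.
pose u := (swaps W2 * s * swaps W1)%g.
have -> : #|porbits (swaps (W1 ++ (a, b) :: W2) * s)%g| = #|porbits (tperm a b * u)%g|.
  by rewrite /u swaps_cat swaps_cons -mulgA (porbits_mulC (swaps W1)) !mulgA.
have -> : #|porbits (swaps (W1 ++ W2) * s)%g| = #|porbits u|.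
  by rewrite /u swaps_cat -mulgA (porbits_mulC (swaps W1)).
have linku x y : y \in porbit u x -> linked (W1 ++ W2 ++ graph s) x y.
  apply: linked_porbit => z; apply: linked_permM => {}z.
    apply: linked_permM => {}z; first by apply: linked_swaps => e eW; rewrite !mem_cat eW orbT.
    by apply: linked_graph_sub => e eW; rewrite !mem_cat eW !orbT.
  by apply: linked_swaps => e eW; rewrite mem_cat eW.
have -> : ncl (W1 ++ (a, b) :: W2 ++ graph s) = ncl ((a, b) :: W1 ++ W2 ++ graph s).
  by apply/eq_ncl/eq_linked_mem => x; rewrite !(mem_cat, inE); case: (_ == _); rewrite ?orbT.
have := ncl_cons a b (W1 ++ W2 ++ graph s); have := porbits_mul_tperm u a b.
have [aub|] /= := boolP (a \in porbit u b).
  by rewrite linkedC (linku _ _ aub) /=; case: (a != b); lia.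
by case: (linked _ _ _) => /=; case: (a != b); lia.
Qed.

Lemma genus_ge0 W s :
  (#|porbits s| + #|porbits (swaps W * s)%g| <= size W + (ncl (W ++ graph s)).*2)%N.
Proof.
elim: W => [|[a b] W IH]; first by rewrite swaps_nil mul1g ncl_graph addnn add0n.
by have := genus_mono [::] a b W s; move: IH => /=; lia.
Qed.

Lemma planar_del W1 e W2 s : planar (W1 ++ e :: W2) s -> planar (W1 ++ W2) s.
Proof.
case: e => a b; rewrite /planar !size_cat /= -!catA /=.
have := genus_mono W1 a b W2 s; have := genus_ge0 (W1 ++ W2) s.
rewrite size_cat -catA; move: #|porbits s| #|porbits (swaps (W1 ++ W2) * s)|.
move: #|porbits (swaps (W1 ++ (a, b) :: W2) * s)| (ncl _) (ncl _) => A c d B C.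
by move: (size W1) (size W2) => m n; lia.
Qed.

Lemma planar_subseq W A s : subseq A W -> planar W s -> planar A s.
Proof.
suff gen B : subseq A W -> planar (B ++ W) s -> planar (B ++ A) s by apply: (gen [::]).
elim: W A B => [|e W IH] A B /=; first by move/eqP->.
case: A => [|f A]; first by move=> _ /planar_del; apply/IH/sub0seq.
case: eqP => [->|_] sub; last by move/planar_del; apply: IH.
by rewrite -!cat_rcons; apply: IH.
Qed.

Lemma linked_cat_rcons W a b L : linked (rcons W (a, b) ++ L) =2 linked ((a, b) :: W ++ L).
Proof. by apply: eq_linked_mem => x; rewrite cat_rcons !(mem_cat, inE) orbCA. Qed.

Lemma planar_merge W a b s :
  a \notin porbit s b -> planar W (tperm a b * s)%g <-> planar (rcons W (a, b)) s.
Proof.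
move=> ab; rewrite /planar size_rcons -cats1 swaps_cat swaps_cons swaps_nil mulg1 mulgA.
rewrite cats1 (porbit_merge ab) /=.
rewrite (eq_ncl (eq_linked_cat W (linked_merge ab))) cat_rcons.
move: #|porbits (tperm a b * s)%g| #|porbits _| (ncl _) (size W) => A B c m.
by rewrite !addSn; split=> [->|[->]].
Qed.

Lemma planar_split W a b s :
  a != b -> a \in porbit s b -> planar W s -> planar W (tperm a b * s)%g.
Proof.
move=> ab /(porbit_splitted ab)/(planar_merge W); rewrite tpermMK => pl.
by move/pl; rewrite -cats1 => /planar_del; rewrite cats0.
Qed.

End Planar.

Definition noncrossing (T : finType) (L : seq (T * T)) (a b c d : T) : bool :=
  ~~ [&& linked L a c, linked L b d & ~~ linked L a b].

Lemma jw_arith (K : comNzRingType) (phi : K) (ab ac ad bc bd cd : bool)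
    (n nab nbc ncd nad nac nbd nabc nbcd ncda ndab ns ns' nx : nat) :
  phi ^+ 2 = phi + 1 ->
  ~~ [&& ac, bd & ~~ ab] ->
  [&& ab && bc ==> ac, ac && cd ==> ad, ab && bd ==> ad, bc && cd ==> bd,
      ab && ac ==> bc, ac && ad ==> cd, ab && ad ==> bd, bc && bd ==> cd,
      ac && bc ==> ab, ad && cd ==> ac, ad && bd ==> ab & bd && cd ==> bc] ->
  (nab + ~~ ab)%N = n -> (nbc + ~~ bc)%N = n -> (ncd + ~~ cd)%N = n ->
  (nad + ~~ ad)%N = n -> (nac + ~~ ac)%N = n -> (nbd + ~~ bd)%N = n ->
  (nabc + ~~ (ab || ac))%N = nbc -> (nbcd + ~~ (bc || bd))%N = ncd ->
  (ncda + ~~ (cd || ac))%N = nad -> (ndab + ~~ (ad || bd))%N = nab ->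
  (ns + ~~ [|| ab, ac && bd | ad && bc])%N = ncd ->
  (ns' + ~~ [|| ad, ab && cd | ac && bd])%N = nbc ->
  (nx + ~~ [|| ab, ac | ad])%N = nbcd ->
  let q m := (phi + 1) ^+ m in
  - phi ^+ 3 * q nx + q ns + q ns' + (1 - phi) * (q nac + q nbd)
  - (q nab + q nbc + q ncd + q nad) + phi * (q nabc + q nbcd + q ncda + q ndab) + q n = 0.
Proof.
move=> phi2.
case: ab; case: ac; case: ad; case: bc; case: bd; case: cd => //= _ _;
rewrite ?addn0 ?addn1 => *; repeat match goal with
  | h : _ = _ :> nat |- _ => first [progress subst | case: h => h] end; rewrite ?exprS; ring: phi2.
Qed.

Section JonesWenzl.
Variables (K : comNzRingType) (phi : K) (T : finType).
Hypothesis phi2 : phi ^+ 2 = phi + 1.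
Implicit Types (L W A : seq (T * T)).
Variables a b c d : T.

Definition jw_sum W L : K :=
  let z A := Z (phi + 1) W (A ++ L) in
  - phi ^+ 3 * z [:: (a, b); (b, c); (c, d)]
  + z [:: (a, b); (c, d)] + z [:: (a, d); (b, c)]
  + (1 - phi) * (z [:: (a, c)] + z [:: (b, d)])
  - (z [:: (a, b)] + z [:: (b, c)] + z [:: (c, d)] + z [:: (a, d)])
  + phi * (z [:: (a, b); (b, c)] + z [:: (b, c); (c, d)]
           + z [:: (c, d); (a, d)] + z [:: (a, d); (a, b)])
  + z [::].

Lemma jw_sum_nil L : noncrossing L a b c d -> jw_sum [::] L = 0.
Proof.
have tr x y z : linked L x y && linked L y z ==> linked L x z.
  by apply/implyP => /andP[]; apply: linked_trans.
have C := linkedC L.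
move=> nc; apply: (@jw_arith K phi (linked L a b) (linked L a c) (linked L a d)
  (linked L b c) (linked L b d) (linked L c d) (ncl L)) => //; try exact: ncl_cons.
- do 4![apply/andP; split; first exact: tr].
  apply/andP; split; first by rewrite (C a b); exact: tr.
  apply/andP; split; first by rewrite (C a c); exact: tr.
  apply/andP; split; first by rewrite (C a b); exact: tr.
  apply/andP; split; first by rewrite (C b c); exact: tr.
  apply/andP; split; first by rewrite (C b c); exact: tr.
  apply/andP; split; first by rewrite (C c d); exact: tr.
  apply/andP; split; first by rewrite (C b d); exact: tr.
  by rewrite (C c d); exact: tr.
all: match goal with |- (ncl ((?x, ?y) :: _ ++ _) + _ = _)%N =>
  rewrite -[RHS](ncl_cons x y); congr (_ + ~~ _)%N; rewrite /= !linked_cons ?linked_refl ?andbT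
  | |- (ncl (((?x, ?y) :: _) ++ _) + _ = _)%N =>
  rewrite -[RHS](ncl_cons x y); congr (_ + ~~ _)%N; rewrite /= !linked_cons ?linked_refl ?andbT end.
- by rewrite (C c b); case: (linked L a b); case: (linked L a c); case: (linked L b c).
- by rewrite (C d c); case: (linked L b c); case: (linked L b d); case: (linked L c d).
- by rewrite (C c a); case: (linked L a c); case: (linked L a d); case: (linked L c d).
- by case: (linked L a b); case: (linked L a d); case: (linked L b d).
- by rewrite (C d b) (C c b).
- by [].
- rewrite (C d b) (C c b).
  have := tr b c d; have := tr a c b; have := tr a d c; rewrite (C d c) (C c b).
  by case: (linked L a b); case: (linked L a c); case: (linked L a d);
    case: (linked L b c); case: (linked L b d); case: (linked L c d).
Qed.

Lemma jw_relation W L :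
  (forall A, subseq A W -> noncrossing (A ++ L) a b c d) -> jw_sum W L = 0.
Proof.
elim: W L => [|e W IH] L nc; first by apply/jw_sum_nil/(nc [::]).
have catC A : linked (e :: A ++ L) =2 linked (A ++ e :: L).
  by apply: eq_linked_mem => x; rewrite !(mem_cat, inE) orbCA.
have -> : jw_sum (e :: W) L = (phi + 1) * jw_sum W (e :: L) - jw_sum W L.
  by rewrite /jw_sum !Z_cons !(Z_ext _ _ (catC _)); ring.
rewrite !IH ?mulr0 ?subr0 // => A AW.
  by apply: nc; apply: subseq_trans AW (subseq_cons _ _).
by have := nc (e :: A); rewrite /noncrossing /= eqxx !catC; apply.
Qed.

End JonesWenzl.

Ltac distinct U :=
  move: (U); rewrite /= !inE !negb_or ?andbT => ?;
  repeat match goal with H : is_true (_ && _) |- _ => case/andP: H => ? ? end;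
  repeat match goal with H : is_true (?x != ?y) |- _ =>
    lazymatch goal with
    | _ : is_true (y != x) |- _ => fail
    | _ => have : y != x by rewrite eq_sym
    end => ? end.

Ltac swap_eval :=
  rewrite ?permM; repeat match goal with
  | |- context [fun_of_perm (tperm ?x ?y) ?z] => is_var z;
    first [ constr_eq z x; rewrite (tpermL x y) | constr_eq z y; rewrite (tpermR x y)
          | rewrite (@tpermD _ x y z); [|assumption|assumption] ]
  | h : fun_of_perm ?s ?z = _ |- context [fun_of_perm ?s ?z] => rewrite h
  end.

Ltac swap_at z a :=
  have [->|?] := eqVneq z a; [by swap_eval | have ? : a != z by rewrite eq_sym].

Section Local.
Variable T : finType.
Implicit Types (W L : seq (T * T)) (s t : {perm T}) (a b c d x y z : T).

Lemma tperm_star a b c : a != b -> a != c -> b != c ->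
  (tperm b c * tperm a b = tperm a b * tperm a c)%g.
Proof.
move=> ab ac bc; have -> : tperm a c = (tperm b c ^ tperm a b)%g.
  by rewrite tpermJ tpermR tpermD // eq_sym.
by rewrite conjgE tpermV !mulgA tperm2 mul1g.
Qed.

Lemma porbit_fix s x y : s x = x -> y != x -> (x \notin porbit s y) * (y \notin porbit s x).
Proof.
move=> sx yx; suff h : y \notin porbit s x by split; rewrite // porbit_sym.
apply: contraNN yx => /porbitP[i ->]; rewrite permX; elim: i => [|i IH] //=.
by rewrite (eqP IH) sx.
Qed.

Lemma porbit_tperm_out s a b x :
  a \notin porbit s x -> b \notin porbit s x -> porbit (tperm a b * s)%g x = porbit s x.
Proof.
move=> ax bx; have ex i : ((tperm a b * s) ^+ i)%g x = (s ^+ i)%g x.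
  elim: i => [|i IH]; first by rewrite !expg0.
  rewrite !expgSr !permM IH tpermD //.
    by apply: contraNneq ax => ->; apply: mem_porbit.
  by apply: contraNneq bx => ->; apply: mem_porbit.
by apply/setP => y; apply/porbitP/porbitP => -[i ->]; exists i; rewrite ex.
Qed.

Definition star4 a b c d s := (tperm c d * (tperm b c * (tperm a b * s)))%g.
Definition pairs a b c d s := (tperm c d * (tperm a b * s))%g.

Section Four.
Variables (a b c d : T) (s : {perm T}).
Hypothesis U : uniq [:: a; b; c; d].
Hypotheses (sa : s a = a) (sb : s b = b) (sc : s c = c) (sd : s d = d).

Lemma star4_rot : star4 a b c d s = star4 b c d a s.
Proof.
distinct U; apply/permP => z; rewrite /star4 !permM; congr (s _).
by swap_at z a; swap_at z b; swap_at z c; swap_at z d; swap_eval.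
Qed.

Lemma linked_pairs : linked (graph (pairs a b c d s)) =2 linked [:: (c, d), (a, b) & graph s].
Proof.
distinct U => x y; rewrite linked_merge; last first.
  by rewrite (porbit_fix _ _).2 // !permM; swap_eval.
by move: x y; apply: eq_linked_cons; apply: linked_merge; rewrite (porbit_fix sa _).1.
Qed.

Lemma linked_star4 :
  linked (graph (star4 a b c d s)) =2 linked [:: (c, d), (b, c), (a, b) & graph s].
Proof.
distinct U => x y; rewrite linked_merge; last first.
  by rewrite (porbit_fix _ _).2 // !permM; swap_eval.
move: x y; apply: eq_linked_cons => x y; rewrite linked_merge; last first.
  by rewrite (porbit_fix _ _).2 // !permM; swap_eval.
by move: x y; apply: eq_linked_cons; apply: linked_merge; rewrite (porbit_fix sa _).1.
Qed.

Lemma porbits_pairs : #|porbits s| = #|porbits (pairs a b c d s)|.+2.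
Proof.
distinct U; rewrite (@porbit_merge _ s a b) ?(porbit_fix sa _).1 //.
by rewrite (@porbit_merge _ _ c d) // (porbit_fix _ _).2 // !permM; swap_eval.
Qed.

Lemma porbits_star4 : #|porbits s| = #|porbits (star4 a b c d s)|.+3.
Proof.
distinct U; rewrite (@porbit_merge _ s a b) ?(porbit_fix sa _).1 //.
rewrite (@porbit_merge _ _ b c) ?(porbit_fix _ _).2 //; last by rewrite !permM; swap_eval.
by rewrite (@porbit_merge _ _ c d) // (porbit_fix _ _).2 // !permM; swap_eval.
Qed.

Lemma planar_star4 W :
  planar W (star4 a b c d s) <-> planar (rcons (rcons (rcons W (c, d)) (b, c)) (a, b)) s.
Proof.
distinct U; rewrite planar_merge; last by rewrite (porbit_fix _ _).2 // !permM; swap_eval.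
rewrite planar_merge; last by rewrite (porbit_fix _ _).2 // !permM; swap_eval.
by rewrite planar_merge // (porbit_fix _ _).1.
Qed.

Lemma planar_pairs W : planar W (pairs a b c d s) <-> planar (rcons (rcons W (c, d)) (a, b)) s.
Proof.
distinct U; rewrite planar_merge; last by rewrite (porbit_fix _ _).2 // !permM; swap_eval.
by rewrite planar_merge // (porbit_fix _ _).1.
Qed.

Lemma planar_star4_pairs W : planar W (star4 a b c d s) -> planar W (pairs a b c d s).
Proof.
rewrite planar_star4 planar_pairs; apply: planar_subseq; rewrite -!cats1 -!catA /=.
by apply: cat_subseq => //=; rewrite !eqxx; case: eqP => //= _; rewrite ?eqxx.
Qed.

Lemma planar_star4_base W : planar W (star4 a b c d s) -> planar W s.
Proof.
by rewrite planar_star4; apply: planar_subseq; rewrite -!cats1 -!catA prefix_subseq.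
Qed.

Lemma planar_star4_ac W : planar W (star4 a b c d s) -> planar W (tperm a c * s)%g.
Proof.
distinct U; have -> : star4 a b c d s = (tperm c d * (tperm a b * (tperm a c * s)))%g.
  by rewrite /star4 [(tperm b c * _)%g]mulgA tperm_star // -mulgA.
rewrite planar_merge; last by rewrite (porbit_fix _ _).2 // !permM; swap_eval.
rewrite planar_merge; last by rewrite (porbit_fix _ _).2 // !permM; swap_eval.
by apply: planar_subseq; rewrite -!cats1 -!catA prefix_subseq.
Qed.

End Four.

Section NonCrossing.
Variables (a b c d : T) (s : {perm T}).
Hypothesis U : uniq [:: a; b; c; d].
Hypotheses (sa : s a = a) (sb : s b = b) (sc : s c = c) (sd : s d = d).

Let U' : uniq [:: b; c; d; a].
Proof. by move: U; rewrite -(rot_uniq 1). Qed.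

(* splitting *)
Lemma face_through W x y :
  x != y -> s x = x -> linked (W ++ graph s) x y ->
  planar W s -> planar W (tperm x y * s)%g ->
  x \in porbit (s * swaps W)%g y.
Proof.
move=> xy sx lxy; have nxy : x \notin porbit s y by rewrite (porbit_fix sx _).1 // eq_sym.
rewrite /planar => pl plt.
have n1 := porbit_merge nxy.
have n2 : ncl (W ++ graph (tperm x y * s)%g) = ncl (W ++ graph s).
  rewrite (eq_ncl (eq_linked_cat W (linked_merge nxy))).
  transitivity (ncl ((x, y) :: W ++ graph s)).
    by apply/eq_ncl/eq_linked_mem => z; rewrite !(mem_cat, inE) orbCA.
  by apply/eq_ncl/linked_cons_id.
have n3 := porbits_mul_tperm (s * swaps W)%g x y.
move: plt pl n3; rewrite !(porbits_mulC (swaps W)) -mulgA n1 n2 xy /=.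
case: (_ \in _) => //=.
move: #|_| #|_| #|_| (ncl _) (size W) => A B C e m; lia.
Qed.

Lemma planar_noncrossing W :
  planar W (star4 a b c d s) -> noncrossing (W ++ graph s) a b c d.
Proof.
move=> pl; distinct U; apply/negP => /and3P[lac lbd nab].
have pl0 : planar W s by move: pl; apply: planar_star4_base.
have plac : planar W (tperm a c * s)%g by move: pl; apply: planar_star4_ac.
have plbd : planar W (tperm b d * s)%g.
  by move: pl; rewrite star4_rot //; apply: planar_star4_ac.
pose u := (s * swaps W)%g.
have lku x y : y \in porbit u x -> linked (W ++ graph s) x y.
  apply: linked_porbit => z; apply: linked_permM => {}z.
    by apply: linked_graph_sub => e eW; rewrite mem_cat eW orbT.
  by apply: linked_swaps => e eW; rewrite mem_cat eW.
have uac : a \in porbit u c by apply: face_through.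
have ubd : b \in porbit u d by apply: face_through.
have nu x y : ~~ linked (W ++ graph s) x y -> (x \notin porbit u y) * (y \notin porbit u x).
  by move=> nxy; split; apply: contra nxy => /lku; rewrite // linkedC.
have nad : ~~ linked (W ++ graph s) a d by rewrite -(linked_eqr _ lbd).
have ncb : ~~ linked (W ++ graph s) c b by rewrite -(linked_eql _ lac).
have ncd : ~~ linked (W ++ graph s) c d by rewrite -(linked_eql _ lac) -(linked_eqr _ lbd).
pose v := (tperm a c * u)%g; pose w := (tperm b d * v)%g.
have nv : #|porbits v| = #|porbits u|.+1 by rewrite porbit_split.
have vb : porbit v b = porbit u b by rewrite porbit_tperm_out // nu.
have vd : porbit v d = porbit u d by rewrite porbit_tperm_out // nu.
have vac : a \notin porbit v c by rewrite porbit_splitted.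
have nw : #|porbits w| = #|porbits v|.+1 by rewrite porbit_split // vd.
have wa : porbit w a = porbit v a by rewrite porbit_tperm_out // porbit_sym (vb, vd) nu.
have wc : porbit w c = porbit v c by rewrite porbit_tperm_out // porbit_sym (vb, vd) nu.
have wbd : b \notin porbit w d by rewrite porbit_splitted // vd.
have wac : a \notin porbit w c by rewrite wc.
have wab : a \notin porbit w b by rewrite porbit_sym wa porbit_sym vb nu.
have wad : a \notin porbit w d by rewrite porbit_sym wa porbit_sym vd nu.
have wcb : c \notin porbit w b by rewrite porbit_sym wc porbit_sym vb nu.
have wcd : c \notin porbit w d by rewrite porbit_sym wc porbit_sym vd nu.
pose w1 := (tperm a d * w)%g; pose w2 := (tperm d c * w1)%g; pose w3 := (tperm c b * w2)%g.
have nw1 : #|porbits w| = #|porbits w1|.+1 by rewrite (porbit_merge wad).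
have w1c : porbit w1 c = porbit w c by rewrite porbit_tperm_out // porbit_sym.
have nw2 : #|porbits w1| = #|porbits w2|.+1.
  by rewrite (@porbit_merge _ _ d c) // w1c porbit_sym.
have w1b : porbit w1 b = porbit w b by rewrite porbit_tperm_out // porbit_sym.
have w2b : porbit w2 b = porbit w b by rewrite porbit_tperm_out // w1b // porbit_sym.
have nw3 : #|porbits w2| = #|porbits w3|.+1 by rewrite (@porbit_merge _ _ c b) // w2b.
have w3E : w3 = (star4 a b c d s * swaps W)%g.
  rewrite /w3 /w2 /w1 /w /v /u /star4; apply/permP => z; rewrite !permM.
  congr (swaps W (s _)).
  by swap_at z a; swap_at z b; swap_at z c; swap_at z d; swap_eval.
have nX : (ncl (W ++ graph (star4 a b c d s)) + 1)%N = ncl (W ++ graph s).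
  have lX : linked (graph (star4 a b c d s)) =2 linked [:: (c, d), (b, c), (a, b) & graph s].
    exact: linked_star4.
  rewrite (eq_ncl (eq_linked_cat W lX)).
  rewrite -(ncl_cons a b (W ++ graph s)) nab; congr (_ + 1)%N.
  transitivity (ncl [:: (c, d), (b, c), (a, b) & W ++ graph s]).
    apply/eq_ncl/eq_linked_mem => z; rewrite !(mem_cat, inE).
    by do 3!case: (_ == _); rewrite ?orbT.
  have cc : linked ((a, b) :: W ++ graph s) b c.
    by rewrite linked_cons linked_refl lac /= !orbT.
  rewrite (eq_ncl (eq_linked_cons (c, d) (linked_cons_id cc))).
  apply/eq_ncl/linked_cons_id; rewrite linked_cons.
  by rewrite [linked _ c a]linkedC lac lbd /= !orbT.
move: pl pl0; rewrite /planar !(porbits_mulC (swaps W)) -w3E -/u.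
have : #|porbits s| = #|porbits (star4 a b c d s)|.+3 by apply: porbits_star4.
move: nv nw nw1 nw2 nw3 nX; rewrite -/v -/w -/w1 -/w2 -/w3; clear; lia.
Qed.

End NonCrossing.
End Local.

Section SwapsPerm.
Variable T : finType.
Implicit Types (W L : seq (T * T)) (s t : {perm T}) (a b c d x y z : T).

Lemma tperm_swapsC a b W :
  a \notin ends W -> b \notin ends W -> (tperm a b * swaps W = swaps W * tperm a b)%g.
Proof.
elim: W => [|[c d] W IH] /=; first by rewrite swaps_nil mulg1 mul1g.
rewrite ends_cons !inE !negb_or swaps_cons /= => /and3P[ac ad aW] /and3P[bc bd bW].
rewrite -mulgA -IH // !mulgA; congr (_ * _)%g.
by rewrite conjgC tpermJ !tpermD // eq_sym.
Qed.

Lemma swaps_rem e W : e \in W -> uniq (ends W) -> swaps W = swaps (e :: rem e W).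
Proof.
elim: W => // f W IH + ufW; move: ufW; rewrite ends_cons => /and3P[].
rewrite inE negb_or => /andP[_ fi] fi' uW; rewrite inE eq_sym /=.
case: eqP => [->//|_ /= eW]; rewrite !swaps_cons IH // !swaps_cons !mulgA.
congr (_ * _)%g.
have fW : f.1 \notin ends [:: e].
  by apply: contra fi => /mem_ends[g]; rewrite inE => /eqP-> h; apply/mem_ends; exists e.
have fW' : f.2 \notin ends [:: e].
  by apply: contra fi' => /mem_ends[g]; rewrite inE => /eqP-> h; apply/mem_ends; exists e.
by have := tperm_swapsC fW fW'; rewrite swaps_cons swaps_nil mulg1.
Qed.

Lemma swaps_perm W W' : perm_eq W W' -> uniq (ends W) -> swaps W = swaps W'.
Proof.
elim: W W' => [|e W IH] W'; first by rewrite perm_sym => /perm_nilP->.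
move=> eW uW; have uW' : uniq (ends W') by rewrite -(perm_uniq (ends_perm eW)).
have eW' : e \in W' by rewrite -(perm_mem eW) mem_head.
have := perm_to_rem eW' => /(perm_trans eW); rewrite perm_cons => WW'.
rewrite (swaps_rem eW') // !swaps_cons (IH _ WW') //.
by move: uW; rewrite ends_cons => /and3P[].
Qed.

Lemma planar_perm W W' s : perm_eq W W' -> uniq (ends W) -> planar W s -> planar W' s.
Proof.
move=> WW' uW; rewrite /planar (swaps_perm WW' uW) (perm_size WW').
by rewrite (eq_ncl (linked_cat_perm _ WW')).
Qed.

Lemma planar_flip a b W s : planar ((a, b) :: W) s -> planar ((b, a) :: W) s.
Proof. by rewrite /planar !swaps_cons /= tpermC (eq_ncl (linked_flip _ _ _)). Qed.

Lemma pull_edge x W : x \in ends W -> exists y W',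
  perm_eq W ((x, y) :: W') \/ perm_eq W ((y, x) :: W').
Proof.
case/mem_ends => -[u v] uvW /orP[] /eqP /= ->.
  by exists v, (rem (u, v) W); left; apply: perm_to_rem.
by exists u, (rem (u, v) W); right; apply: perm_to_rem.
Qed.

Lemma porbit_closed (l : seq T) s x y :
  {in l, forall z, s z \in l} -> x \in l -> y \notin l -> y \notin porbit s x.
Proof.
move=> cl xl; apply: contra => /porbitP[i ->]; rewrite permX.
by elim: i => //= i IH; apply: cl.
Qed.

Lemma planar_dead W s x z :
  s x = x -> x \notin ends W -> z != x -> planar W (tperm z x * s)%g <-> planar W s.
Proof.
move=> sx xW zx.
have nxz : z \notin porbit s x by rewrite (porbit_fix sx zx).
have wx : swaps W x = x.
  elim: (W) xW => [|e V IH]; first by rewrite swaps_nil perm1.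
  rewrite ends_cons !inE !negb_or swaps_cons permM => /and3P[e1 e2 /IH].
  by rewrite tpermD // eq_sym.
have n1 := porbit_merge nxz.
have n2 : #|porbits (s * swaps W)%g| = #|porbits (tperm z x * (s * swaps W))%g|.+1.
  by apply: porbit_merge; rewrite (porbit_fix _ zx) // permM sx.
have n3 : ncl (W ++ graph s) = (ncl (W ++ graph (tperm z x * s)%g)).+1.
  rewrite (eq_ncl (eq_linked_cat W (linked_merge nxz))).
  have -> : ncl (W ++ (z, x) :: graph s) = ncl ((z, x) :: W ++ graph s).
    by apply/eq_ncl/eq_linked_mem => u; rewrite !(mem_cat, inE) orbCA.
  rewrite -(ncl_cons z x (W ++ graph s)).
  suff /negPf-> : ~~ linked (W ++ graph s) z x by rewrite addn1.
  apply/negP => /(@linked_closed _ _ (pred1 x)); rewrite !inE eqxx (negPf zx) => h.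
  suff /h : closed_under (W ++ graph s) (pred1 x) by [].
  move=> e; rewrite mem_cat => /orP[eW|].
    have ne u : (u == e.1) || (u == e.2) -> u != x.
      by move=> ue; apply: contraNneq xW => <-; apply/mem_ends; exists e.
    by rewrite !inE !(negPf (ne _ _)) // eqxx ?orbT.
  case/mapP => u _ -> /=; rewrite !inE; apply/eqP/eqP => [->//|su].
  by apply: (@perm_inj _ s); rewrite sx.
rewrite /planar !(porbits_mulC (swaps W)) -mulgA n1 n2 n3.
move: #|_| #|_| (ncl _) (size W) => A B e m; split; lia.
Qed.

End SwapsPerm.

Section Flow.
Variables (K : fieldType) (Q : K) (T : finType).
Hypothesis Q0 : Q != 0.
Implicit Types (W L : seq (T * T)) (s t : {perm T}) (a b c d x y z : T).

Definition flow W s : K := Z Q W (graph s) / Q ^+ #|porbits s|.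

Lemma flowE W s : Z Q W (graph s) = flow W s * Q ^+ #|porbits s|.
Proof. by rewrite /flow divfK ?expf_neq0. Qed.

Lemma flow_nil s : flow [::] s = 1.
Proof. by rewrite /flow /= ncl_graph divff ?expf_neq0. Qed.

Lemma flow_perm W W' s : perm_eq W W' -> flow W s = flow W' s.
Proof. by move=> WW'; rewrite /flow (Z_perm _ _ WW'). Qed.

Lemma flow_flip a b W s : flow ((a, b) :: W) s = flow ((b, a) :: W) s.
Proof. by rewrite /flow Z_flip. Qed.

Lemma flow_loop a b W s : b \in porbit s a -> flow ((a, b) :: W) s = (Q - 1) * flow W s.
Proof. by move=> ab; rewrite /flow Z_loop ?mulrA // linked_graph. Qed.

Lemma flow_cons a b W s :
  a \notin porbit s b -> flow ((a, b) :: W) s = flow W (tperm a b * s)%g - flow W s.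
Proof.
move=> ab; rewrite /flow Z_cons mulrBl; congr (_ - _).
by rewrite (Z_ext _ _ (linked_merge ab)) (porbit_merge ab) exprS invfM mulrACA divff // mul1r.
Qed.

Lemma flow_cut (M : {pred T}) a b W s :
  (forall x, (s x \in M) = (x \in M)) -> closed_under W M -> a \in M -> b \notin M ->
  flow ((a, b) :: W) s = 0.
Proof.
by move=> sM WM aM bM; rewrite /flow (Z_cut _ _ WM aM bM) ?mul0r //; apply: closed_graph.
Qed.

Lemma closed_fix s x y : s x = x -> (s y == x) = (y == x).
Proof. by move=> sx; apply/eqP/eqP => [|->//]; rewrite -{1}sx => /perm_inj. Qed.

Lemma flow_dead W s x z :
  s x = x -> x \notin ends W -> z != x -> flow W (tperm z x * s)%g = flow W s.
Proof.
move=> sx xW zx; have nzx : z \notin porbit s x by rewrite (porbit_fix sx zx).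
rewrite /flow (Z_ext _ _ (linked_merge nzx)) (porbit_merge nzx) exprS.
rewrite (Z_ext _ _ (linked_flip _ _ _)).
rewrite -(@Z_pendant _ Q _ (pred1 x) x z W (graph s)) ?inE //.
- by rewrite invfM mulrACA divff // mul1r.
- by apply: closed_graph => y; rewrite !inE closed_fix.
- by move=> y yW; rewrite inE; apply: contraNneq xW => <-.
Qed.

(* series reduction *)
Lemma flow_join a b a' b' W s :
  uniq [:: a; b; a'; b'] -> s a = b -> s b = a -> a \notin ends W -> b \notin ends W ->
  flow ((a, a') :: (b, b') :: W) s = flow ((a', b') :: W) s.
Proof.
move=> U sa sb aW bW; distinct U; rewrite /flow; congr (_ / _).
pose M := [pred x | (x == a) || (x == b)].
have clM : closed_under (graph s) M.
  apply: closed_graph => x; rewrite !inE.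
  have -> : (s x == a) = (x == b) by rewrite -[a]sb (inj_eq perm_inj).
  have -> : (s x == b) = (x == a) by rewrite -[b]sa (inj_eq perm_inj).
  by rewrite orbC.
have outW x : x \in ends W -> x \notin M.
  move=> xW; rewrite inE negb_or; apply/andP.
  by split; [move: aW|move: bW]; apply: contraNneq => <-.
have clW : closed_under W M.
  move=> e eW; rewrite (negPf (outW e.1 _)) ?(negPf (outW e.2 _)) //;
  by apply/mem_ends; exists e; rewrite ?eqxx ?orbT.
rewrite Z_cons (@Z_cut _ Q _ M b b' W (graph s)) ?inE ?eqxx ?orbT ?negb_or //; last by apply/andP.
have ab : linked (graph s) a b by rewrite -sa linked_graph1.
rewrite (@Z_pair _ Q _ b b' a' b'); first last.
- exact: linked_refl.
- rewrite linked_cons linked_refl [linked _ b a]linkedC ab.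
  by rewrite /= orbT.
rewrite subr0 (@Z_pendant _ Q _ M a a' _ (graph s)) ?inE ?eqxx ?negb_or //; first last.
  by apply/andP.
move=> x; rewrite ends_cons !inE negb_or => /or3P[/eqP->|/eqP->|/outW//]; last by rewrite inE negb_or.
all: by apply/andP.
Qed.

Lemma perm_ends_flip a b W : perm_eq (ends ((a, b) :: W)) (ends ((b, a) :: W)).
Proof. by rewrite !ends_cons; apply: (permEl (perm_catCA [:: a] [:: b] _)). Qed.

Lemma Z_leaf x W L :
  x \in ends W -> uniq (ends W) -> closed_under L (pred1 x) -> Z Q W L = 0.
Proof.
move=> xW uW clL; have [y [V WV]] := pull_edge xW.
have [uV Z1] : uniq (ends ((x, y) :: V)) /\ Z Q W L = Z Q ((x, y) :: V) L.
  case: WV => WV; rewrite (Z_perm _ _ WV) ?(Z_flip _ y) //.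
    by rewrite -(perm_uniq (ends_perm WV)).
  by rewrite (perm_uniq (perm_ends_flip _ _ _)) -(perm_uniq (ends_perm WV)).
move: uV; rewrite Z1 ends_cons /= inE negb_or => /and3P[/andP[xy xV] yV _].
apply: (@Z_cut _ Q _ (pred1 x)); rewrite ?inE ?eqxx // 1?eq_sym // => e eV.
have ne u : (u == e.1) || (u == e.2) -> u != x.
  by move=> ue; apply: contraNneq xV => <-; apply/mem_ends; exists e.
by rewrite !inE !(negPf (ne _ _)) // eqxx ?orbT.
Qed.

End Flow.

Definition hshape (T : finType) (a b c d x y : T) (s : {perm T}) : {perm T} :=
  (tperm b x * (tperm d y * pairs a b c d s))%g.

Section LocalRelations.
Variable T : finType.
Implicit Types (W L : seq (T * T)) (s t : {perm T}).

Section HShape.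
Variables (a b c d x y : T) (s : {perm T}).
Hypothesis U : uniq [:: a; b; c; d; x; y].
Hypotheses (sa : s a = a) (sb : s b = b) (sc : s c = c) (sd : s d = d).
Hypotheses (sx : s x = x) (sy : s y = y).

Lemma hshape_ports : ((tperm b x * (tperm d y * star4 a b c d s)) = tperm x y * hshape a b c d x y s)%g.
Proof.
distinct U; apply/permP => z; rewrite /hshape /pairs /star4 !permM; congr (s _).
by swap_at z a; swap_at z b; swap_at z c; swap_at z d; swap_at z x; swap_at z y; swap_eval.
Qed.

Lemma ports_fix :
  (((tperm d y * star4 a b c d s)%g x = x) * (star4 a b c d s y = y))
  * (((tperm d y * pairs a b c d s)%g x = x) * (pairs a b c d s y = y)).
Proof. by distinct U; rewrite /pairs /star4; do !split; swap_eval. Qed.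

Lemma hshape_porbit : x \notin porbit (hshape a b c d x y s) y.
Proof.
distinct U; rewrite porbit_sym; apply: (@porbit_closed _ [:: a; b; x]).
- move=> z; rewrite !inE /hshape /pairs !permM => /or3P[] /eqP ->;
  by swap_eval; rewrite eqxx ?orbT.
- by rewrite !inE eqxx !orbT.
- by rewrite !inE !negb_or; apply/and3P.
Qed.

Lemma planar_hshape W : uniq (ends W) -> x \notin ends W -> y \notin ends W ->
  planar W (star4 a b c d s) -> planar ((x, y) :: W) (hshape a b c d x y s).
Proof.
distinct U => uW xW yW pl.
have: planar W (tperm x y * hshape a b c d x y s)%g.
  by rewrite -hshape_ports planar_dead ?ports_fix // planar_dead ?ports_fix.
rewrite planar_merge ?hshape_porbit //; apply: planar_perm; first by rewrite perm_rcons.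
rewrite (perm_uniq (ends_perm (_ : perm_eq _ ((x, y) :: W)))) ?perm_rcons // ends_cons /=.
by rewrite inE negb_or xW yW uW /= !andbT.
Qed.

Lemma planar_hshapeV W : uniq (ends W) -> x \notin ends W -> y \notin ends W ->
  planar ((x, y) :: W) (hshape a b c d x y s) -> planar W (star4 a b c d s).
Proof.
distinct U => uW xW yW pl.
have: planar W (tperm x y * hshape a b c d x y s)%g.
  rewrite planar_merge ?hshape_porbit //; move: pl; apply: planar_perm.
    by rewrite perm_sym perm_rcons.
  by rewrite ends_cons /= inE negb_or xW yW uW /= !andbT.
by rewrite -hshape_ports planar_dead ?ports_fix // planar_dead ?ports_fix.
Qed.

Lemma flow_hshape (K : fieldType) (Q : K) W : Q != 0 -> x \notin ends W -> y \notin ends W ->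
  flow Q ((x, y) :: W) (hshape a b c d x y s)
  = flow Q W (star4 a b c d s) - flow Q W (pairs a b c d s).
Proof.
move=> Q0 xW yW; distinct U; rewrite flow_cons ?hshape_porbit // -hshape_ports.
congr (_ - _); first by rewrite flow_dead ?ports_fix // flow_dead ?ports_fix.
by rewrite /hshape flow_dead ?ports_fix // flow_dead ?ports_fix.
Qed.

End HShape.

Section Fibonacci.
Variables (K : fieldType) (phi : K).
Hypothesis phi2 : phi ^+ 2 = phi + 1.

Lemma phi_neq0 : phi != 0.
Proof.
by apply: contra_eq_neq phi2 => ->; rewrite expr0n add0r eq_sym oner_neq0.
Qed.

Variables (a b c d : T) (s : {perm T}).
Hypothesis U : uniq [:: a; b; c; d].
Hypotheses (sa : s a = a) (sb : s b = b) (sc : s c = c) (sd : s d = d).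

Lemma fibonacci_relation W :
  uniq (ends W) -> {subset [:: a; b; c; d] <= ends W} -> planar W (star4 a b c d s) ->
  flow (phi + 1) W (star4 a b c d s)
  = phi^-1 * (flow (phi + 1) W (pairs a b c d s) + flow (phi + 1) W (pairs b c d a s)).
Proof.
move=> uW sW pl; have ph0 := phi_neq0; have Q0 : phi + 1 != 0 by rewrite -phi2 expf_neq0.
have := @jw_relation K phi T phi2 a b c d W (graph s) _.
have leaf x A : s x = x -> x \in [:: a; b; c; d] ->
    all [pred e | (x != e.1) && (x != e.2)] A -> Z (phi + 1) W (A ++ graph s) = 0.
  move=> sx xl xA; apply: (@Z_leaf _ _ _ x) => //; first exact: sW.
  move=> e; rewrite mem_cat => /orP[eA|].
    have /= /andP[h1 h2] := allP xA _ eA; rewrite !inE.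
    by rewrite ![_ == x]eq_sym (negPf h1) (negPf h2).
  by case/mapP => u _ -> /=; rewrite !inE closed_fix.
distinct U.
have -> : jw_sum phi a b c d W (graph s) =
    - phi ^+ 3 * Z (phi + 1) W ([:: (a, b); (b, c); (c, d)] ++ graph s)
    + Z (phi + 1) W ([:: (a, b); (c, d)] ++ graph s)
    + Z (phi + 1) W ([:: (a, d); (b, c)] ++ graph s).
  rewrite /jw_sum (leaf b [:: (a, c)]) ?(leaf a [:: (b, d)]) ?(leaf c [:: (a, b)])
    ?(leaf a [:: (b, c)]) ?(leaf a [:: (c, d)]) ?(leaf b [:: (a, d)])
    ?(leaf d [:: (a, b); (b, c)]) ?(leaf a [:: (b, c); (c, d)])
    ?(leaf b [:: (c, d); (a, d)]) ?(leaf c [:: (a, d); (a, b)]) ?(leaf a [::])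
    ?inE ?eqxx ?orbT //=; first [by ring | by rewrite ?andbT; do ?[apply/andP; split]].
have lX : linked (graph (star4 a b c d s)) =2 linked ([:: (a, b); (b, c); (c, d)] ++ graph s).
  move=> u v; rewrite linked_star4 //; apply: eq_linked_mem u v => u.
  by rewrite !inE; do 3!case: (_ == _).
have l0 : linked (graph (pairs a b c d s)) =2 linked ([:: (a, b); (c, d)] ++ graph s).
  by move=> u v; rewrite linked_pairs //; apply: linked_consA.
have l1 : linked (graph (pairs b c d a s)) =2 linked ([:: (a, d); (b, c)] ++ graph s).
  have U' : uniq [:: b; c; d; a] by move: U; rewrite -(rot_uniq 1).
  by move=> u v; rewrite linked_pairs //; apply: (linked_flip d a).
rewrite -(Z_ext _ _ lX) -(Z_ext _ _ l0) -(Z_ext _ _ l1) !flowE //.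
have nX : #|porbits s| = #|porbits (star4 a b c d s)|.+3 by apply: porbits_star4.
have n0 : #|porbits s| = #|porbits (pairs a b c d s)|.+2 by apply: porbits_pairs.
have n1 : #|porbits s| = #|porbits (pairs b c d a s)|.+2.
  by apply: porbits_pairs => //; move: U; rewrite -(rot_uniq 1).
have [m0 m1] : #|porbits (pairs a b c d s)| = #|porbits (star4 a b c d s)|.+1 /\
    #|porbits (pairs b c d a s)| = #|porbits (star4 a b c d s)|.+1 by move: nX n0 n1; clear; lia.
rewrite m0 m1; move: #|porbits (star4 _ _ _ _ _)| (flow _ W (star4 a b c d s)) => n X.
move: (flow _ W (pairs a b c d s)) (flow _ W (pairs b c d a s)) => S0 S1 h.
have /h : forall A, subseq A W -> noncrossing (A ++ graph s) a b c d.
  by move=> A AW; apply: planar_noncrossing => //; apply: planar_subseq AW pl.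
have -> : - phi ^+ 3 * (X * (phi + 1) ^+ n) + S0 * (phi + 1) ^+ n.+1 + S1 * (phi + 1) ^+ n.+1
   = (phi + 1) ^+ n * phi ^+ 2 * (- phi * X + S0 + S1) by rewrite [_ ^+ n.+1]exprS; ring: phi2.
move/eqP; rewrite !mulf_eq0 !expf_eq0 (negPf Q0) (negPf ph0) !andbF /= => /eqP e0.
apply: (mulfI ph0); rewrite mulVKf //; apply/eqP; rewrite eq_sym -subr_eq0; apply/eqP.
by rewrite -e0; ring.
Qed.

End Fibonacci.
End LocalRelations.

Ltac neq_eval := repeat match goal with
  | H : is_true (?x != ?y) |- context [?x == ?y] => rewrite (negPf H)
  end; rewrite ?eqxx.

Section LocalChange.
Variable T : finType.
Implicit Types (W L : seq (T * T)) (s t : {perm T}) (E l : seq T).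

Definition bivalent s : pred T := [pred z | (s z != z) && (s (s z) == z)].
Definition nbiv s : nat := #|bivalent s|./2.

Definition good E W s : Prop :=
  [/\ uniq (ends W), forall z, z \notin ends W -> s z = z
    & forall z, z \in ends W -> z \notin E -> s z != z /\ (s (s z) = z \/ s (s (s z)) = z)].

Lemma away l s t z :
  {in l, forall u, s u = u} -> (forall u, u \notin l -> t u = s u) -> z \notin l ->
  [/\ t z = s z, t (t z) = s (s z) & t (t (t z)) = s (s (s z))].
Proof.
move=> sl tl; have out u : u \notin l -> s u \notin l.
  by apply: contra => sul; rewrite -(perm_inj (sl _ sul)).
by move=> zl; rewrite tl // tl ?out // tl ?out.
Qed.

Lemma card_bivalent_local l s t :
  uniq l -> {in l, forall u, s u = u} -> (forall u, u \notin l -> t u = s u) ->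
  #|bivalent t| = (#|bivalent s| + count (bivalent t) l)%N.
Proof.
move=> ul sl tl; rewrite -(cardID (mem l) (bivalent t)) addnC; congr (_ + _)%N.
  apply: eq_card => z; rewrite !inE; have [zl|zl] := boolP (z \in l).
    by rewrite sl // eqxx.
  by have [-> -> _] := away sl tl zl.
rewrite -size_filter -(card_uniqP (filter_uniq _ ul)).
by apply: eq_card => z; rewrite !inE mem_filter andbC.
Qed.

Lemma good_mem E W W' s : perm_eq (ends W) (ends W') -> good E W s -> good E W' s.
Proof.
by move=> p [h1 h2 h3]; split=> [|z|z]; rewrite -?(perm_uniq p) -?(perm_mem p); auto.
Qed.

Lemma planar_join a b a' b' W s :
  uniq [:: a; b; a'; b'] -> a \notin ends W -> b \notin ends W ->
  a \notin porbit s b ->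
  planar ((a, a') :: (b, b') :: W) (tperm a b * s)%g -> planar ((a', b') :: W) s.
Proof.
move=> U aW bW ab; rewrite planar_merge // => pl; distinct U.
suff : planar [:: (a', b), (b', a), (a', b') & W] s.
  by move/(@planar_del _ [::])/(@planar_del _ [::]).
have sw : swaps [:: (a', b), (b', a), (a', b') & W] = swaps (rcons ((a, a') :: (b, b') :: W) (a, b)).
  rewrite -cats1 swaps_cat !swaps_cons swaps_nil mulg1 -!mulgA -tperm_swapsC //=.
  rewrite !mulgA; congr (_ * _)%g; apply/permP => z; rewrite !permM.
  by swap_at z a; swap_at z b; swap_at z a'; swap_at z b'; swap_eval.
move: pl; rewrite /planar -sw size_rcons => ->; congr (_ + _.*2)%N.
set M := W ++ graph s.
have ab1 L : linked ((a, b) :: L) a b by apply/linked_mem/mem_head.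
transitivity (ncl [:: (b, b'), (a, a'), (a, b) & M]).
  apply/eq_ncl/eq_linked_mem => z; rewrite cat_rcons !(inE, mem_cat).
  by do 3!case: (_ == _); rewrite ?orbT.
transitivity (ncl [:: (b, b'), (b, a'), (a, b) & M]).
  by apply/eq_ncl/eq_linked_cons/eq_linked_pair; rewrite ?linked_refl.
transitivity (ncl [:: (a', b'), (b, a'), (a, b) & M]).
  by apply/eq_ncl/eq_linked_pair; rewrite ?linked_refl //; apply/linked_mem/mem_head.
transitivity (ncl [:: (a, b), (a', b'), (b, a') & M]).
  apply/eq_ncl/eq_linked_mem => z; rewrite !inE.
  by do 3!case: (_ == _); rewrite ?orbT.
transitivity (ncl [:: (a, b'), (a', b'), (b, a') & M]).
  apply/eq_ncl/eq_linked_pair; rewrite ?linked_refl //.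
  by apply: (@linked_trans _ _ a'); apply/linked_mem; rewrite !inE eqxx ?orbT.
transitivity (ncl [:: (b', a), (b, a'), (a', b') & M]).
  by rewrite (eq_ncl (linked_flip _ _ _)); apply/eq_ncl/eq_linked_cons/linked_consA.
by rewrite (eq_ncl (linked_consA _ _ _)) (eq_ncl (linked_flip _ _ _)).
Qed.

End LocalChange.

Section GoldenIdentity.
Variables (K : fieldType) (phi : K).
Hypothesis phi2 : phi ^+ 2 = phi + 1.
Hypothesis phi5 : phi + 2 != 0.

Definition golden (T : finType) (W : seq (T * T)) (s : {perm T}) : Prop :=
  phi ^+ nbiv s * flow (phi + 2) W s = phi ^+ size W * flow (phi + 1) W s ^+ 2.

Let ph0 : phi != 0. Proof. exact: phi_neq0 phi2. Qed.
Let Q20 : phi + 1 != 0. Proof. by rewrite -phi2 expf_neq0. Qed.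

Variable T : finType.
Implicit Types (W L : seq (T * T)) (s t : {perm T}).

Lemma golden0 W s : (forall Q : K, Q != 0 -> flow Q W s = 0) -> golden W s.
Proof. by move=> h; rewrite /golden !h // expr0n mulr0 mulr0. Qed.

Lemma pull E W s x : x \in ends W -> good E W s -> planar W s ->
  exists y V, [/\ good E ((x, y) :: V) s, planar ((x, y) :: V) s, size W = (size V).+1
    & forall Q : K, flow Q W s = flow Q ((x, y) :: V) s].
Proof.
move=> xW gW pl; have uW : uniq (ends W) by case: gW.
have [y [V [WV|WV]]] := pull_edge xW; exists y, V; split.
- exact: good_mem (ends_perm WV) gW.
- exact: planar_perm WV uW pl.
- by rewrite (perm_size WV).
- by move=> Q; apply: flow_perm.
- by apply: good_mem gW; apply: perm_trans (ends_perm WV) (perm_ends_flip _ _ _).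
- by apply/planar_flip; apply: planar_perm WV uW pl.
- by rewrite (perm_size WV).
- by move=> Q; rewrite (flow_perm _ _ WV) flow_flip.
Qed.

Lemma pull2 E e V s x : x \in ends V -> good E (e :: V) s -> planar (e :: V) s ->
  exists y U, [/\ good E (e :: (x, y) :: U) s, planar (e :: (x, y) :: U) s,
    size V = (size U).+1
    & forall Q : K, flow Q (e :: V) s = flow Q (e :: (x, y) :: U) s].
Proof.
move=> xV gV pl; have uV : uniq (ends (e :: V)) by case: gV.
have sw f U : perm_eq (e :: f :: U) (f :: e :: U) := permEl (perm_catCA [:: e] [:: f] U).
have [y [U [VU|VU]]] := pull_edge xV; exists y, U.
  have p : perm_eq (e :: V) (e :: (x, y) :: U) by rewrite perm_cons.
  split; [exact: good_mem (ends_perm p) gV|exact: planar_perm p uV pl| |].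
    by rewrite (perm_size VU).
  by move=> Q; apply: flow_perm.
have p : perm_eq (e :: V) ((y, x) :: e :: U).
  by apply: perm_trans (sw _ _); rewrite perm_cons.
have p' : perm_eq (ends (e :: V)) (ends ((x, y) :: e :: U)).
  exact: perm_trans (ends_perm p) (perm_ends_flip _ _ _).
have q : perm_eq ((x, y) :: e :: U) (e :: (x, y) :: U) by rewrite perm_sym.
split.
- by apply: good_mem gV; apply: perm_trans p' (ends_perm q).
- apply: (planar_perm q); first by rewrite -(perm_uniq p').
  by apply/planar_flip/(planar_perm p uV pl).
- by rewrite (perm_size VU).
- by move=> Q; rewrite (flow_perm _ _ p) flow_flip (flow_perm _ _ q).
Qed.

Lemma golden_pull W V s : size W = size V ->
  (forall Q : K, flow Q W s = flow Q V s) -> golden V s -> golden W s.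
Proof. by rewrite /golden => -> WV; rewrite !WV. Qed.

Lemma flow_bridge (Q : K) u v V s : Q != 0 -> uniq (ends ((u, v) :: V)) ->
  planar ((u, v) :: V) s -> v \in porbit (swaps ((u, v) :: V) * s)%g u ->
  flow Q ((u, v) :: V) s = 0.
Proof.
move=> Q0 uV pl vu; have uv : u != v.
  by move: uV; rewrite ends_cons /= inE negb_or => /andP[/andP[]].
have pl' := @planar_del _ [::] _ _ _ pl.
have vu' : u \notin porbit (swaps V * s)%g v.
  have -> : (swaps V * s = tperm u v * (swaps ((u, v) :: V) * s))%g.
    by rewrite swaps_cons -mulgA tpermMK.
  by rewrite porbit_splitted // porbit_sym.
have nlk : ~~ linked (V ++ graph s) u v.
  have n1 := porbit_merge vu'; have := ncl_cons u v (V ++ graph s).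
  move: pl pl' n1; rewrite /planar swaps_cons -mulgA /=.
  case: (linked _ u v) => //=; move: #|_| #|_| #|_| (ncl _) (ncl _) (size V) => A B C e e' m.
  by clear; lia.
pose M := [pred z | linked (V ++ graph s) u z].
have clM : closed_under (V ++ graph s) M by move=> e /(@closed_class _ _ u).
apply: (@flow_cut _ Q _ M).
- move=> x; rewrite !inE -(linked_eqr _ (linked_graph_sub x _)) // => e eG.
  by rewrite mem_cat eG orbT.
- by move=> e eV; apply: clM; rewrite mem_cat eV.
- by rewrite inE linked_refl.
- by rewrite inE.
Qed.

Lemma golden_bivalent W s a :
  good [::] W s -> planar W s -> a \in ends W -> s (s a) = a ->
  (forall V t, (size V < size W)%N -> good [::] V t -> planar V t -> golden V t) ->
  golden W s.
Proof.
move=> gW plW aW sa2 IH; have sa : s a != a by case: gW => _ _ /(_ _ aW isT)[].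
set b := s a in sa sa2.
have [a' [V [gV plV szV flV]]] := pull aW gW plW.
apply: (golden_pull _ flV) => //.
pose t := (tperm a b * s)%g.
have ab : a != b by rewrite eq_sym.
have ta : t a = a by rewrite /t permM tpermL.
have tb : t b = b by rewrite /t permM tpermR.
have tz z : z \notin [:: a; b] -> t z = s z.
  rewrite !inE negb_or => /andP[za zb]; rewrite /t permM tpermD //; by rewrite eq_sym.
have sE : s = (tperm a b * t)%g by rewrite tpermMK.
have nb : nbiv s = (nbiv t).+1.
  rewrite /nbiv (@card_bivalent_local _ [:: a; b] t s).
  - rewrite /= /bivalent /= -/b sa2 -/b.
    by rewrite sa ab !eqxx !addnS addn0.
  - by rewrite /= inE ab.
  - by move=> u; rewrite !inE => /orP[] /eqP->.
  - by move=> u /tz.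
have plt U : planar U s -> planar U t.
  by apply: planar_split => //; rewrite porbit_sym; apply: (mem_porbit s 1).
have abt : a \notin porbit t b by rewrite (porbit_fix ta).
have goodt W0 U : good [::] W0 s -> uniq (ends U) ->
   a \notin ends U -> b \notin ends U ->
   (forall z, z \notin [:: a; b] -> (z \in ends U) = (z \in ends W0)) -> good [::] U t.
  case=> uV1 h2 h3 uU aU bU mU; split=> // z.
    have [|zl zU] := boolP (z \in [:: a; b]); first by rewrite !inE => /orP[] /eqP->.
    by rewrite tz // h2 // -mU.
  move=> zU _; have zl : z \notin [:: a; b].
    by apply: contraTN zU; rewrite !inE => /orP[] /eqP->.
  have [|u /tz //|//|e1 e2 e3] := @away _ [:: a; b] t s z.
    by move=> u; rewrite !inE => /orP[] /eqP->.
  rewrite -e3 -e2 -e1.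
  by apply: h3 => //; rewrite -mU.
have [ba'|ba'] := eqVneq a' b.
  subst a'; move: (gV) => [+ _ _]; rewrite ends_cons /= inE negb_or => /and3P[/andP[_ aV] bV uV].
  have gVt : good [::] V t.
    apply: goodt gV _ _ _ _ => // z; rewrite ends_cons !inE negb_or.
    by case/andP => /negPf-> /negPf->.
  have plVt : planar V t by apply/plt/(@planar_del _ [::] _ _ _ plV).
  have fl (Q : K) : Q != 0 -> flow Q ((a, b) :: V) s = (Q - 1) * flow Q V t.
    move=> Q0; rewrite flow_loop; last exact: (mem_porbit s 1).
    by rewrite {1}sE flow_dead.
  have := IH V t; rewrite szV /golden ltnS leqnn => /(_ isT gVt plVt) e.
  rewrite !fl // nb /= !exprS.
  transitivity (phi * (phi + 2 - 1) * (phi ^+ nbiv t * flow (phi + 2) V t)); first by ring.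
  by rewrite e; ring: phi2.
have bV : b \in ends V.
  case: gV => uV h2 _; have : b \in ends ((a, a') :: V).
    by apply/negPn/negP => /h2 sbb; move: sa; rewrite -sa2 sbb eqxx.
  by rewrite ends_cons !inE (negPf sa) eq_sym (negPf ba').
have [b' [U [gU plU szU flU]]] := pull2 bV gV plV.
apply: (golden_pull _ flU); first by rewrite /= szU.
have uU : uniq [:: a, a', b, b' & ends U] by case: gU; rewrite !ends_cons.
have Q4 : uniq [:: a; b; a'; b'].
  move: uU; rewrite /= !inE !negb_or -!andbA.
  do 10![case/andP => ?]; rewrite !andbT => ?.
  by do ![apply/andP; split] => //; rewrite eq_sym.
have [aU bU] : a \notin ends U /\ b \notin ends U.
  by move: uU; rewrite /= !inE !negb_or -!andbA; do 10![case/andP => ?].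
have fl (Q : K) : Q != 0 -> flow Q [:: (a, a'), (b, b') & U] s = flow Q ((a', b') :: U) t.
  move=> Q0; rewrite flow_join // {1}sE flow_dead //.
  rewrite ends_cons !inE !negb_or bU andbT.
  by move: Q4; rewrite /= !inE !negb_or -!andbA => /and5P[_ _ _ -> /andP[-> _]].
have gUt : good [::] ((a', b') :: U) t.
  apply: goodt gU _ _ _ _.
  - by move: uU; rewrite !ends_cons /= !inE !negb_or -!andbA;
    do 10![case/andP => ?]; move=> ?; do ![apply/andP; split].
  - rewrite ends_cons !inE !negb_or aU andbT.
    by move: Q4; rewrite /= !inE !negb_or -!andbA => /and5P[_ -> -> _ _].
  - rewrite ends_cons !inE !negb_or bU andbT.
    by move: Q4; rewrite /= !inE !negb_or -!andbA => /and5P[_ _ _ -> /andP[-> _]].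
  - move=> z; rewrite !ends_cons !inE negb_or.
    by case/andP => /negPf-> /negPf->.
have plUt : planar ((a', b') :: U) t.
  by apply: (planar_join Q4) => //; rewrite -sE.
have := IH ((a', b') :: U) t; rewrite szV szU /golden /= => /(_ (ltnSn _) gUt plUt) e.
by rewrite !fl // nb [phi ^+ (nbiv t).+1]exprS -mulrA e [in RHS]exprS mulrA.
Qed.

End GoldenIdentity.

Section LocalGood.
Variable T : finType.
Implicit Types (W L : seq (T * T)) (s t : {perm T}) (E l : seq T).

Lemma good_local E0 E W0 W l s0 s t :
  good E0 W0 s -> (forall z, z \notin l -> z \notin E -> z \notin E0) -> {in l, forall u, s0 u = u} ->
  (forall u, u \notin l -> s u = s0 u) -> (forall u, u \notin l -> t u = s0 u) ->
  uniq (ends W) -> (forall z, z \notin l -> (z \in ends W) = (z \in ends W0)) ->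
  {in l, forall z, z \notin ends W -> t z = z} ->
  {in l, forall z, z \in ends W -> t z != z /\ (t (t z) = z \/ t (t (t z)) = z)} ->
  good E W t.
Proof.
case=> _ h2 h3 EE s0l sl tl uW mW dead live; split=> // z.
  have [/dead//|zl zW] := boolP (z \in l).
  by rewrite tl // -sl // h2 // -mW.
have [/live h zW _|zl zW zE] := boolP (z \in l); first exact: h.
have [-> -> ->] := away s0l tl zl; have [<- <- <-] := away s0l sl zl.
by apply: h3; [rewrite -mW|apply: EE].
Qed.

End LocalGood.

Section Local6.
Variables (T : finType) (a b c d x y : T) (s : {perm T}).
Hypothesis U : uniq [:: a; b; c; d; x; y].
Hypotheses (sa : s a = a) (sb : s b = b) (sc : s c = c) (sd : s d = d).
Hypotheses (sx : s x = x) (sy : s y = y).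
Let six := [:: a; b; c; d; x; y].

Lemma six_fix : {in six, forall u, s u = u}.
Proof. by move=> u; rewrite !inE => /or4P[| | |/or3P[]] /eqP->. Qed.

Lemma off_six u : u \notin six -> forall z, z \in six -> z != u /\ u != z.
Proof. by move=> uN z zs; split; apply: contraNneq uN => e; rewrite -?e ?e //; rewrite -e. Qed.

Lemma pairs_off u : u \notin six -> pairs a b c d s u = s u.
Proof.
move=> uN; have o := off_six uN; rewrite /pairs !permM !tpermD //;
by apply: (o _ _).1; rewrite !inE eqxx ?orbT.
Qed.

Lemma star4_off u : u \notin six -> star4 a b c d s u = s u.
Proof.
move=> uN; have o := off_six uN; rewrite /star4 !permM !tpermD //;
by apply: (o _ _).1; rewrite !inE eqxx ?orbT.
Qed.

Lemma hshape_off u : u \notin six -> hshape a b c d x y s u = s u.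
Proof.
move=> uN; have o := off_six uN; rewrite /hshape !permM !tpermD ?pairs_off //;
by apply: (o _ _).1; rewrite !inE eqxx ?orbT.
Qed.

Lemma pairs_values (p := pairs a b c d s) :
  [/\ p a = b, p b = a, p c = d, p d = c & p x = x /\ p y = y].
Proof. by distinct U; rewrite /p /pairs; do !split; swap_eval. Qed.

Lemma star4_values (p := star4 a b c d s) :
  [/\ p a = b, p b = c, p c = d, p d = a & p x = x /\ p y = y].
Proof. by distinct U; rewrite /p /star4; do !split; swap_eval. Qed.

Lemma hshape_values (p := hshape a b c d x y s) :
  [/\ p a = b, p b = x, p x = a & [/\ p c = d, p d = y & p y = c]].
Proof. by distinct U; rewrite /p /hshape /pairs; do !split; swap_eval. Qed.

Lemma nbiv_pairs : nbiv (pairs a b c d s) = (nbiv s).+2.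
Proof.
rewrite /nbiv (card_bivalent_local U six_fix pairs_off) /= /bivalent /=.
have [e1 e2 e3 e4 [e5 e6]] := pairs_values; rewrite !(e1, e2, e3, e4, e5, e6).
by distinct U; neq_eval; rewrite /= !add0n !add1n !addnS addn0.
Qed.

Lemma nbiv_star4 : nbiv (star4 a b c d s) = nbiv s.
Proof.
rewrite /nbiv (card_bivalent_local U six_fix star4_off) /= /bivalent /=.
have [e1 e2 e3 e4 [e5 e6]] := star4_values; rewrite !(e1, e2, e3, e4, e5, e6).
by distinct U; neq_eval; rewrite /= !addn0.
Qed.

Lemma nbiv_hshape : nbiv (hshape a b c d x y s) = nbiv s.
Proof.
rewrite /nbiv (card_bivalent_local U six_fix hshape_off) /= /bivalent /=.
have [e1 e2 e3 [e4 e5 e6]] := hshape_values; rewrite !(e1, e2, e3, e4, e5, e6).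
by distinct U; neq_eval; rewrite /= !addn0.
Qed.

Lemma good_pairs E0 E W0 W s1 : good E0 W0 s1 ->
  (forall z, z \notin six -> z \notin E -> z \notin E0) -> (forall u, u \notin six -> s1 u = s u) ->
  uniq (ends W) -> (forall z, z \notin six -> (z \in ends W) = (z \in ends W0)) ->
  x \notin ends W -> y \notin ends W -> {subset [:: a; b; c; d] <= ends W} ->
  good E W (pairs a b c d s).
Proof.
move=> g EE s1E uW mW xW yW sW; have [e1 e2 e3 e4 [e5 e6]] := pairs_values.
distinct U; apply: (good_local g EE six_fix s1E (@pairs_off)) => // z.
  rewrite !inE => zs zW; move: zs zW.
  have live : all (fun u => u \in ends W) [:: a; b; c; d] by apply/allP.
  case/and5P: live => aW bW cW dW _.
  by case/or4P => [| | |/or3P[]] /eqP->; rewrite ?aW ?bW ?cW ?dW ?e5 ?e6.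
rewrite !inE => zs zW; move: zs zW.
case/or4P => [| | |/or3P[]] /eqP->; rewrite ?(negPf xW) ?(negPf yW) // => _;
by rewrite !(e1, e2, e3, e4); split=> //; left.
Qed.

Lemma good_hshape E0 E W0 W s1 : good E0 W0 s1 ->
  (forall z, z \notin six -> z \notin E -> z \notin E0) -> (forall u, u \notin six -> s1 u = s u) ->
  uniq (ends W) -> (forall z, z \notin six -> (z \in ends W) = (z \in ends W0)) ->
  {subset six <= ends W} ->
  good E W (hshape a b c d x y s).
Proof.
move=> g EE s1E uW mW sW; have [e1 e2 e3 [e4 e5 e6]] := hshape_values.
distinct U; apply: (good_local g EE six_fix s1E (@hshape_off)) => // z zs zW.
  by rewrite sW in zW.
move: zs; rewrite !inE.
case/or4P => [| | |/or3P[]] /eqP->;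
by rewrite !(e1, e2, e3, e4, e5, e6); split=> //; right.
Qed.

End Local6.

Section Flip.
Variables (K : fieldType) (phi : K).
Hypothesis phi2 : phi ^+ 2 = phi + 1.
Hypothesis phi5 : phi + 2 != 0.
Variable T : finType.
Implicit Types (W L : seq (T * T)) (s t : {perm T}).
Local Notation golden := (golden phi).

Let ph0 : phi != 0. Proof. exact: phi_neq0 phi2. Qed.
Let Q20 : phi + 1 != 0. Proof. by rewrite -phi2 expf_neq0. Qed.

Lemma uniq_rot4 (a b c d x y : T) : uniq [:: a; b; c; d; x; y] -> uniq [:: b; c; d; a; x; y].
Proof.
rewrite -(perm_uniq (_ : perm_eq [:: b; c; d; a; x; y] _)) //.
exact: (permEl (perm_catCA [:: b; c; d] [:: a] [:: x; y])).
Qed.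

Lemma uniq_take4 (a b c d x y : T) : uniq [:: a; b; c; d; x; y] -> uniq [:: a; b; c; d].
Proof. by move/(take_uniq 4). Qed.

Lemma golden_flip (a b c d x y : T) s W : uniq [:: a; b; c; d; x; y] ->
  {in [:: a; b; c; d; x; y], forall u, s u = u} ->
  uniq (ends W) -> x \notin ends W -> y \notin ends W -> {subset [:: a; b; c; d] <= ends W} ->
  planar W (star4 a b c d s) ->
  golden ((x, y) :: W) (hshape b c d a x y s) ->
  golden W (pairs a b c d s) -> golden W (pairs b c d a s) ->
  golden ((x, y) :: W) (hshape a b c d x y s).
Proof.
move=> U sU uW xW yW sW pl; have U' := uniq_rot4 U; have U4 := uniq_take4 U.
have [sa sb sc sd [sx sy]] : [/\ s a = a, s b = b, s c = c, s d = d & s x = x /\ s y = y].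
  by do !split; apply: sU; rewrite !inE eqxx ?orbT.
have X : flow (phi + 1) W (star4 a b c d s) = _ :=
  fibonacci_relation phi2 U4 sa sb sc sd uW sW pl.
rewrite /golden (nbiv_pairs U) // (nbiv_pairs U') // (nbiv_hshape U) // (nbiv_hshape U') //.
rewrite !(flow_hshape U) // !(flow_hshape U') // -(star4_rot s U4) X /=.
move: (nbiv s) (size W) (flow _ W (star4 a b c d s)) => n k x1.
move: (flow (phi + 1) W (pairs a b c d s)) (flow (phi + 1) W (pairs b c d a s)) => p2 q2.
move: (flow _ W (pairs a b c d s)) (flow _ W (pairs b c d a s)) => p1 q1 e0 e1 e2.
have e1' : phi ^+ n * p1 = phi ^+ k / phi ^+ 2 * p2 ^+ 2.
  by rewrite mulrAC -e1 !exprS; field.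
have e2' : phi ^+ n * q1 = phi ^+ k / phi ^+ 2 * q2 ^+ 2.
  by rewrite mulrAC -e2 !exprS; field.
have -> : phi ^+ n * (x1 - p1) = phi ^+ n * (x1 - q1) + phi ^+ n * q1 - phi ^+ n * p1 by ring.
rewrite e0 e1' e2' exprS.
have -> : phi * phi ^+ k * (phi^-1 * (p2 + q2) - q2) ^+ 2
   = phi ^+ k / phi * ((p2 + q2) - phi * q2) ^+ 2 by field.
have -> : phi * phi ^+ k * (phi^-1 * (p2 + q2) - p2) ^+ 2
   = phi ^+ k / phi * ((p2 + q2) - phi * p2) ^+ 2 by field.
have key : (p2 + q2 - phi * q2) ^+ 2 = (p2 + q2 - phi * p2) ^+ 2 + (p2 ^+ 2 - q2 ^+ 2) / phi.
  apply: (mulfI ph0); by rewrite mulrDr [phi * (_ / phi)]mulrC divfK //; ring: phi2.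
by rewrite key; field.
Qed.

End Flip.

Section Trivalent.
Variables (K : fieldType) (phi : K).
Hypothesis phi2 : phi ^+ 2 = phi + 1.
Hypothesis phi5 : phi + 2 != 0.
Variable T : finType.
Implicit Types (W L : seq (T * T)) (s t : {perm T}).
Local Notation golden := (golden phi).

Let ph0 : phi != 0. Proof. exact: phi_neq0 phi2. Qed.
Let Q20 : phi + 1 != 0. Proof. by rewrite -phi2 expf_neq0. Qed.

Lemma swaps_out W z : z \notin ends W -> swaps W z = z.
Proof.
elim: W => [|e V IH]; first by rewrite swaps_nil perm1.
rewrite ends_cons !inE !negb_or swaps_cons permM => /and3P[e1 e2 /IH].
by rewrite tpermD // eq_sym.
Qed.

Lemma swaps_head u v W : uniq (ends ((u, v) :: W)) -> swaps ((u, v) :: W) u = v.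
Proof.
rewrite ends_cons swaps_cons permM /= tpermL inE negb_or => /and3P[_ vW _].
exact: swaps_out.
Qed.

Lemma swapsK W : uniq (ends W) -> involutive (swaps W).
Proof.
elim: W => [|[u v] W IH] uW z; first by rewrite swaps_nil !perm1.
have := uW; rewrite ends_cons /= inE negb_or => /and3P[/andP[uv uo] vo uW'].
have e : swaps ((u, v) :: W) = (swaps W * tperm u v)%g by rewrite swaps_cons tperm_swapsC.
by rewrite {1}e swaps_cons !permM /= IH // tpermK.
Qed.

Lemma pull_swaps W z : uniq (ends W) -> z \in ends W -> exists y V,
  [/\ perm_eq (ends W) (ends ((z, y) :: V)), swaps W = swaps ((z, y) :: V),
      forall s, planar W s -> planar ((z, y) :: V) s
    & forall (Q : K) s, flow Q W s = flow Q ((z, y) :: V) s].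
Proof.
move=> uW zW; have [y [V [WV|WV]]] := pull_edge zW; exists y, V; split.
- exact: ends_perm.
- exact: swaps_perm.
- by move=> s; apply: planar_perm.
- by move=> Q s; apply: flow_perm.
- exact: perm_trans (ends_perm WV) (perm_ends_flip _ _ _).
- by rewrite (swaps_perm WV uW) !swaps_cons /= tpermC.
- by move=> s pl; apply/planar_flip; apply: planar_perm WV uW pl.
- by move=> Q s; rewrite (flow_perm _ _ WV) flow_flip.
Qed.

Lemma swaps_mem W z : uniq (ends W) -> z \in ends W -> swaps W z \in ends W /\ swaps W z != z.
Proof.
move=> uW zW; have [y [V [p sw _ _]]] := pull_swaps uW zW.
have uV : uniq (ends ((z, y) :: V)) by rewrite -(perm_uniq p).
rewrite sw (perm_mem p) swaps_head // ends_cons !inE eqxx orbT; split=> //.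
by move: uV; rewrite ends_cons /= inE negb_or eq_sym => /andP[/andP[]].
Qed.

Lemma flow_bridge_at (Q : K) W s z : Q != 0 -> uniq (ends W) -> planar W s -> z \in ends W ->
  swaps W z \in porbit (swaps W * s)%g z -> flow Q W s = 0.
Proof.
move=> Q0 uW pl zW; have [y [V [p sw plV ->]]] := pull_swaps uW zW.
have uV : uniq (ends ((z, y) :: V)) by rewrite -(perm_uniq p).
by rewrite sw swaps_head // => zo; apply: flow_bridge => //; apply: plV.
Qed.

Lemma golden_trivalent m W s z :
  good [::] W s -> planar W s -> {in ends W, forall u, s (s u) != u} -> z \in ends W ->
  (#|porbit (swaps W * s)%g z| <= m)%N ->
  (forall V t, (size V < size W)%N -> good [::] V t -> planar V t -> golden V t) ->
  golden W s.
Proof.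
elim: m W s z => [|m IHm] W s c gW plW tri cW le IH.
  by move: le; rewrite leqn0 (negPf (card_porbit_neq0 _ _)).
have [uW dead live] := gW.
have s3 u : u \in ends W -> s (s (s u)) = u.
  by move=> uW'; have [] := live u uW' isT => _ [] // /eqP h; have := tri u uW'; rewrite h.
have sW u : u \in ends W -> s u \in ends W.
  move=> uW'; apply/negPn/negP => /dead e; have [] := live u uW' isT.
  by move: e => /perm_inj ->; rewrite eqxx.
pose d := s c; pose y := s d.
have dW : d \in ends W by apply: sW.
have yW : y \in ends W by apply: sW.
have sy : s y = c by apply: s3.
pose x := swaps W y; have [xW xy] := swaps_mem uW yW.
have [V [pV swV plV flV]] : exists V, [/\ perm_eq (ends W) (ends ((x, y) :: V)),
     swaps W = swaps ((x, y) :: V),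
     forall s, planar W s -> planar ((x, y) :: V) s
    & forall (Q : K) s, flow Q W s = flow Q ((x, y) :: V) s].
  have [y' [V [p sw pl fl]]] := pull_swaps uW xW; exists V.
  suff <- : y' = y by [].
  rewrite -(@swaps_head x y' V) -?sw; last by rewrite -(perm_uniq p).
  by rewrite /x swapsK.
have szV : size W = (size V).+1.
  by have := perm_size pV; rewrite ends_cons /= !size_ends -doubleS => /double_inj.
suff: golden ((x, y) :: V) s by rewrite /golden szV !flV.
have gV : good [::] ((x, y) :: V) s by apply: good_mem gW.
have uV : uniq (ends ((x, y) :: V)) by case: gV.
have plV' : planar ((x, y) :: V) s by apply: plV.
have [xV yV uVV] : [/\ x \notin ends V, y \notin ends V & uniq (ends V)].
  by move: uV; rewrite ends_cons /= inE negb_or => /and3P[/andP[]].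
have dc : d != c by have [] := live c cW isT.
have yd : y != d by have [] := live d dW isT.
have yc : y != c by apply: tri.
have mV u : u != x -> u != y -> (u \in ends V) = (u \in ends W).
  by move=> ux uy; rewrite (perm_mem pV) ends_cons !inE (negPf ux) (negPf uy).
have loop u : u \in ends V -> {in ends V, forall v, v \in [:: c; d; y] -> v = u} ->
    u \in [:: c; d; y] -> forall Q : K, Q != 0 -> flow Q V s = 0.
  move=> uVn only uM Q Q0; have [u' [V' [p _ _ ->]]] := pull_swaps uVV uVn.
  have uV' : uniq (ends ((u, u') :: V')) by rewrite -(perm_uniq p).
  move: (uV'); rewrite ends_cons /= inE negb_or => /and3P[/andP[uu' uV1] uV2 _].
  have inV v : v \in ends V' -> v \in ends V by rewrite (perm_mem p) ends_cons !inE => ->; rewrite !orbT.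
  have out v : v \in ends V' -> v \notin [:: c; d; y].
    move=> vV; apply/negP => /(only _ (inV _ vV)) vu.
    by move: uV1; rewrite -vu vV.
  apply: (@flow_cut _ Q _ [pred v | v \in [:: c; d; y]]) => //.
  - move=> v; rewrite !inE; apply/idP/idP.
      move=> h; have := h; case/or3P: h => /eqP e _.
      + by move: e; rewrite -{1}sy => /perm_inj->; rewrite eqxx !orbT.
      + by move: e; rewrite /d => /perm_inj->; rewrite eqxx.
      + by move: e; rewrite {1}/y => /perm_inj->; rewrite eqxx !orbT.
    by case/or3P => /eqP->; rewrite ?sy ?eqxx ?orbT.
  - move=> e eV; change ((e.1 \in [:: c; d; y]) = (e.2 \in [:: c; d; y])).
    by rewrite !(negPf (out _ _)) //; apply/mem_ends; exists e; rewrite ?eqxx ?orbT.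
  - apply: contra uu' => /only -> //.
    by rewrite (perm_mem p) ends_cons !inE eqxx orbT.
have [xo|xno] := boolP (x \in [:: c; d]).
  apply: (golden0 phi2 phi5) => Q Q0; rewrite flow_loop; last first.
    move: xo; rewrite !inE => /orP[] /eqP ->; last exact: (mem_porbit s 1).
    rewrite -linked_graph; exact: linked_trans (linked_graph1 s c) (linked_graph1 s d).
  pose u := if x == c then d else c.
  rewrite (loop u) ?mulr0 //.
  - move: xo; rewrite /u !inE; case: (eqVneq x c) => [xc _|xc /eqP xd].
      by rewrite mV // 1?eq_sym // xc eq_sym.
    by rewrite mV // eq_sym // xd.
  - move=> v vV; rewrite !inE => vM.
    have vx : v != x by apply: contraTneq vV => ->.
    have vy : v != y by apply: contraTneq vV => ->.
    move: xo; rewrite /u !inE; case: (eqVneq x c) => [xc _|xc /eqP xd].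
      by move: vM; rewrite -xc (negPf vx) (negPf vy) orbF => /eqP.
    by move: vM; rewrite -xd (negPf vx) (negPf vy) !orbF => /eqP.
  - by rewrite /u !inE; case: ifP; rewrite eqxx ?orbT.
have [xc xd] : x != c /\ x != d by move: xno; rewrite !inE negb_or => /andP[].
pose a := s x; pose b := s a.
have aW : a \in ends W by apply: sW.
have bW : b \in ends W by apply: sW.
have sb : s b = x by apply: s3.
have inj u v : u != v -> s u != s v by rewrite (inj_eq perm_inj).
have ax : a != x by have [] := live x xW isT.
have ba : b != a by have [] := live a aW isT.
have bx : b != x by apply: tri.
have ac : a != c by rewrite -sy; apply: inj.
have ad : a != d by apply: inj.
have ay : a != y by apply: inj.
have bc : b != c by rewrite -sy; apply: inj.
have bd : b != d by apply: inj.
have by_ : b != y by apply: inj.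
have U : uniq [:: a; b; c; d; x; y].
  rewrite /= !inE !negb_or; do ![apply/andP; split] => //; by rewrite eq_sym.
pose s0 := (tperm a b * (tperm c d * (tperm d y * (tperm b x * s))))%g.
have sE : s = hshape a b c d x y s0 by rewrite /hshape /pairs /s0 !tpermMK.
have s0F : {in [:: a; b; c; d; x; y], forall u, s0 u = u}.
  have [ea eb ec ed [ex ey]] : [/\ s a = b, s b = x, s c = d, s d = y & s x = a /\ s y = c] by [].
  have [] : [/\ s0 a = a, s0 b = b, s0 c = c, s0 d = d & s0 x = x /\ s0 y = y].
    by distinct U; rewrite /s0; do !split; swap_eval.
  by move=> f1 f2 f3 f4 [f5 f6] u; rewrite !inE => /or4P[| | |/or3P[]] /eqP->.
have [fa fb fc fd [fx fy]] : [/\ s0 a = a, s0 b = b, s0 c = c, s0 d = d & s0 x = x /\ s0 y = y].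
  by do !split; apply: s0F; rewrite !inE eqxx ?orbT.
have sOff u : u \notin [:: a; b; c; d; x; y] -> s u = s0 u by rewrite {1}sE; apply: hshape_off.
have U' := uniq_rot4 U; have U4 := uniq_take4 U.
have six' u : (u \in [:: b; c; d; a; x; y]) = (u \in [:: a; b; c; d; x; y]).
  by rewrite !inE; do 6!case: (u == _).
have sV : {subset [:: a; b; c; d] <= ends V}.
  move=> u; rewrite !inE => /or4P[] /eqP ->; rewrite mV //; by rewrite eq_sym.
have plX : planar V (star4 a b c d s0).
  by apply: (@planar_hshapeV _ a b c d x y) => //; rewrite -sE.
have mem6 u : u \notin [:: a; b; c; d; x; y] -> (u \in ends V) = (u \in ends ((x, y) :: V)).
  by rewrite ends_cons !inE !negb_or => /and5P[_ _ _ _ /andP[/negPf-> /negPf->]].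
have [br|nbrc] := boolP (swaps W c \in porbit (swaps W * s)%g c).
  by apply: (golden0 phi2 phi5) => Q Q0; rewrite -flV (flow_bridge_at Q0 uW plW cW br).
have [br|nbrb] := boolP (swaps W b \in porbit (swaps W * s)%g b).
  by apply: (golden0 phi2 phi5) => Q Q0; rewrite -flV (flow_bridge_at Q0 uW plW bW br).
rewrite sE; apply: (golden_flip phi2 phi5 U) => //; first last.
- apply: IH; [by rewrite szV| |].
    apply: (good_pairs U' _ _ _ _ _ _ gV) => // u.
    - by rewrite six'; apply: sOff.
    - by rewrite six'; apply: mem6.
    - by rewrite !inE => h; apply: sV; rewrite !inE; case/or4P: h => ->; rewrite ?orbT.
  by apply: planar_star4_pairs => //; [exact: uniq_take4 U'|rewrite -star4_rot].
- apply: IH; [by rewrite szV| |].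
    by apply: (good_pairs U _ _ _ _ _ _ gV).
  exact: planar_star4_pairs.
set s' := hshape b c d a x y s0.
have s'Off u : u \notin [:: a; b; c; d; x; y] -> s' u = s0 u.
  by move=> u6; apply: hshape_off; rewrite // six'.
have [v1 v2 v3 [v4 v5 v6]] : [/\ s' b = c, s' c = x, s' x = b & [/\ s' d = a, s' a = y & s' y = d]].
  exact: hshape_values.
have gV' : good [::] ((x, y) :: V) s'.
  apply: (good_hshape U' _ _ _ _ _ _ gV) => // u; first by rewrite six'; apply: sOff.
  rewrite six' -(perm_mem pV) !inE.
  by case/or4P => [| | |/or3P[]] /eqP->.
have U'4 := uniq_take4 U'.
apply: (IHm _ _ c) => //; last by move=> V1 t; rewrite /= -szV; apply: IH.
- by apply: planar_hshape => //; rewrite -star4_rot.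
- move=> u; rewrite -(perm_mem pV) => uW1.
  have [|u6] := boolP (u \in [:: a; b; c; d; x; y]); last first.
    have [_ -> _] := away s0F s'Off u6; have [_ <- _] := away s0F sOff u6.
    exact: tri.
  rewrite !inE; case/or4P => [| | |/or3P[]] /eqP->; rewrite !(v1, v2, v3, v4, v5, v6) //;
  by rewrite eq_sym.
- by rewrite -(perm_mem pV).
rewrite -swV -ltnS; apply: leq_trans le.
set f := (swaps W * s)%g in nbrc nbrb *; set f' := (swaps W * s')%g.
have fE u : f u = s (swaps W u) by rewrite permM.
have Wx : swaps W x = y by rewrite /x swapsK.
have inv u v : swaps W u = v -> u = swaps W v by move<-; rewrite swapsK.
have fxc : f x = c by rewrite fE Wx.
have f1 u v : (f u \in porbit f v) = (u \in porbit f v).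
  by rewrite -!eq_porbit_mem -(porbit_perm f 1 u) expg1.
have xO : x \in porbit f c by rewrite -f1 fxc porbit_id.
have bO : swaps W b \in porbit f c by rewrite -f1 fE swapsK // sb.
have bN : b \notin porbit f c.
  apply: contra nbrb => bO'; move: bO bO'; rewrite -!eq_porbit_mem => /eqP -> /eqP->.
  by [].
have aN : swaps W a \notin porbit f c.
  by rewrite -f1 fE swapsK // -/b.
have sub u : u \in porbit f' c -> (u \in porbit f c) && (u \notin [:: x; y]).
  case/porbitP => i ->; rewrite permX; elim: i => [|i /andP[]] /=.
    by rewrite porbit_id !inE negb_or ![c == _]eq_sym xc yc.
  set z := iter i f' c => zO zN; rewrite permM.
  have zE v : swaps W z = v -> z = swaps W v := @inv z v.
  have fz : s (swaps W z) \in porbit f c by rewrite -fE f1.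
  move: zN; rewrite !inE negb_or => /andP[zx zy].
  have [/zE zE'|wx] := eqVneq (swaps W z) x; first by rewrite zE' Wx eqxx in zy.
  have [/zE zE'|wy] := eqVneq (swaps W z) y; first by rewrite zE' eqxx in zx.
  have [/zE zE'|wa] := eqVneq (swaps W z) a; first by rewrite zE' (negPf aN) in zO.
  have [/zE zE'|wc] := eqVneq (swaps W z) c; first by rewrite zE' (negPf nbrc) in zO.
  have [wb|wb] := eqVneq (swaps W z) b.
    by rewrite wb v1 porbit_id ![c == _]eq_sym (negPf xc) (negPf yc).
  have [wd|wd] := eqVneq (swaps W z) d.
    rewrite wd v4 (negPf ax) (negPf ay) andbT.
    by move: fz; rewrite wd -/y -f1 fE.
  rewrite s'Off -?sOff ?inE ?negb_or ?wa ?wb ?wc ?wd ?wx ?wy //.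
  by rewrite fz -{1}sb (inj_eq perm_inj) wb /y (inj_eq perm_inj) wd.
apply: proper_card; apply/properP; split.
  by apply/fintype.subsetP => u /sub/andP[].
by exists x => //; apply/negP => /sub/andP[_]; rewrite !inE eqxx.
Qed.

Theorem golden_cubic W s : good [::] W s -> planar W s -> golden W s.
Proof.
have [n le] := ubnP (size W); elim: n => // n IHn in W s le *.
move=> gW plW.
have IH V t : (size V < size W)%N -> good [::] V t -> planar V t -> golden V t.
  by move=> VW; apply: IHn; apply: leq_trans VW _.
have [[a aW /eqP sa2]|none] := @hasP _ (fun u => s (s u) == u) (ends W).
  exact: (golden_bivalent phi2 phi5 gW plW aW sa2 IH).
have tri : {in ends W, forall u, s (s u) != u}.
  by move=> u uW; apply/negP => h; apply: none; exists u.
case eW : (ends W) => [|z l]; last first.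
  have zW : z \in ends W by rewrite eW mem_head.
  exact: (golden_trivalent gW plW tri zW (leqnn _) IH).
have W0 : W = [::] by case: (W) eW.
have b0 : nbiv s = 0%N.
  rewrite /nbiv (_ : #|bivalent s| = 0%N) //; apply: eq_card0 => u.
  by case: gW => _ dead _; rewrite !inE dead ?eqxx // eW.
by rewrite /golden b0 W0 !flow_nil //= expr1n.
Qed.

End Trivalent.

Definition site (T : Type) : Type := ((T * T) * (T * T) * (T * T))%type.

Definition darts (T : finType) (k : site T) : seq T :=
  let: ((a, b), (c, d), (x, y)) := k in [:: a; b; c; d; x; y].

Definition site_ok (T : finType) (s : {perm T}) (k : site T) : Prop :=
  let: ((a, b), (c, d), (x, y)) := k in [/\ s a = b, s b = c, s c = d & s d = a].

Fixpoint resolve (K : fieldType) (q Q : K) (T : finType) (W : seq (T * T)) (s : {perm T})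
    (C : seq (site T)) : K :=
  if C is ((a, b), (c, d), (x, y)) :: C' then
    - q * resolve q Q W (tperm b d * s)%g C' + resolve q Q W s C'
    - q^-1 * resolve q Q W (tperm a c * s)%g C'
  else flow Q W s.

Definition all_darts (T : finType) (C : seq (site T)) : seq T := flatten (map (@darts T) C).

Lemma mem_all_darts (T : finType) (C : seq (site T)) k z :
  k \in C -> z \in darts k -> z \in all_darts C.
Proof. by move=> kC zk; apply/flattenP; exists (darts k) => //; apply: map_f. Qed.

Lemma all_darts_cons (T : finType) (k : site T) C : all_darts (k :: C) = darts k ++ all_darts C.
Proof. by []. Qed.

Section Lifting.
Variables (K : fieldType) (T : finType).
Implicit Types (W : seq (T * T)) (s t : {perm T}) (C : seq (site T)).

Section SixPoints.
Variables (a b c d x y : T).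
Hypothesis U : uniq [:: a; b; c; d; x; y].
Let six := [:: a; b; c; d; x; y].

Lemma tpermC_out u v p r s : p \in six -> r \in six -> u \notin six -> v \notin six ->
  (tperm u v * (tperm p r * s) = tperm p r * (tperm u v * s))%g.
Proof.
move=> p6 r6 u6 v6; have ne w z : w \notin six -> z \in six -> z != w.
  by move=> w6 z6; apply: contraNneq w6 => <-.
rewrite !mulgA; congr (_ * _)%g; rewrite conjgC tpermJ !tpermD //; exact: ne.
Qed.

Variables (u v : T).
Hypotheses (u6 : u \notin six) (v6 : v \notin six).

Lemma star4_tperm s : (tperm u v * star4 a b c d s)%g = star4 a b c d (tperm u v * s)%g.
Proof. by rewrite /star4 !(@tpermC_out u v) // !inE eqxx ?orbT. Qed.

Lemma pairs_tperm s : (tperm u v * pairs a b c d s)%g = pairs a b c d (tperm u v * s)%g.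
Proof. by rewrite /pairs !(@tpermC_out u v) // !inE eqxx ?orbT. Qed.

Lemma pairs'_tperm s : (tperm u v * pairs b c d a s)%g = pairs b c d a (tperm u v * s)%g.
Proof. by rewrite /pairs !(@tpermC_out u v) // !inE eqxx ?orbT. Qed.

Lemma hshape_tperm s :
  (tperm u v * hshape a b c d x y s)%g = hshape a b c d x y (tperm u v * s)%g.
Proof. by rewrite /hshape /pairs !(@tpermC_out u v) // !inE eqxx ?orbT. Qed.

Lemma fix_tperm s : {in six, forall z, s z = z} -> {in six, forall z, (tperm u v * s)%g z = z}.
Proof.
move=> f z z6; rewrite permM tpermD ?f //.
  by apply: contraNneq u6 => ->.
by apply: contraNneq v6 => ->.
Qed.

End SixPoints.

Lemma resolve_hshape (q Q : K) a b c d x y W s C : Q != 0 ->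
  uniq [:: a; b; c; d; x; y] -> {in [:: a; b; c; d; x; y], forall z, s z = z} ->
  x \notin ends W -> y \notin ends W ->
  {in all_darts C, forall z, z \notin [:: a; b; c; d; x; y]} ->
  resolve q Q ((x, y) :: W) (hshape a b c d x y s) C
  = resolve q Q W (star4 a b c d s) C - resolve q Q W (pairs a b c d s) C.
Proof.
move=> Q0 U + xW yW; elim: C s => [|[[[a' b'] [c' d']] [x' y']] C IH] s f6 out.
  by apply: flow_hshape => //; apply: f6; rewrite !inE eqxx ?orbT.
have o z : z \in [:: a'; b'; c'; d'; x'; y'] -> z \notin [:: a; b; c; d; x; y].
  by move=> z6; apply: out; apply: (mem_all_darts (mem_head _ _)).
have outC : {in all_darts C, forall z, z \notin [:: a; b; c; d; x; y]}.
  by move=> z zC; apply: out; rewrite all_darts_cons mem_cat zC orbT.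
have [a6 b6 c6 d6] : [/\ a' \notin [:: a; b; c; d; x; y], b' \notin [:: a; b; c; d; x; y],
    c' \notin [:: a; b; c; d; x; y] & d' \notin [:: a; b; c; d; x; y]].
  by split; apply: o; rewrite !inE eqxx ?orbT.
rewrite /= !(hshape_tperm b6 d6, hshape_tperm a6 c6) !(star4_tperm b6 d6, star4_tperm a6 c6).
rewrite !(pairs_tperm b6 d6, pairs_tperm a6 c6) !IH //; try exact: fix_tperm.
by move: (resolve _ _ _ _ _) (resolve _ _ _ _ _) => *; ring.
Qed.

Lemma site_ok_tperm s k u v : site_ok s k -> u \notin darts k -> v \notin darts k ->
  site_ok (tperm u v * s)%g k.
Proof.
move: k => [[[a b] [c d]] [x y]] /= [ha hb hc hd].
rewrite !inE !negb_or => /and5P[ua ub uc ud _] /and5P[va vb vc vd _].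
by split; rewrite permM tpermD.
Qed.

Lemma resolve_fibonacci (phi q : K) a b c d x y W s C : phi ^+ 2 = phi + 1 ->
  uniq [:: a; b; c; d; x; y] -> {in [:: a; b; c; d; x; y], forall z, s z = z} ->
  uniq (ends W) -> {subset [:: a; b; c; d] <= ends W} ->
  {in all_darts C, forall z, z \notin [:: a; b; c; d; x; y]} -> uniq (all_darts C) ->
  {in C, forall k, site_ok s k} -> planar W (star4 a b c d s) ->
  resolve q (phi + 1) W (star4 a b c d s) C
  = phi^-1 * (resolve q (phi + 1) W (pairs a b c d s) C
              + resolve q (phi + 1) W (pairs b c d a s) C).
Proof.
move=> phi2 U + uW sW; elim: C s => [|[[[a' b'] [c' d']] [x' y']] C IH] s f6 out uC okC pl.
  by apply: fibonacci_relation => //; [exact: uniq_take4 U|..]; apply: f6; rewrite !inE eqxx ?orbT.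
have o z : z \in [:: a'; b'; c'; d'; x'; y'] -> z \notin [:: a; b; c; d; x; y].
  by move=> z6; apply: out; apply: (mem_all_darts (mem_head _ _)).
have outC : {in all_darts C, forall z, z \notin [:: a; b; c; d; x; y]}.
  by move=> z zC; apply: out; rewrite all_darts_cons mem_cat zC orbT.
have [a6 b6 c6 d6] : [/\ a' \notin [:: a; b; c; d; x; y], b' \notin [:: a; b; c; d; x; y],
    c' \notin [:: a; b; c; d; x; y] & d' \notin [:: a; b; c; d; x; y]].
  by split; apply: o; rewrite !inE eqxx ?orbT.
have okC' : {in C, forall k, site_ok s k} by move=> k kC; apply: okC; rewrite inE kC orbT.
have [uC' dis] : uniq (all_darts C) /\ forall z, z \in [:: a'; b'; c'; d'; x'; y'] ->
    forall k, k \in C -> z \notin darts k.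
  move: (uC); rewrite all_darts_cons cat_uniq.
  case/and3P => _ /hasPn h ->; split=> // z z6 k kC.
  by apply: contraL z6 => zk; apply: h; apply: mem_all_darts zk.
have [s1 s2 s3 s4] : site_ok s (((a', b'), (c', d')), (x', y')) by apply: okC; apply: mem_head.
have U' : uniq [:: a'; b'; c'; d'; x'; y'].
  by move: uC; rewrite all_darts_cons cat_uniq => /andP[].
have offs z : z \notin [:: a; b; c; d; x; y] -> star4 a b c d s z = s z.
  by move=> z6; apply: (star4_off (x := x) (y := y)) => //.
have orb p1 p2 p3 : p1 \notin [:: a; b; c; d; x; y] -> p2 \notin [:: a; b; c; d; x; y] ->
    s p1 = p2 -> s p2 = p3 -> p1 \in porbit (star4 a b c d s) p3.
  move=> h1 h2 e1 e2; rewrite porbit_sym -linked_graph.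
  have l1 : linked (graph (star4 a b c d s)) p1 p2 by rewrite -e1 -offs // linked_graph1.
  by apply: linked_trans l1 _; rewrite -e2 -offs // linked_graph1.
have pl1 : planar W (star4 a b c d (tperm b' d' * s)%g).
  rewrite -(star4_tperm b6 d6); apply: planar_split => //; first by distinct U'.
  exact: (orb b' c' d').
have pl2 : planar W (star4 a b c d (tperm a' c' * s)%g).
  rewrite -(star4_tperm a6 c6); apply: planar_split => //; first by distinct U'.
  exact: (orb a' b' c').
rewrite /= !(star4_tperm b6 d6, star4_tperm a6 c6) !(pairs_tperm b6 d6, pairs_tperm a6 c6).
rewrite !(pairs'_tperm b6 d6, pairs'_tperm a6 c6) !IH //;
  try exact: fix_tperm; try by move=> k kC; apply: site_ok_tperm; [exact: okC'|..];
  apply: dis => //; rewrite !inE eqxx ?orbT.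
move: (resolve _ _ _ (pairs a _ _ _ (tperm b' d' * s)%g) C) (resolve _ _ _ (pairs b _ _ _ s) C).
move: (resolve _ _ _ (pairs b _ _ _ (tperm b' d' * s)%g) C) (resolve _ _ _ (pairs a _ _ _ s) C).
move: (resolve _ _ _ (pairs a _ _ _ (tperm a' c' * s)%g) C).
move: (resolve _ _ _ (pairs b _ _ _ (tperm a' c' * s)%g) C) => z1 z2 z3 z4 z5 z6.
by move: phi^-1 q^-1 => i j; ring.
Qed.

End Lifting.

Section Crossings.
Variables (K : fieldType) (phi q : K).
Hypothesis phi2 : phi ^+ 2 = phi + 1.
Hypothesis phi5 : phi + 2 != 0.
Hypothesis q0 : q != 0.
Hypothesis q_phi : q + q^-1 = phi.
Variable T : finType.
Implicit Types (W : seq (T * T)) (s t : {perm T}) (C : seq (site T)).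

Definition sites_ok W s C : Prop :=
  [/\ uniq (all_darts C), {in C, forall k, site_ok s k}
    & forall a b c d x y, ((a, b), (c, d), (x, y)) \in C ->
      [/\ {subset [:: a; b; c; d] <= ends W}, x \notin ends W, y \notin ends W, s x = x & s y = y]].

Lemma crossing_algebra (p p' : K) :
  - q * p ^+ 2 + phi ^+ 3 * (phi^-1 * (p + p') - p) ^+ 2 + p ^+ 2 - q^-1 * p' ^+ 2
  = - (- (q ^- 2) * p + phi^-1 * (p + p') - (q ^- 2)^-1 * p') ^+ 2.
Proof.
have ph0 := phi_neq0 phi2.
have iphi : phi^-1 = phi - 1.
  by apply: (mulfI ph0); rewrite divff // mulrBr mulr1 -expr2 phi2; ring.
have qV : q^-1 = phi - q by rewrite -q_phi; ring.
have q2 : q ^+ 2 = phi * q - 1 by rewrite -q_phi mulrDl mulVf // expr2; ring.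
have q2V : q ^- 2 = phi - phi * q.
  by rewrite -exprVn qV; ring: phi2 q2.
rewrite invrK q2V qV iphi; ring: phi2 q2.
Qed.

Lemma golden_crossings C W s :
  good (all_darts C) W s -> sites_ok W s C -> planar W s ->
  phi ^+ (nbiv s + (size C).*2) * resolve q (phi + 2) W s C
  = (-1) ^+ size C * phi ^+ size W * resolve (q ^- 2) (phi + 1) W s C ^+ 2.
Proof.
elim: C W s => [|[[[a b] [c d]] [x y]] C IH] W s gW [uC okC spC] pl.
  by rewrite /= addn0 expr0 mul1r; apply: golden_cubic.
have [sW xW yW sx sy] := spC _ _ _ _ _ _ (mem_head _ _).
have [sa sb sc sd] := okC _ (mem_head _ _).
move: (uC); rewrite all_darts_cons cat_uniq => /and3P[/= U /hasPn dis uC'].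
have uW : uniq (ends W) by case: gW.
have outC : {in all_darts C, forall z, z \notin [:: a; b; c; d; x; y]} by move=> z /dis.
pose s0 := (tperm a b * (tperm b c * (tperm c d * s)))%g.
have sE : s = star4 a b c d s0 by rewrite /star4 /s0 !tpermMK.
have f6 : {in [:: a; b; c; d; x; y], forall z, s0 z = z}.
  have [] : [/\ s0 a = a, s0 b = b, s0 c = c, s0 d = d & s0 x = x /\ s0 y = y].
    by distinct U; rewrite /s0; do !split; swap_eval.
  by move=> f1 f2 f3 f4 [f5 f6] u; rewrite !inE => /or4P[| | |/or3P[]] /eqP->.
clearbody s0; have U6 : uniq [:: a; b; c; d; x; y] by [].
have U' := uniq_rot4 U6; have U4 := uniq_take4 U6.
have [fa fb fc fd [fx fy]] : [/\ s0 a = a, s0 b = b, s0 c = c, s0 d = d & s0 x = x /\ s0 y = y].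
  by do !split; apply: f6; rewrite !inE eqxx ?orbT.
have sOff u : u \notin [:: a; b; c; d; x; y] -> s u = s0 u by rewrite {1}sE; apply: star4_off.
have six' u : (u \in [:: b; c; d; a; x; y]) = (u \in [:: a; b; c; d; x; y]).
  by rewrite !inE; do 6!case: (u == _).
have e0 : (tperm b d * s)%g = pairs a b c d s0.
  rewrite sE; apply/permP => z; rewrite /pairs /star4 !permM; congr (s0 _); distinct U4.
  by swap_at z a; swap_at z b; swap_at z c; swap_at z d; swap_eval.
have e1 : (tperm a c * s)%g = pairs b c d a s0.
  rewrite sE; apply/permP => z; rewrite /pairs /star4 !permM; congr (s0 _); distinct U4.
  by swap_at z a; swap_at z b; swap_at z c; swap_at z d; swap_eval.
have pOff u : u \notin [:: a; b; c; d; x; y] -> pairs a b c d s0 u = s u.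
  by move=> u6; rewrite sOff //; apply: pairs_off u6.
have p'Off u : u \notin [:: a; b; c; d; x; y] -> pairs b c d a s0 u = s u.
  by move=> u6; rewrite sOff //; apply: (pairs_off (x := x) (y := y)); rewrite six'.
have hOff u : u \notin [:: a; b; c; d; x; y] -> hshape a b c d x y s0 u = s u.
  by move=> u6; rewrite sOff //; apply: hshape_off u6.
have ok t : (forall u, u \notin [:: a; b; c; d; x; y] -> t u = s u) ->
    {in C, forall k, site_ok t k}.
  move=> tE [[[a' b'] [c' d']] [x' y']] kC.
  have o z : z \in [:: a'; b'; c'; d'; x'; y'] -> z \notin [:: a; b; c; d; x; y].
    by move=> z6; apply: outC; apply: (mem_all_darts kC).
  have [k1 k2 k3 k4] : site_ok s ((a', b'), (c', d'), (x', y')) by apply: okC; rewrite inE kC orbT.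
  by split; rewrite tE //; apply: o; rewrite !inE eqxx ?orbT.
have oks t W' : (forall u, u \notin [:: a; b; c; d; x; y] -> t u = s u) ->
    {subset ends W <= ends W'} ->
    (forall u, u \notin [:: a; b; c; d; x; y] -> u \notin ends W -> u \notin ends W') ->
    sites_ok W' t C.
  move=> tE WW' WW'' ; split; [exact: uC'|exact: ok|].
  move=> a' b' c' d' x' y' kC.
  have o z : z \in [:: a'; b'; c'; d'; x'; y'] -> z \notin [:: a; b; c; d; x; y].
    by move=> z6; apply: outC; apply: (mem_all_darts kC).
  have [|k1 k2 k3 k4 k5] := spC a' b' c' d' x' y'; first by rewrite inE kC orbT.
  have [ox oy] : x' \notin [:: a; b; c; d; x; y] /\ y' \notin [:: a; b; c; d; x; y].
    by split; apply: o; rewrite !inE eqxx ?orbT.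
  by split; rewrite ?tE //; [move=> z /k1/WW'|apply: WW''|apply: WW''].
have EE z : z \notin [:: a; b; c; d; x; y] -> z \notin all_darts C ->
    z \notin all_darts (((a, b), (c, d), (x, y)) :: C).
  by move=> z6 zC; rewrite all_darts_cons mem_cat negb_or zC andbT.
have plX : planar W (star4 a b c d s0) by rewrite -sE.
have gP : good (all_darts C) W (pairs a b c d s0).
  by apply: (good_pairs U6 _ _ _ _ _ _ gW).
have gP' : good (all_darts C) W (pairs b c d a s0).
  apply: (good_pairs U' _ _ _ _ _ _ gW) => // u; first by rewrite six'; apply: EE.
    by rewrite six'; apply: sOff.
  by rewrite !inE => h; apply: sW; rewrite !inE; case/or4P: h => ->; rewrite ?orbT.
have uxyW : uniq (ends ((x, y) :: W)).
  have xy : x != y by distinct U6.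
  by rewrite ends_cons /= inE negb_or xW yW uW xy.
have gH : good (all_darts C) ((x, y) :: W) (hshape a b c d x y s0).
  apply: (good_hshape U6 _ _ _ _ _ _ gW) => // u.
    rewrite ends_cons !inE !negb_or => /and5P[_ _ _ _ /andP[/negPf-> /negPf->]] //.
  rewrite ends_cons !inE; case/or4P => [| | |/or3P[]] /eqP->; rewrite ?eqxx ?orbT //;
  by rewrite (sW _) ?orbT // !inE eqxx ?orbT.
have pl0 : planar W (pairs a b c d s0) by apply: planar_star4_pairs.
have pl1 : planar W (pairs b c d a s0).
  by apply: planar_star4_pairs => //; [exact: uniq_take4 U'|rewrite -star4_rot].
have plH : planar ((x, y) :: W) (hshape a b c d x y s0) by apply: planar_hshape.
have hd (u : T) : u \in ends W -> u \in ends ((x, y) :: W).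
  by move=> uW1; rewrite ends_cons !inE uW1 !orbT.
have hd' (u : T) : u \notin [:: a; b; c; d; x; y] -> u \notin ends W -> u \notin ends ((x, y) :: W).
  rewrite ends_cons !inE !negb_or => /and5P[_ _ _ _ /andP[-> ->]] ->.
  by [].
have := IH W _ gP (oks _ _ pOff (fun _ h => h) (fun _ _ h => h)) pl0.
have := IH W _ gP' (oks _ _ p'Off (fun _ h => h) (fun _ _ h => h)) pl1.
have := IH _ _ gH (oks _ _ hOff hd hd') plH.
have Q10 := phi5; have Q20 : phi + 1 != 0 by rewrite -phi2 expf_neq0 ?(phi_neq0 phi2).
rewrite !resolve_hshape // e0 e1 sE (nbiv_star4 U6) // (nbiv_hshape U6) // (nbiv_pairs U6) //.
rewrite (nbiv_pairs U') //.
rewrite (@resolve_fibonacci _ _ phi _ a b c d x y) //; last by apply: ok => u /sOff.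
move: (resolve _ _ W (star4 a b c d s0) C) (resolve _ (phi + 2) W (pairs a b c d s0) C) => x1 p1.
move: (resolve _ _ W (pairs a b c d s0) C) (resolve _ (phi + 2) W (pairs b c d a s0) C) => p2 p1'.
move: (resolve _ _ W (pairs b c d a s0) C) (nbiv s0) (size C) => p2' n m eh ep' ep.
have pw r : phi ^+ r.+1 = phi * phi ^+ r by rewrite exprS.
rewrite /= doubleS !addnS !addSn !pw in eh ep ep' *; rewrite [(-1) ^+ m.+1]exprS mulN1r.
move: eh ep ep'; move: (phi ^+ (n + m.*2)) ((-1) ^+ m) (phi ^+ size W) => N e k eh ep ep'.
have -> : phi * (phi * N) * (- q * p1 + x1 - q^-1 * p1')
   = - q * (phi * (phi * N) * p1) + phi ^+ 2 * (N * (x1 - p1))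
     + phi * (phi * N) * p1 - q^-1 * (phi * (phi * N) * p1') by ring.
rewrite eh ep ep'; have := crossing_algebra p2 p2'.
move: ((- q ^- 2 * p2 + _ - _) ^+ 2) => sq sqE.
transitivity (e * k * (- q * p2 ^+ 2 + phi ^+ 3 * (phi^-1 * (p2 + p2') - p2) ^+ 2
  + p2 ^+ 2 - q^-1 * p2' ^+ 2)); first by move: (phi^-1) (q^-1) => i j; ring.
by rewrite sqE; ring.
Qed.

End Crossings.

Section Pairing.
Variable T : finType.
Implicit Types (W L P : seq (T * T)) (s : {perm T}).

Lemma pull_bond W z : z \in ends W -> exists y V,
  [/\ perm_eq (ends W) (ends ((z, y) :: V)), size W = (size V).+1, bond W =2 bond ((z, y) :: V)
    & forall (K : comNzRingType) (Q : K) L, Z Q W L = Z Q ((z, y) :: V) L].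
Proof.
move=> zW; have [y [V [WV|WV]]] := pull_edge zW; exists y, V; split.
- exact: ends_perm.
- exact: perm_size WV.
- by move=> u v; rewrite /bond /= !(perm_mem WV).
- by move=> K Q L; apply: Z_perm.
- exact: perm_trans (ends_perm WV) (perm_ends_flip _ _ _).
- exact: perm_size WV.
- move=> u v; rewrite /bond /= !(perm_mem WV) !inE !xpair_eqE.
  by rewrite ![(u == _) && _]andbC orbACA [X in X || _]orbC orbACA.
- by move=> K Q L; rewrite (Z_perm _ _ WV) Z_flip.
Qed.

Lemma bond_ends W u v : bond W u v -> (u \in ends W) && (v \in ends W).
Proof.
rewrite /bond /= => /orP[] uv; apply/andP; split; apply/mem_ends.
- by exists (u, v); rewrite //= eqxx.
- by exists (u, v); rewrite //= eqxx orbT.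
- by exists (v, u); rewrite //= eqxx orbT.
- by exists (v, u); rewrite //= eqxx.
Qed.

Lemma bond_cons a b W u v :
  bond ((a, b) :: W) u v = [|| (u == a) && (v == b), (u == b) && (v == a) | bond W u v].
Proof.
rewrite /bond /= !inE !xpair_eqE; case: (_ \in W); rewrite /= ?orbT //.
by rewrite [(v == a) && _]andbC orbA; case: (_ \in W); rewrite ?orbT ?orbF.
Qed.

Lemma linked_matching W u v : uniq (ends W) -> u \in ends W ->
  linked W u v = (u == v) || bond W u v.
Proof.
move=> uW uE; have [y [V [p _ bW _]]] := pull_bond uE.
apply/idP/orP => [|[/eqP->|]]; last 2 first.
- exact: linked_refl.
- by apply: connect1.
have clM : closed_under W (pred2 u y).
  move=> e eW; have : bond W e.1 e.2 by rewrite /bond /= -surjective_pairing eW.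
  have := uW; rewrite bW bond_cons (perm_uniq p) ends_cons /= inE negb_or.
  case/and3P => /andP[uy uV] yV _.
  case/or3P => [/andP[/eqP-> /eqP->]|/andP[/eqP-> /eqP->]|/bond_ends/andP[e1 e2]].
  - by rewrite !inE !eqxx orbT.
  - by rewrite !inE !eqxx orbT.
  have ne z : z \in ends V -> (z \in pred2 u y) = false.
    by move=> zV; rewrite !inE; apply/negbTE; rewrite negb_or; apply/andP; split;
      [apply: contraNneq uV|apply: contraNneq yV] => <-.
  by rewrite !ne.
move/(linked_closed clM); rewrite !inE eqxx => /esym/orP[/eqP->|/eqP->]; first by left.
by right; rewrite bW bond_cons !eqxx.
Qed.

Lemma ncl_matching W : uniq (ends W) -> (ncl W + size W = #|T|)%N.
Proof.
elim: W => [|[a b] W IH]; first by rewrite ncl_nil addn0.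
rewrite ends_cons /= inE negb_or => /and3P[/andP[ab aW] bW uW].
have := ncl_cons a b W; suff /negPf-> : ~~ linked W a b by rewrite -(IH uW) => <-; rewrite addn1 addSnnS.
apply/negP => /(@linked_closed _ W (pred1 a)); rewrite !inE eqxx eq_sym (negPf ab) => h.
suff /h : closed_under W (pred1 a) by [].
move=> e eW; rewrite !inE; have h' : e.1 \in ends W /\ e.2 \in ends W.
  by split; apply/mem_ends; exists e; rewrite ?eqxx ?orbT.
by case: h' => e1 e2; do 2!(have [E|_] := eqVneq _ a; first by rewrite -E ?e1 ?e2 in aW).
Qed.

Lemma pairing (A P : seq (T * T)) :
  uniq (ends A) -> (forall z, z \in ends A) -> uniq (ends P) -> exists W k,
  [/\ uniq (ends W), forall z, (z \in ends W) = (z \notin ends P),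
      forall u v, u \notin ends P -> v \notin ends P ->
        linked (P ++ A) u v = (u == v) || bond W u v,
      ncl (P ++ A) = (size W + k)%N /\ (size W + size P = size A)%N
    & forall (K : fieldType) (Q : K) s, Q != 0 ->
        {in P, forall e, s e.1 = e.2 /\ s e.2 = e.1} ->
        flow Q A s = (Q - 1) ^+ k * flow Q W s].
Proof.
move=> uA cA; elim: P => [|[b c] P IH].
  exists A, 0%N; split=> //.
  - by move=> u v _ _; apply: linked_matching.
  - rewrite /= !addn0; split=> //; have := ncl_matching uA.
    have : #|T| = (size A).*2.
      by rewrite -size_ends -(card_uniqP uA); apply: eq_card => z; rewrite cA.
    by move=> -> e; apply/(@addIn (size A)); rewrite addnn.
  - by move=> K Q s _ _; rewrite expr0 mul1r.
rewrite ends_cons /= inE negb_or => /and3P[/andP[bc bP] cP uP].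
have [W' [k' [uW' mW' lW' [nW' sW'] fW']]] := IH uP.
have bW' : b \in ends W' by rewrite mW'.
have cW' : c \in ends W' by rewrite mW'.
have [b' [W1 [p1 s1 b1 Z1]]] := pull_bond bW'.
have := uW'; rewrite (perm_uniq p1) ends_cons /= inE negb_or => /and3P[/andP[bb' bW1] b'W1 uW1].
have m1 z : (z \in ends W') = [|| z == b, z == b' | z \in ends W1].
  by rewrite (perm_mem p1) ends_cons !inE.
have nP z : (z \notin ends ((b, c) :: P)) = [&& z != b, z != c & z \in ends W'].
  by rewrite ends_cons !inE !negb_or mW'.
have fP (K : fieldType) (Q : K) s : Q != 0 -> {in (b, c) :: P, forall e, s e.1 = e.2 /\ s e.2 = e.1} ->
    [/\ flow Q A s = (Q - 1) ^+ k' * flow Q W' s, s b = c & s c = b].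
  move=> Q0 h; have [sb sc] := h _ (mem_head _ _); split=> //.
  by apply: fW' => // e eP; apply: h; rewrite inE eP orbT.
have [Ec|b'c] := eqVneq b' c.
  subst b'; exists W1, k'.+1.
  have lbc : linked (P ++ A) b c by rewrite lW' // b1 bond_cons !eqxx orbT.
  split=> //.
  - move=> z; rewrite nP m1; have [->|zb] := eqVneq z b; first by rewrite (negPf bW1).
    by have [->|zc] := eqVneq z c; first by rewrite (negPf b'W1).
  - move=> u v; rewrite !nP => /and3P[ub uc uW] /and3P[vb vc vW].
    rewrite ?cat_cons (linked_cons_id lbc) lW' -?mW' //.
    by rewrite b1 bond_cons (negPf ub) (negPf uc).
  - rewrite ?cat_cons (eq_ncl (linked_cons_id lbc)) nW' s1.
    by split; [rewrite addSnnS|rewrite -sW' s1 addSnnS].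
  - move=> K Q s Q0 h; have [-> sb sc] := fP K Q s Q0 h.
    rewrite [flow Q W' s]/flow Z1 -/(flow Q ((b, c) :: W1) s) flow_loop.
      by rewrite exprS mulrCA mulrA.
    by rewrite -sb; apply: (mem_porbit s 1).
have cW1 : c \in ends W1.
  by move: cW'; rewrite m1 eq_sym (negPf bc) eq_sym (negPf b'c).
have [c' [W2 [p2 s2 b2 Z2]]] := pull_bond cW1.
have := uW1; rewrite (perm_uniq p2) ends_cons /= inE negb_or => /and3P[/andP[cc' cW2] c'W2 uW2].
have m2 z : (z \in ends W1) = [|| z == c, z == c' | z \in ends W2].
  by rewrite (perm_mem p2) ends_cons !inE.
move: bW1 b'W1; rewrite !m2 !negb_or => /and3P[_ bc' bW2] /and3P[_ b'c' b'W2].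
exists ((b', c') :: W2), k'.
have bond1 u v : bond W' u v = [|| (u == b) && (v == b'), (u == b') && (v == b),
   (u == c) && (v == c'), (u == c') && (v == c) | bond W2 u v].
  by rewrite b1 bond_cons b2 bond_cons.
have out u v : u \notin ends W2 -> bond W2 u v = false /\ bond W2 v u = false.
  by move=> uW2'; split; apply: contraNF uW2' => /bond_ends/andP[].
have lbc : ~~ linked (P ++ A) b c.
  rewrite lW' // bond1 (negPf bc) (negPf bb') [c == b]eq_sym (negPf bc) (negPf bc').
  by rewrite [c == b']eq_sym (negPf b'c) !andbF /= (out b c bW2).1.
split.
- by rewrite ends_cons /= inE negb_or b'c' b'W2 c'W2.
- move=> z; rewrite nP m1 m2 ends_cons !inE.
  have [->|zb] := eqVneq z b; first by rewrite (negPf bb') (negPf bc') (negPf bW2).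
  have [->|zc] /= := eqVneq z c; first by rewrite eq_sym (negPf b'c) (negPf cc') (negPf cW2).
  by [].
- move=> u v; rewrite !nP => /and3P[ub uc uW] /and3P[vb vc vW].
  rewrite ?cat_cons linked_cons !lW' -?mW' // !bond1 bond_cons.
  rewrite !(eq_sym b) !(eq_sym c) (negPf ub) (negPf uc) (negPf vb) (negPf vc) !eqxx !andbF !andbT /=.
  rewrite (out b v bW2).1 (out b u bW2).2 (out c v cW2).1 (out c u cW2).2.
  rewrite (negPf bc) !andbF /= !orbF; move: (bond W2 u v) => [];
  by rewrite ?orbT ?orbF //= -?orbA ?orbT.
- have := ncl_cons b c (P ++ A); rewrite lbc; move: nW' sW' s1 s2; rewrite /=.
  move: (ncl _) (ncl _) (size A) (size W') (size W1) (size W2) (size P) => n1 n2 n3 n4 n5 n6 n7.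
  by clear; lia.
move=> K Q s Q0 h; have [-> sb sc] := fP K Q s Q0 h; congr (_ * _).
rewrite [LHS]/flow Z1 Z_cons !Z2 -Z_cons; apply: flow_join => //.
rewrite /= !inE !negb_or bc bb' bc' (eq_sym c b') b'c cc' b'c' //.
Qed.

End Pairing.

Section Transfer.
Variables (V T : finType) (f : V -> T) (L : seq (T * T)).
Hypothesis fL : forall u v, linked L (f u) (f v) = (u == v).
Implicit Type A : seq (V * V).

Definition push A : seq (T * T) := [seq (f e.1, f e.2) | e <- A].

Lemma linked_nil (S : finType) (u v : S) : linked [::] u v = (u == v).
Proof.
apply/idP/eqP => [|->]; last exact: linked_refl.
by move/(@linked_closed _ [::] (pred1 u)); rewrite !inE eqxx => h; apply/esym/eqP; rewrite -h.
Qed.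

Lemma linked_push A u v : linked (push A ++ L) (f u) (f v) = linked A u v.
Proof.
elim: A u v => [|[a b] A IH] u v; first by rewrite linked_nil fL.
by rewrite /= !linked_cons !IH.
Qed.

Lemma ncl_push A : (ncl (push A ++ L) + #|V| = ncl A + ncl L)%N.
Proof.
elim: A => [|[a b] A IH]; first by rewrite ncl_nil addnC.
have := ncl_cons a b A; have := ncl_cons (f a) (f b) (push A ++ L).
rewrite linked_push /= => e1 e2; move: IH; rewrite -e1 -e2.
by move: (ncl _) (ncl _) (ncl L) (nat_of_bool _) #|V| => n1 n2 n3 n4 n5; clear; lia.
Qed.

Lemma Z_push (K : comNzRingType) (Q : K) W A :
  Z Q (push W) (push A ++ L) * Q ^+ #|V| = Z Q W A * Q ^+ ncl L.
Proof.
elim: W A => [|e W IH] A /=; first by rewrite -!exprD ncl_push.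
by rewrite mulrBl -mulrA (IH (e :: A)) IH; ring.
Qed.

End Transfer.

Section SubsetSum.
Variables (K : comNzRingType) (Q : K) (E T : finType) (h : E -> T * T) (L : seq (T * T)).

Lemma Z_subsets (r : seq E) : uniq r ->
  Z Q (map h r) L = \sum_(A : {set E} | A \subset r)
    (-1) ^+ (size r - #|A|) * Q ^+ (#|A| + ncl (map h [seq e <- r | e \in A] ++ L)).
Proof.
elim: r L => [|e r IH] M /= ur.
  rewrite (big_pred1 finset.set0) ?finset.cards0 /= ?subnn ?expr0 ?mul1r // => A.
  apply/idP/eqP => [/fintype.subsetP sA|->]; last by apply/fintype.subsetP => x; rewrite inE.
  by apply/finset.setP => x; rewrite inE; apply/negP => /sA.
case/andP: ur => er ur; rewrite (bigID (fun A : {set E} => e \in A)) /=.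
rewrite !IH // mulr_sumr -sumrN; congr (_ + _).
  rewrite [RHS](reindex_onto (fun B : {set E} => e |: B) (fun A => A :\ e)) /=; last first.
    by move=> A /andP[_ eA]; rewrite finset.setD1K.
  apply: eq_big => [B|B BP]; last first.
    have eB : e \notin B by apply: contra er; apply: (fintype.subsetP BP).
    rewrite finset.setU11 finset.cardsU1 eB add1n subSS.
    have -> : [seq e0 <- r | e0 \in e |: B] = [seq e0 <- r | e0 \in B].
      apply: eq_in_filter => x xr; rewrite !inE; case: eqP => // xe.
      by rewrite -xe xr in er.
    rewrite mulrCA -exprS addSn; congr (_ * _ ^+ _.+1); congr (_ + _)%N.
    by apply/eq_ncl/eq_linked_mem => x; rewrite /= !(inE, mem_cat) orbCA.
  rewrite finset.setU11 andbT; apply/idP/andP => [/fintype.subsetP sB|[/fintype.subsetP sB /eqP eB]].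
    split; first by apply/fintype.subsetP => x; rewrite !inE => /orP[->//|/sB->]; rewrite orbT.
    by rewrite finset.setU1K //; apply: contra er => /sB.
  apply/fintype.subsetP => x xB; have := sB x; rewrite !inE xB orbT => /(_ isT) /orP[/eqP xe|//].
  by move: xB; rewrite -eB xe !inE eqxx.
apply: eq_big => [B|B BP].
  apply/idP/andP => [/fintype.subsetP sB|[/fintype.subsetP sB eB]].
    split; first by apply/fintype.subsetP => x /sB xr; rewrite inE xr orbT.
    by apply: contra er => /sB.
  apply/fintype.subsetP => x xB; have := sB x xB; rewrite inE => /orP[/eqP xe|//].
  by rewrite xe (negPf eB) in xB.
have eB : e \notin B by apply: contra er; apply: (fintype.subsetP BP).
rewrite (negPf eB) subSn ?exprS ?mulN1r ?mulNr //.
by rewrite -(card_uniqP ur); apply: subset_leq_card.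
Qed.

End SubsetSum.

Lemma ncl_classes (T : finType) (L : seq (T * T)) :
  ncl L = #|[set [set y | linked L x y] | x in T]|.
Proof.
rewrite /ncl /n_comp_mem; set e := bond L; have csym : connect_sym e by apply: linked_csym.
have -> : [set [set y | linked L x y] | x in T] = [set [set y | linked L x y] | x in [set x | roots e x]].
  apply/finset.setP => B; apply/imsetP/imsetP => -[x _ ->]; last by exists x.
  exists (fingraph.root e x); first by rewrite inE roots_root.
  by apply/finset.setP => y; rewrite !inE; apply: linked_eql; apply: connect_root.
rewrite card_in_imset; first by apply: eq_card => x; rewrite !inE andbT.
move=> x y; rewrite !inE => /eqP rx /eqP ry /finset.setP/(_ y); rewrite !inE linked_refl => xy.
by rewrite -rx -ry; apply/(fingraph.rootP csym).
Qed.

Lemma perm_ends_unzip (T : finType) (W : seq (T * T)) :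
  perm_eq (ends W) (map fst W ++ map snd W).
Proof.
elim: W => // e W IH; rewrite ends_cons /= perm_cons.
rewrite -cat1s (perm_catl _ IH) perm_catCA.
by [].
Qed.

Lemma involution_pairs (T : finType) (p : T -> T) : involutive p -> exists P : seq (T * T),
  [/\ uniq (ends P), forall z, (z \in ends P) = (p z != z) & {in P, forall e, p e.1 = e.2}].
Proof.
move=> pK; pose r := [seq d <- enum T | (enum_rank d < enum_rank (p d))%N].
pose P := [seq (d, p d) | d <- r].
have mr z : (z \in r) = (enum_rank z < enum_rank (p z))%N by rewrite mem_filter mem_enum andbT.
have ur : uniq r by apply/filter_uniq/enum_uniq.
have P1 : map fst P = r by rewrite -map_comp map_id.
have P2 : map snd P = map p r by rewrite -map_comp.
have mp z : (z \in map p r) = (p z \in r) by rewrite -{1}[z]pK mem_map //; apply: inv_inj.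
exists P; split.
- rewrite (perm_uniq (perm_ends_unzip P)) P1 P2 cat_uniq ur map_inj_uniq ?ur //; last exact: inv_inj.
  by rewrite andbT; apply/hasPn => z; rewrite mp !mr pK -leqNgt; apply: ltnW.
- move=> z; rewrite (perm_mem (perm_ends_unzip P)) P1 P2 mem_cat mp !mr pK -neq_ltn.
  by rewrite eq_sym (inj_eq val_inj) (inj_eq enum_rank_inj).
- by move=> e /mapP[d _ ->].
Qed.

Lemma Z_congr (K : comNzRingType) (Q : K) (E T : finType) (h h' : E -> T * T) (r : seq E) L :
  {in r, forall e, linked L (h e).1 (h' e).1 /\ linked L (h e).2 (h' e).2} ->
  Z Q (map h r) L = Z Q (map h' r) L.
Proof.
elim: r L => //= e r IH L hr; have [h1 h2] := hr _ (mem_head _ _).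
have sub f : subrel (linked L) (linked (f :: L)).
  by apply: linked_sub => -[u v] uv; apply: linked_mem; rewrite inE uv orbT.
have hr' : {in r, forall e', linked L (h e').1 (h' e').1 /\ linked L (h e').2 (h' e').2}.
  by move=> e' e'r; apply: hr; rewrite inE e'r orbT.
have hr2 : {in r, forall e', linked (h e :: L) (h e').1 (h' e').1
    /\ linked (h e :: L) (h e').2 (h' e').2}.
  by move=> e' /hr'[k1 k2]; split; apply: sub.
rewrite (IH _ hr') (IH _ hr2).
have -> : Z Q (map h' r) (h e :: L) = Z Q (map h' r) (h' e :: L).
  by apply: Z_ext; case: (h e) (h' e) h1 h2 => a b [a' b'] /= h1 h2; apply: eq_linked_pair.
by [].
Qed.

Lemma Z_loops (K : comNzRingType) (Q : K) (T : finType) (W X L : seq (T * T)) :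
  {in X, forall e, e.1 = e.2} -> Z Q (X ++ W) L = (Q - 1) ^+ size X * Z Q W L.
Proof.
elim: X => [|[a b] X IH] h /=; first by rewrite expr0 mul1r.
have /= ab := h _ (mem_head _ _); rewrite -[LHS]/(Z Q ((a, b) :: X ++ W) L) Z_loop.
  by rewrite IH ?mulrA ?exprS // => e eX; apply: h; rewrite inE eX orbT.
by rewrite ab linked_refl.
Qed.

Lemma bond_inj (T : finType) (W : seq (T * T)) a b c :
  uniq (ends W) -> bond W a b -> bond W a c -> b = c.
Proof.
move=> uW ab; have /andP[aW _] := bond_ends ab.
have [y [V [p _ bW _]]] := pull_bond aW; move: uW ab.
rewrite (perm_uniq p) ends_cons /= inE negb_or => /and3P[/andP[ay aV] _ _].
have nb z : bond V a z = false by apply: contraNF aV => /bond_ends/andP[].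
by rewrite !bW !bond_cons !nb !eqxx (negPf ay) /= !orbF => /eqP-> /eqP->.
Qed.

Lemma bondC (T : finType) (W : seq (T * T)) a b : bond W a b = bond W b a.
Proof. by rewrite /bond /= orbC. Qed.

Lemma matching_eq (K : comNzRingType) (Q : K) (T : finType) (X W L : seq (T * T)) :
  uniq (ends X) -> uniq (ends W) -> bond X =2 bond W ->
  Z Q X L = Z Q W L /\ size X = size W.
Proof.
elim: X W L => [|[a b] X IH] W L uX uW bXW.
  case: W uW bXW => // -[a b] W _ /(_ a b); by rewrite bond_cons !eqxx.
have abW : bond W a b by rewrite -bXW bond_cons !eqxx.
have /andP[aW _] := bond_ends abW; have [y [V [p sW bW ZW]]] := pull_bond aW.
have yb : y = b by apply: (bond_inj uW _ abW); rewrite bW bond_cons !eqxx.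
subst y; move: (uX); rewrite ends_cons /= inE negb_or => /and3P[/andP[ab aX] bX uX'].
have := uW; rewrite (perm_uniq p) ends_cons /= inE negb_or => /and3P[/andP[_ aV] bV uV].
have bXV : bond X =2 bond V.
  have nX u v : (u == a) || (u == b) -> bond X u v = false.
    by move=> h; apply/negP => /bond_ends/andP[uX1 _]; case/orP: h uX1 => /eqP->; apply/negP.
  have nV u v : (u == a) || (u == b) -> bond V u v = false.
    by move=> h; apply/negP => /bond_ends/andP[uX1 _]; case/orP: h uX1 => /eqP->; apply/negP.
  move=> u v; have [h|] := boolP ((u == a) || (u == b)); first by rewrite nX // nV.
  have := bXW u v; rewrite bW !bond_cons negb_or => h /andP[/negPf ua /negPf ub].
  by move: h; rewrite ua ub.
rewrite sW ZW !Z_cons; split; last by rewrite /= (IH V [::] uX' uV bXV).2.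
by rewrite !(IH V _ uX' uV bXV).1.
Qed.

Lemma bond_irr (T : finType) (W : seq (T * T)) a : uniq (ends W) -> ~~ bond W a a.
Proof.
move=> uW; apply/negP => aa; have /andP[aW _] := bond_ends aa.
have [y [V [p _ bW _]]] := pull_bond aW; move: uW aa.
rewrite (perm_uniq p) ends_cons bW bond_cons /= inE negb_or => /andP[/andP[/negPf h1 /negPf h2] _].
by rewrite h1 !andbF /= => /bond_ends/andP[]; rewrite h2.
Qed.

Section StrandGraph.
Variables (D : diagram) (p : dart D -> dart D) (A : seq (dart D * dart D)) (s : {perm dart D}).
Local Notation T := (dart D).
Local Notation H := (strand_graph p).
Hypothesis pK : involutive p.
Hypotheses (uA : uniq (ends A)) (cA : forall z, z \in ends A) (aA : {in A, forall e, Defs.arc D e.1 = e.2}).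
Hypothesis st : forall d d' : T, p d = d -> d' \in node d -> p d' = d'.
Hypothesis sp : forall d : T, p d != d -> s d = p d.
Hypothesis ss : forall d : T, p d = d -> porbit s d = node d.

Definition stop_nodes : {set {set T}} := [set node d | d in [set d | p d == d]].

Definition same_strand : rel T := connect [rel x y | (y == Defs.arc D x) || (y == p x)].

Lemma same_strand_csym : connect_sym [rel x y | (y == Defs.arc D x) || (y == p x)].
Proof.
apply: sym_connect_sym => x y /=; congr (_ || _).
  by rewrite eq_sym (can2_eq (@arcK D) (@arcK D)).
by rewrite eq_sym (can2_eq pK pK).
Qed.

Lemma same_strandC x y : same_strand x y = same_strand y x.
Proof. exact: same_strand_csym. Qed.

Lemma same_strand_eql x y z : same_strand x y -> same_strand x z = same_strand y z.
Proof. by move=> xy; apply: (same_connect same_strand_csym). Qed.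

Lemma node_sym (x y : T) : (x \in node y) = (y \in node x).
Proof. exact: porbit_sym. Qed.

Lemma node_eq (x y : T) : (node x == node y) = (x \in node y).
Proof. exact: eq_porbit_mem. Qed.

Lemma node_id (x : T) : x \in node x.
Proof. exact: porbit_id. Qed.

Lemma same_strandE (P : seq (T * T)) :
  (forall z, (z \in ends P) = (p z != z)) -> {in P, forall e, p e.1 = e.2} ->
  same_strand =2 linked (P ++ A).
Proof.
move=> mP pP x y; apply/idP/idP; apply: connect_sub => u v.
  rewrite -/(linked (P ++ A) u v); case/orP => /eqP->.
    have /mem_ends[[a b] eA] := cA u; have /= ab := aA eA.
    case/orP => /eqP /= ->; last rewrite -ab arcK linkedC.
    1,2: by rewrite ab; apply: linked_mem; rewrite mem_cat eA orbT.
  have [->|pu] := eqVneq (p u) u; first exact: linked_refl.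
  have /mem_ends[[a b] eP] : u \in ends P by rewrite mP.
  have /= ab := pP _ eP; case/orP => /eqP /= ->; last rewrite -ab pK linkedC.
  1,2: by rewrite ab; apply: linked_mem; rewrite mem_cat eP.
have key u' v' : (u', v') \in P ++ A -> (v' == Defs.arc D u') || (v' == p u').
  by rewrite mem_cat => /orP[/pP|/aA] /= ->; rewrite eqxx ?orbT.
have key' u' v' : (v' == Defs.arc D u') || (v' == p u') -> (u' == Defs.arc D v') || (u' == p v').
  by case/orP => /eqP->; rewrite ?arcK ?pK eqxx ?orbT.
by case/orP => /key; [move=> h|move/key' => h]; apply: connect1.
Qed.

Lemma strandsE (P : seq (T * T)) : same_strand =2 linked (P ++ A) ->
  strands p = [set [set y | linked (P ++ A) x y] | x in T].
Proof.
move=> E; apply/finset.setP => B; apply/imsetP/imsetP => -[x _ ->]; exists x => //;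
by apply/finset.setP => y; rewrite !inE -E.
Qed.

Lemma mem_vertex (X : {set T}) : X \in graph_vertices p -> exists x, x \in X.
Proof.
rewrite inE => /orP[/imsetP[d _ ->]|]; first by exists d; apply: node_id.
by rewrite inE => /andP[/imsetP[d _ ->] _]; exists d; rewrite !inE connect0.
Qed.

Lemma rep_ex (v : vertex H) : exists x, x \in val v.
Proof. exact/mem_vertex/(valP v). Qed.

Definition rep (v : vertex H) : T := xchoose (rep_ex v).

Lemma repP v : rep v \in val v.
Proof. exact: xchooseP. Qed.

(* vertices are determined by any of their darts *)
Lemma vertex_stop (v : vertex H) z : z \in val v -> p z = z -> val v = node z.
Proof.
have := valP v; rewrite inE => /orP[/imsetP[d _ ->]|].
  by rewrite -node_eq => /eqP.
by rewrite inE => /andP[_ /forallP/(_ z)/implyP h] /h /eqP nz /nz.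
Qed.

Lemma vertex_pass (v : vertex H) z : z \in val v -> p z != z -> val v = [set y | same_strand z y].
Proof.
have := valP v; rewrite inE => /orP[/imsetP[d ]|].
  by rewrite inE => /eqP pd -> zd; rewrite (st pd zd) eqxx.
rewrite inE => /andP[/imsetP[d _ ->] _]; rewrite !inE /= => dz _.
by apply/finset.setP => y; rewrite !inE /=; apply: same_strand_eql.
Qed.

Lemma strand_mem (S : {set T}) z : S \in strands p -> z \in S -> S = [set y | same_strand z y].
Proof.
case/imsetP => x _ ->; rewrite !inE /= => xz.
by apply/finset.setP => y; rewrite !inE; apply: same_strand_eql.
Qed.

Lemma strand_ex (S : {set T}) : S \in strands p -> exists x, x \in S.
Proof. by case/imsetP => x _ ->; exists x; rewrite !inE connect0. Qed.

Lemma rep_linked (u v : vertex H) : linked (graph s) (rep u) (rep v) = (u == v).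
Proof.
apply/idP/eqP => [|->]; last exact: linked_refl.
rewrite linked_graph => uv; apply: val_inj.
have [pu|pu] := eqVneq (p (rep u)) (rep u).
  rewrite (vertex_stop (repP u) pu); rewrite ss // in uv.
  have pv := st pu uv; rewrite (vertex_stop (repP v) pv).
  by apply/eqP; rewrite node_eq node_sym.
have uE := vertex_pass (repP u) pu.
have vu : rep v \in val u.
  have [e1 e2] : s (rep u) = p (rep u) /\ s (p (rep u)) = rep u.
    by rewrite !sp ?pK // eq_sym.
  have : rep v \in [:: rep u; p (rep u)].
    apply: contraTT uv; apply: porbit_closed; rewrite ?mem_head // => z.
    by rewrite !inE => /orP[] /eqP->; rewrite ?e1 ?e2 eqxx ?orbT.
  rewrite uE !inE => /orP[] /eqP->; first exact: connect0.
  by apply: connect1; rewrite /= eqxx orbT.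
have pv : p (rep v) != rep v.
  apply/negP => /eqP pv; move/(vertex_stop vu): (pv) => uN.
  have := repP u; rewrite uN => /(st pv) h; by rewrite h eqxx in pu.
rewrite (vertex_pass (repP v) pv) uE; apply/finset.setP => y; rewrite !inE.
by apply: same_strand_eql; have := vu; rewrite uE !inE.
Qed.

Variables (P W : seq (T * T)) (k : nat).
Hypotheses (mP : forall z, (z \in ends P) = (p z != z)) (pP : {in P, forall e, p e.1 = e.2}).
Hypotheses (uW : uniq (ends W)) (mW : forall z, (z \in ends W) = (z \notin ends P)).
Hypothesis lW : forall u v, u \notin ends P -> v \notin ends P ->
  linked (P ++ A) u v = (u == v) || bond W u v.
Hypothesis nW : ncl (P ++ A) = (size W + k)%N.

Let ssE : same_strand =2 linked (P ++ A) := same_strandE mP pP.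

Lemma stop_mem z : (z \in ends W) = (p z == z).
Proof. by rewrite mW mP negbK. Qed.

Lemma stop_strand u v : p u = u -> p v = v -> same_strand u v = (u == v) || bond W u v.
Proof. by move=> pu pv; rewrite ssE lW // mP ?pu ?pv eqxx. Qed.

Record edge_data (e : edge H) (r : (vertex H * vertex H) * (T * T)) : Prop := EdgeData {
  inc_ends : forall v, inc v e = (v == r.1.1) || (v == r.1.2);
  rep1 : linked (graph s) (rep r.1.1) r.2.1;
  rep2 : linked (graph s) (rep r.1.2) r.2.2;
  in_edge : (r.2.1 \in val e) && (r.2.2 \in val e);
  edge_kind : r.2.1 = r.2.2 /\ (forall z, z \in val e -> p z != z) \/ bond W r.2.1 r.2.2
}.

Lemma stop_vertex d : p d = d -> exists v : vertex H, val v = node d.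
Proof.
move=> pd; have vP : node d \in graph_vertices p.
  by rewrite inE; apply/orP; left; apply/imsetP; exists d; rewrite ?inE ?pd.
by exists (Sub (node d) vP); rewrite SubK.
Qed.

Lemma incE (v : vertex H) (e : edge H) : reflect (exists2 z, z \in val v & z \in val e) (inc v e).
Proof.
apply: (iffP idP) => [/pred0Pn[z /andP[zv ze]]|[z zv ze]]; first by exists z.
by apply/pred0Pn; exists z; apply/andP.
Qed.

Lemma edge_dataP e : exists r, edge_data e r.
Proof.
have eS : val e \in strands p := valP e.
have [[d de pd]|nost] := pselect (exists2 d, d \in val e & p d = d).
  have dW : d \in ends W by rewrite stop_mem pd.
  have [y [V [pV _ bV _]]] := pull_bond dW.
  have dy : bond W d y by rewrite bV bond_cons !eqxx.
  have /andP[_ yW] := bond_ends dy.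
  have py : p y = y by apply/eqP; rewrite -stop_mem.
  have dsy : same_strand d y by rewrite stop_strand // dy orbT.
  have ye : y \in val e by rewrite (strand_mem eS de) inE.
  have [v1 v1E] := stop_vertex pd; have [v2 v2E] := stop_vertex py.
  exists ((v1, v2), (d, y)); split=> /=.
  - move=> v; apply/incE/orP.
      case=> z zv ze.
      have dz : same_strand d z by move: ze; rewrite (strand_mem eS de) inE.
      have pz : p z = z.
        apply/eqP/negPn/negP => pz; have vE := vertex_pass zv pz.
        have dv : d \in val v by rewrite vE inE same_strandC.
        have := repP v; rewrite (vertex_stop dv pd) => h.
        have zd : z \in node d by rewrite -(vertex_stop dv pd).
        by rewrite (st pd zd) eqxx in pz.
      move: dz; rewrite stop_strand // => /orP[/eqP dz|dz].
        by left; apply/eqP/val_inj; rewrite v1E dz; apply: vertex_stop.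
      by right; apply/eqP/val_inj; rewrite v2E (bond_inj uW dy dz); apply: vertex_stop.
    by case=> /eqP->; [exists d|exists y]; rewrite ?v1E ?v2E ?node_id.
  - by rewrite linked_graph -eq_porbit_mem eq_sym eq_porbit_mem ss // -v1E repP.
  - by rewrite linked_graph -eq_porbit_mem eq_sym eq_porbit_mem ss // -v2E repP.
  - by rewrite de ye.
  - by right.
have np z : z \in val e -> p z != z.
  by move=> ze; apply/negP => /eqP pz; apply: nost; exists z.
have vP : val e \in graph_vertices p.
  by rewrite inE; apply/orP; right; rewrite inE eS; apply/forallP => z; apply/implyP/np.
pose v0 : vertex H := Sub (val e) vP.
have v0E : val v0 = val e by rewrite SubK.
exists ((v0, v0), (rep v0, rep v0)); split=> /=; rewrite ?linked_refl //.
- move=> v; rewrite orbb; apply/incE/eqP => [[z zv ze]|->].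
    apply: val_inj; rewrite v0E (vertex_pass zv (np z ze)).
    by rewrite -(strand_mem eS ze).
  by exists (rep v0); [apply: repP|rewrite -v0E repP].
- by rewrite -v0E repP.
- by left; split.
Qed.

Lemma ncomp_ends (F : edge H -> (vertex H * vertex H) * (T * T)) (B : {set edge H}) :
  (forall e, edge_data e (F e)) ->
  ncomp B = ncl [seq (F e).1 | e <- enum (edge H) & e \in B].
Proof.
move=> hF; apply: eq_n_comp => u v; apply/idP/idP; apply: connect_sub => {}u {}v.
  case/existsP => e /andP[eB /andP[ue ve]].
  have : (u == (F e).1.1) || (u == (F e).1.2) by rewrite -(inc_ends (hF e)).
  have : (v == (F e).1.1) || (v == (F e).1.2) by rewrite -(inc_ends (hF e)).
  set L := [seq _ | _ <- _ & _]; rewrite -/(linked L u v).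
  have e12 : linked L (F e).1.1 (F e).1.2.
    apply: linked_mem; rewrite -surjective_pairing; apply: map_f.
    by rewrite mem_filter eB mem_enum.
  by case/orP => /eqP-> /orP[] /eqP->; rewrite ?linked_refl // linkedC.
move=> uv; apply: connect1; rewrite /adj /=; apply/existsP.
by case/orP: uv => /mapP[e]; rewrite mem_filter => /andP[eB _] E; exists e;
  apply/and3P; split=> //; apply: (etrans (inc_ends (hF e) _)); rewrite -E eqxx ?orbT.
Qed.

Lemma strand_flow_aux : exists2 n, (#|edge H| = size W + n)%N /\
    #|[set S in strands p | [forall d in S, p d != d]]| = n &
  forall (K : fieldType) (Q : K), Q != 0 ->
    (map_poly intr (flow_poly H)).[Q] = (Q - 1) ^+ n * flow Q W s.
Proof.
have [F hF] := fin_all_exists edge_dataP.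
pose loop e := (F e).2.1 == (F e).2.2.
pose X := [seq (F e).2 | e <- enum (edge H) & ~~ loop e].
pose Y := [seq (F e).2 | e <- enum (edge H) & loop e].
have bX e : ~~ loop e -> bond W (F e).2.1 (F e).2.2.
  by rewrite /loop; have [[->]|] := edge_kind (hF e); rewrite ?eqxx.
have disj (e e' : edge H) z : z \in val e -> z \in val e' -> e = e'.
  move=> ze ze'; apply: val_inj.
  by rewrite (strand_mem (valP e) ze) (strand_mem (valP e') ze').
have uX : uniq (ends X).
  rewrite /X; elim: (enum (edge H)) (enum_uniq (edge H)) => //= e r IH /andP[er /IH ur].
  case: ifP => // el; rewrite map_cons ends_cons /= inE negb_or.
  have /andP[f1 f2] := in_edge (hF e).
  have out z : z \in val e -> z \notin ends [seq (F e).2 | e <- r & ~~ loop e].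
    move=> ze; apply/negP => /mem_ends[_ /mapP[e' + ->]]; rewrite mem_filter => /andP[_ e'r].
    have /andP[g1 g2] := in_edge (hF e').
    by case/orP => /eqP zE; move: er; rewrite (disj e e' z) ?e'r // zE.
  by rewrite !out // ur !andbT.
have bXW : bond X =2 bond W.
  move=> u v; apply/idP/idP.
    by case/orP => /mapP[e]; rewrite mem_filter => /andP[el _] E;
      have := bX e el; rewrite -E //= bondC.
  move=> uv; have /andP[uW' vW'] := bond_ends uv.
  have [pu pv] : p u = u /\ p v = v by split; apply/eqP; rewrite -stop_mem.
  pose S : {set T} := [set y | same_strand u y].
  have SP : S \in strands p by apply/imsetP; exists u => //; apply/finset.setP => y; rewrite !inE.
  pose e : edge H := Sub S SP.
  have eE : val e = S by rewrite SubK.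
  have uS : u \in val e by rewrite eE inE; apply: connect0.
  have vS : v \in val e by rewrite eE inE stop_strand // uv orbT.
  have el : ~~ loop e.
    have [[_ h]|b] := edge_kind (hF e); first by have := h u uS; rewrite pu eqxx.
    by apply/negP => /eqP E; move: b; rewrite -E (negPf (bond_irr _ uW)).
  have b := bX e el; have /andP[f1 f2] := in_edge (hF e).
  have /andP[g1 g2] := bond_ends b.
  have q1 : p (F e).2.1 = (F e).2.1 by apply/eqP; rewrite -stop_mem.
  have memX : (F e).2 \in X by apply: map_f; rewrite mem_filter el mem_enum.
  have : same_strand (F e).2.1 u.
    by rewrite same_strandC; move: f1; rewrite eE inE.
  rewrite stop_strand // => /orP[/eqP E|b'].
    by rewrite /bond /= -E (bond_inj uW uv (_ : bond W u (F e).2.2)) -?surjective_pairing ?memX -?E.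
  have E : u = (F e).2.2 by apply: bond_inj b' b.
  have E' : v = (F e).2.1 by apply: (bond_inj uW uv); rewrite E bondC.
  by rewrite /bond /= E E' -surjective_pairing memX orbT.
have sX : size X = size W := (matching_eq (0 : int) [::] uX uW bXW).2.
have loopE e : loop e = [forall d in val e, p d != d].
  apply/idP/forallP => [el z|h].
    apply/implyP => ze; have [[_ h]|b] := edge_kind (hF e); first exact: h.
    by move: b; rewrite (eqP el) (negPf (bond_irr _ uW)).
  apply: contraT => /bX b; have /andP[fW _] := bond_ends b.
  have /andP[fe _] := in_edge (hF e); have := implyP (h _) fe.
  by rewrite -(negbK (_ != _)) negbK -stop_mem fW.
have sY : size Y = #|[set e | loop e]|.
  rewrite /Y size_map -(card_uniqP (filter_uniq _ (enum_uniq _))).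
  by apply: eq_card => e; rewrite mem_filter mem_enum andbT inE.
exists (size Y); first split.
- rewrite -sX /X /Y !size_map !size_filter addnC count_predC -cardE.
  by [].
- rewrite sY -(card_imset [set e | loop e] val_inj).
  congr #|pred_of_set _|; apply/finset.setP => S; rewrite !inE.
  apply/andP/imsetP => [[SP h]|[e]].
    by exists (Sub S SP : edge H); rewrite ?inE ?loopE ?SubK.
  by rewrite inE loopE => h ->; split; first exact: (valP e).
move=> K Q Q0; have Qn n : Q ^+ n != 0 by rewrite expf_neq0.
have sumE : (map_poly intr (flow_poly H)).[Q] * Q ^+ #|vertex H|
    = Z Q [seq (F e).1 | e <- enum (edge H)] [::].
  rewrite (Z_subsets _ _ _ (enum_uniq _)) /flow_poly rmorph_sum horner_sum mulr_suml.
  apply: eq_big => [B|B _]; first by apply/esym/fintype.subsetP => e; rewrite mem_enum.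
  rewrite /= map_polyZ map_polyXn hornerZ hornerXn rmorph_sign -mulrA -exprD -cardE.
  rewrite (ncomp_ends _ hF) cats0; congr (_ * _ ^+ _); rewrite subnK //.
  rewrite -(@ncl_nil (vertex H)); apply: leq_trans (ncl_cat_le [seq (F e).1 | e <- enum (edge H) & e \in B] _) _.
  rewrite cats0 leq_add2r size_map size_filter.
  apply: eq_leq; rewrite -size_filter -(card_uniqP (filter_uniq _ (enum_uniq _))).
  by apply: eq_card => e; rewrite mem_filter mem_enum andbT.
apply: (mulIf (Qn #|vertex H|)); rewrite sumE; apply: (mulIf (Qn (ncl (graph s)))).
rewrite -(Z_push (rep_linked) Q [seq (F e).1 | e <- enum (edge H)] [::]) /=.
have -> : push rep [seq (F e).1 | e <- enum (edge H)]
    = [seq (rep (F e).1.1, rep (F e).1.2) | e <- enum (edge H)] by rewrite /push -map_comp.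
rewrite (@Z_congr _ Q _ _ _ (fun e => (F e).2) (enum (edge H)) (graph s)); last first.
  by move=> e _ /=; split; [apply: rep1 (hF e)|apply: rep2 (hF e)].
have pYX : perm_eq [seq (F e).2 | e <- enum (edge H)] (Y ++ X).
  by rewrite /Y /X -map_cat; apply: perm_map; rewrite perm_sym perm_filterC.
rewrite (Z_perm _ _ pYX) Z_loops; last first.
  by move=> _ /mapP[e + ->]; rewrite mem_filter => /andP[/eqP].
rewrite (matching_eq Q _ uX uW bXW).1 flowE // ncl_graph.
by rewrite !mulrA [RHS]mulrAC.
Qed.

Lemma strand_flow (K : fieldType) (Q : K) : Q != 0 ->
  (map_poly intr (flow_poly H)).[Q] = (Q - 1) ^+ k * flow Q W s.
Proof.
have [n [nE _] fE] := strand_flow_aux; suff <- : n = k by apply: fE.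
apply/(@addnI (size W)); rewrite -nE -nW ncl_classes -(strandsE ssE).
by rewrite card_sig; apply: eq_card => S; rewrite inE.
Qed.

Lemma strand_euler : euler_char H = #|stop_nodes|%:Z - (size W)%:Z.
Proof.
have [n [nE cE] _] := strand_flow_aux; rewrite /euler_char nE.
have -> : #|vertex H| = (#|stop_nodes| + n)%N.
  rewrite card_sig -cE -cardsUI.
  have -> : stop_nodes :&: [set S in strands p | [forall d in S, p d != d]] = finset.set0.
    apply/finset.setP => S; rewrite !inE; apply/negP => /andP[/imsetP[d + ->]].
    by rewrite inE => pd /andP[_ /forallP/(_ d)]; rewrite pd node_id.
  by rewrite finset.cards0 addn0; apply: eq_card => S; rewrite !inE.
by rewrite !PoszD; ring.
Qed.

End StrandGraph.

Section StateGraph.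
Variables (D : diagram) (p : dart D -> dart D) (A : seq (dart D * dart D)) (s : {perm dart D}).
Hypothesis pK : involutive p.
Hypotheses (uA : uniq (ends A)) (cA : forall z, z \in ends A)
  (aA : {in A, forall e, Defs.arc D e.1 = e.2}).
Hypothesis st : forall d d' : dart D, p d = d -> d' \in node d -> p d' = d'.
Hypothesis sp : forall d : dart D, p d != d -> s d = p d.
Hypothesis ss : forall d : dart D, p d = d -> porbit s d = node d.

Lemma flow_strand_graph (K : fieldType) (Q : K) : Q != 0 ->
  (map_poly intr (flow_poly (strand_graph p))).[Q] = flow Q A s.
Proof.
move=> Q0; have [P [uP mP pP]] := involution_pairs pK.
have [W [k [uW mW lW [nW _] fW]]] := pairing uA cA uP.
rewrite (strand_flow pK cA aA st sp ss mP pP uW mW lW nW Q0) (fW _ _ s Q0) //.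
move=> e eP; have e1 : e.1 \in ends P by apply/mem_ends; exists e; rewrite ?eqxx.
have := e1; rewrite mP => ne; have pe := pP e eP; rewrite sp // pe; split=> //.
by rewrite -pe sp ?pK // eq_sym.
Qed.

Lemma euler_strand_graph m : m.*2 = #|[set d | p d != d]| ->
  euler_char (strand_graph p) = #|stop_nodes p|%:Z + m%:Z - (size A)%:Z.
Proof.
move=> mE; have [P [uP mP pP]] := involution_pairs pK.
have [W [k [uW mW lW [nW sW] fW]]] := pairing uA cA uP.
rewrite (strand_euler pK cA aA st sp ss mP pP uW mW lW) -sW.
have -> : m = size P.
  apply: double_inj; rewrite mE -size_ends -(card_uniqP uP).
  by apply: eq_card => z; rewrite inE mP.
by rewrite PoszD; ring.
Qed.

End StateGraph.

Section StateSum.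
Variables (I : finType) (K : comNzRingType).
Implicit Types (l : seq I) (f : {ffun I -> resolution}).

Definition upd f c r : {ffun I -> resolution} := [ffun x => if x == c then r else f x].

Lemma mem_states (l : {pred I}) f :
  reflect (forall c, c \notin l -> f c = Fuse) (f \in pffun_on Fuse l predT).
Proof.
apply: (iffP pffun_onP) => [[/supportP h _] c cl|h]; first exact: h.
by split; [apply/supportP => c; apply: h|].
Qed.

Lemma big_states_cons l c (F : {ffun I -> resolution} -> K) : c \notin l ->
  \sum_(f in pffun_on Fuse (mem (c :: l)) predT) F f
  = \sum_(f in pffun_on Fuse (mem l) predT)
      (F (upd f c Smooth0) + F (upd f c Fuse) + F (upd f c Smooth1)).
Proof.
move=> cl; pose h (g : {ffun I -> resolution} * resolution) := upd g.1 c g.2.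
rewrite (reindex_onto h (fun f => (upd f c Fuse, f c))) /=; last first.
  by move=> f _; apply/ffunP => x; rewrite !ffunE; case: eqP => [->|].
rewrite (eq_bigl (fun g => (g.1 \in pffun_on Fuse (mem l) predT) && predT g.2)); last first.
  move=> [f r]; rewrite andbT /=; apply/andP/mem_states => [[/mem_states h1 /eqP[h2 _]] x xl|h1].
    rewrite -h2 !ffunE; case: eqP => // /eqP xc.
    by have := h1 x; rewrite inE (negPf xc) !ffunE (negPf xc); apply.
  split; first by apply/mem_states => x; rewrite inE negb_or !ffunE => /andP[/negPf-> /h1].
  apply/eqP; congr (_, _); last by rewrite !ffunE eqxx.
  apply/ffunP => x; rewrite !ffunE; case: eqP => // ->; exact/esym/h1.
rewrite -(pair_big (fun f => f \in pffun_on Fuse (mem l) predT) predT (fun f r => F (h (f, r)))) /=.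
apply: eq_bigr => f _; rewrite /h /=.
rewrite (bigD1 Smooth0) //= (bigD1 Fuse) //= (bigD1 Smooth1) //= big1 ?addr0 ?addrA //.
by case.
Qed.

End StateSum.

Section Smoothing.
Variable D : diagram.
Local Notation T := (dart D).
Local Notation r := (Defs.rot D).
Implicit Types (u d z : T) (U : seq T) (f : state D) (t : {perm T}).

Lemma node_in d d' : d' \in node d -> node d' = node d.
Proof. by rewrite -eq_porbit_mem => /eqP. Qed.

Lemma iter_node i d : iter i r d \in node d.
Proof. by rewrite -permX mem_porbit. Qed.

Lemma node_rot d : node (r d) = node d.
Proof. exact/node_in/(iter_node 1). Qed.

Lemma node_crossing d d' : d' \in node d -> (d' \in crossing D) = (d \in crossing D).
Proof.
by case/porbitP => i ->; rewrite permX; elim: i => //= i <-; apply: crossing_rot.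
Qed.

Lemma crossing_order d : d \in crossing D ->
  r (r (r (r d))) = d /\ uniq [:: d; r d; r (r d); r (r (r d))].
Proof.
move=> dX; have c4 := crossing_card dX; split.
  by have := iter_porbit r d; rewrite c4.
by have := uniq_traject_porbit r d; rewrite c4.
Qed.

Lemma mem_crossing_node u z : u \in crossing D ->
  z \in node u -> z \in [:: u; r u; r (r u); r (r (r u))].
Proof. by move=> uX; rewrite /node porbit_traject crossing_card. Qed.

Definition swap f u : {perm T} :=
  match f (node u) with
  | Smooth0 => tperm (r u) (r (r (r u)))
  | Fuse => 1%g
  | Smooth1 => tperm u (r (r u))
  end.

Lemma swap_out f u z : z \notin node u -> swap f u z = z.
Proof.
move=> zu; have nz i : iter i r u != z by apply: contraNneq zu => <-; apply: iter_node.
rewrite /swap; case: (f _); rewrite ?perm1 //; apply: tpermD.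
- exact: (nz 1%N).
- exact: (nz 3%N).
- exact: (nz 0%N).
- exact: (nz 2%N).
Qed.

Lemma swap_in f u z : z \in node u -> swap f u z \in node u.
Proof.
move=> zu; rewrite /swap; case: (f _); rewrite ?perm1 //; case: tpermP => // _.
- exact: (iter_node 3).
- exact: (iter_node 1).
- exact: (iter_node 2).
- exact: (iter_node 0).
Qed.

Definition settle f U t : {perm T} := foldl (fun t u => swap f u * t)%g t U.

Lemma settle_out f U t z : (forall u, u \in U -> z \in node u -> f (node u) = Fuse) ->
  settle f U t z = t z.
Proof.
elim: U t => //= u U IH t h; rewrite IH; last by move=> v vU; apply: h; rewrite inE vU orbT.
have [zu|/swap_out zu] := boolP (z \in node u); last by rewrite permM zu.
by rewrite /swap h ?mem_head // mul1g.
Qed.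

Lemma settle_in f U t u z : uniq (map (@node D) U) -> u \in U -> z \in node u ->
  settle f U t z = t (swap f u z).
Proof.
elim: U t => // v U IH t /= /andP[vU uU]; rewrite inE => /orP[/eqP uv|uU'] zu.
  subst v; rewrite settle_out ?permM // => w wU zw.
  by move: vU; rewrite -(node_in zu) (node_in zw) map_f.
rewrite IH // permM swap_out //; apply: contra vU => zv.
by rewrite -(node_in zv) (node_in (swap_in f zu)) map_f.
Qed.

Lemma eq_porbit_on s t d : {in porbit s d, t =1 s} -> porbit t d = porbit s d.
Proof.
move=> ts; have itE i : iter i t d = iter i s d.
  by elim: i => //= i ->; apply: ts; rewrite -permX mem_porbit.
by apply/finset.setP => z; apply/porbitP/porbitP => -[i ->]; exists i; rewrite !permX itE.
Qed.

Section State.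
Variables (U : seq T) (f : state D).
Hypothesis UX : {in U, forall u, u \in crossing D /\ u \notin Defs.over D}.
Hypothesis U_crossings : map (@node D) U = enum (crossings D).
Hypothesis fX : forall c, c \notin crossings D -> f c = Fuse.
Local Notation s := (settle f U r).
Local Notation p := (@state_pass D f).

Lemma U_uniq : uniq (map (@node D) U).
Proof. by rewrite U_crossings enum_uniq. Qed.

Lemma under_dart d : d \in crossing D -> exists2 u, u \in U & d \in node u.
Proof.
move=> dX; have : node d \in map (@node D) U by rewrite U_crossings mem_enum; apply/imsetP; exists d.
by case/mapP => u uU dE; exists u; rewrite // -dE node_id.
Qed.

Lemma smoothed_crossing d : f (node d) != Fuse -> d \in crossing D.
Proof.
move=> fd; have : node d \in crossings D by apply: contraNT fd => /fX ->.
by case/imsetP => e eX dE; rewrite -(node_crossing (_ : d \in node e)) // in eX *; rewrite -dE node_id.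
Qed.

Lemma state_pass_smooth d : f (node d) != Fuse ->
  [/\ p d = s d, p d != d, p (p d) = d & node (p d) = node d].
Proof.
move=> fd; have dX := smoothed_crossing fd; have [u uU du] := under_dart dX.
have [uX uO] := UX uU; have [r4 un] := crossing_order uX.
have rK x : (r^-1)%g (r x) = x by apply: permK.
have rK3 : (r^-1)%g u = r (r (r u)) by apply: (perm_inj (s := r)); rewrite permKV.
have ov x : x \in crossing D -> (r x \in Defs.over D) = (x \notin Defs.over D) by apply: over_rot.
have nE : node d = node u := node_in du.
have pE x : x \in node u -> p x = match f (node u) with
  | Smooth0 => if x \in Defs.over D then (r^-1)%g x else r x
  | Smooth1 => if x \in Defs.over D then r x else (r^-1)%g x
  | Fuse => x end by move=> /node_in xE; rewrite /state_pass xE.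
have i0 := iter_node 0 u; have i1 := iter_node 1 u; have i2 := iter_node 2 u; have i3 := iter_node 3 u.
have o1 : (r u \in Defs.over D) = true by rewrite ov // uO.
have o2 : (r (r u) \in Defs.over D) = false by rewrite ov ?crossing_rot // o1.
have o3 : (r (r (r u)) \in Defs.over D) = true by rewrite ov ?crossing_rot // o2.
have o0 : (u \in Defs.over D) = false := negbTE uO.
move: un; rewrite /= !inE !negb_or => /and4P[/and3P[n01 n02 n03] /andP[n12 n13] n23 _].
have sE x : x \in node u -> s x = r (swap f u x) by move=> xu; apply: settle_in U_uniq uU xu.
have [n10 n20 n30] : [/\ r u != u, r (r u) != u & r (r (r u)) != u] by split; rewrite eq_sym.
have [n21 n31 n32] : [/\ r (r u) != r u, r (r (r u)) != r u & r (r (r u)) != r (r u)].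
  by split; rewrite eq_sym.
have pair x y : x \in node u -> y \in node u -> x != y -> p x = y -> p y = x -> s x = y ->
    [/\ p x = s x, p x != x, p (p x) = x & node (p x) = node x].
  by move=> xu yu xy px py sx; rewrite px sx py (node_in xu) (node_in yu) eq_sym.
rewrite nE in fd; move: fd; have := mem_crossing_node uX du; rewrite !inE.
case fu: (f (node u)) => // + _.
- have t0 : swap f u u = u by rewrite /swap fu tpermD.
  have t1 : swap f u (r u) = r (r (r u)) by rewrite /swap fu tpermL.
  have t2 : swap f u (r (r u)) = r (r u) by rewrite /swap fu tpermD // eq_sym.
  have t3 : swap f u (r (r (r u))) = r u by rewrite /swap fu tpermR.
  by case/or4P => /eqP->; [apply: (pair u (r u))|apply: (pair (r u) u)|apply: (pair (r (r u)) (r (r (r u))))|apply: (pair (r (r (r u))) (r (r u)))];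
    rewrite ?node_rot //; rewrite ?pE ?sE ?node_rot // ?fu ?o0 ?o1 ?o2 ?o3 ?rK ?t0 ?t1 ?t2 ?t3 ?r4.
have t0 : swap f u u = r (r u) by rewrite /swap fu tpermL.
have t1 : swap f u (r u) = r u by rewrite /swap fu tpermD // eq_sym.
have t2 : swap f u (r (r u)) = u by rewrite /swap fu tpermR.
have t3 : swap f u (r (r (r u))) = r (r (r u)) by rewrite /swap fu tpermD // eq_sym.
by case/or4P => /eqP->; [apply: (pair u (r (r (r u))))|apply: (pair (r u) (r (r u)))|apply: (pair (r (r u)) (r u))|apply: (pair (r (r (r u))) u)];
  rewrite ?node_rot //; rewrite ?pE ?sE ?node_rot // ?fu ?o0 ?o1 ?o2 ?o3 ?rK ?rK3 ?t0 ?t1 ?t2 ?t3 ?r4.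
Qed.

Lemma state_passE d : (p d == d) = (f (node d) == Fuse).
Proof.
by have [fd|fd] := eqVneq (f (node d)) Fuse; [rewrite /state_pass fd eqxx|
  have [_ /negPf] := state_pass_smooth fd].
Qed.

Lemma state_pass_invol : involutive p.
Proof.
move=> d; have [fd|/state_pass_smooth[]//] := eqVneq (f (node d)) Fuse.
by rewrite /state_pass !fd.
Qed.

Lemma settle_porbit d : p d = d -> porbit s d = node d.
Proof.
move/eqP; rewrite state_passE => /eqP fd; apply: eq_porbit_on => z zd.
by apply: settle_out => u uU zu; rewrite -(node_in zu) (node_in zd).
Qed.

End State.
End Smoothing.

Lemma card_nodes (D : diagram) (Pr : pred {set dart D}) :
  #|[set d | Pr (node d)]| = (\sum_(c in porbits (Defs.rot D) | Pr c) #|c|)%N.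
Proof.
rewrite -sum1_card (partition_big (@node D) (fun c => (c \in porbits (Defs.rot D)) && Pr c)) /=.
  apply: eq_bigr => c /andP[/imsetP[d _ ->] Pc]; rewrite sum1_card.
  apply: eq_card => z; rewrite -eq_porbit_mem unfold_in /= inE.
  by rewrite /node; case: eqP => [->|_]; rewrite ?Pc ?andbF.
by move=> d; rewrite inE => ->; rewrite andbT; apply: imset_f.
Qed.

Lemma sum_nodes (D : diagram) (Pr : pred {set dart D}) m :
  {in porbits (Defs.rot D), forall c : {set dart D}, Pr c -> #|c| = m} ->
  #|[set d | Pr (node d)]| = (#|[set c in porbits (Defs.rot D) | Pr c]| * m)%N.
Proof.
move=> h; rewrite card_nodes -sum_nat_cond_const; by apply: eq_bigr => c /andP[/h].
Qed.

Section StateExpansion.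
Variables (D : diagram) (A : seq (dart D * dart D)) (U : seq (dart D)).
Local Notation r := (Defs.rot D).
Hypotheses (uA : uniq (ends A)) (cA : forall z, z \in ends A)
  (aA : {in A, forall e, Defs.arc D e.1 = e.2}).
Hypothesis UX : {in U, forall u, u \in crossing D /\ u \notin Defs.over D}.
Hypothesis U_crossings : map (@node D) U = enum (crossings D).

Lemma crossings_porbits c : c \in crossings D -> c \in porbits r /\ #|c| = 4%N.
Proof. by case/imsetP => d dX ->; rewrite crossing_card // imset_f. Qed.

Lemma state_yamada (f : state D) (K : fieldType) (q : K) :
  (forall c, c \notin crossings D -> f c = Fuse) -> q + 2 + q^-1 != 0 ->
  planar_yamada (strand_graph (state_pass f)) q
  = (-1) ^+ (#|porbits r| + size A + #|[set c in crossings D | f c != Fuse]|)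
    * flow (q + 2 + q^-1) A (settle f U r).
Proof.
move=> fX Q0; set n := #|[set c in _ | _]|.
have pE := state_passE UX U_crossings fX.
have st d d' : state_pass f d = d -> d' \in node d -> state_pass f d' = d'.
  by move/eqP; rewrite pE => fd dd'; apply/eqP; rewrite pE (node_in dd').
have sp d : state_pass f d != d -> settle f U r d = state_pass f d.
  by rewrite pE => /(state_pass_smooth UX U_crossings fX)[].
have pK := state_pass_invol UX U_crossings fX.
have ss d := @settle_porbit D U f UX U_crossings fX d.
rewrite /planar_yamada (flow_strand_graph pK uA cA aA st sp ss) //; congr (_ * _).
have nE : (n.*2).*2 = #|[set d | state_pass f d != d]|.
  have -> : [set d | state_pass f d != d] = [set d | f (node d) != Fuse].
    by apply/finset.setP => d; rewrite !inE pE.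
  rewrite (@sum_nodes _ (fun c => f c != Fuse) 4); last first.
    move=> c _ fc; have cX : c \in crossings D by apply: contraNT fc => /fX ->.
    by have [] := crossings_porbits cX.
  have -> : [set c in porbits r | f c != Fuse] = [set c in crossings D | f c != Fuse].
    apply/finset.setP => c; rewrite !inE; apply/andP/andP => -[h1 h2]; split=> //.
      by apply: contraNT h2 => /fX ->.
    by have [] := crossings_porbits h1.
  by rewrite -/n -!muln2 -mulnA.
rewrite (euler_strand_graph pK uA cA aA st sp ss nE).
have -> : #|stop_nodes (state_pass f)| = (#|porbits r| - n)%N.
  have -> : stop_nodes (state_pass f) = porbits r :\: [set c in crossings D | f c != Fuse].
    apply/finset.setP => c; rewrite !inE; apply/imsetP/andP => [[d + ->]|[h /imsetP[d _ dE]]].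
      by rewrite inE pE => /eqP->; rewrite eqxx andbF imset_f.
    exists d => //; rewrite inE pE -[node d]dE; move: h; rewrite negb_and negbK => /orP[/fX->//|//].
  rewrite finset.cardsD; congr (_ - _)%N; apply: eq_card => c; rewrite !inE.
  by case: (boolP (c \in crossings D)) => [/crossings_porbits[->]|_]; rewrite ?andbF.
have nle : (n <= #|porbits r|)%N.
  by apply: subset_leq_card; apply/fintype.subsetP => c; rewrite !inE => /andP[/crossings_porbits[]].
move: nle; move: #|porbits r| (size A) => N a nle.
rewrite -subzn //.
have -> : N%:Z - n%:Z + (n.*2)%:Z - a%:Z = (N + a + n)%:Z - (a + a)%:Z by rewrite -addnn !PoszD; ring.
have u : (-1 : K) != 0 by rewrite oppr_eq0 oner_eq0.
by rewrite expfzDr // -invr_expz -!exprnP addnn -mul2n exprM sqrrN !expr1n invr1 mulr1.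
Qed.

Definition signed_weight (K : fieldType) (q : K) (f : state D) c : K :=
  (-1) ^+ (f c != Fuse) * weight q (f c).

Definition quad (u : dart D) : site (dart D) := (((u, r u), (r (r u), r (r (r u)))), (u, u)).

Lemma settle_upd (f : state D) V c x t :
  c \notin map (@node D) V -> settle (upd f c x) V t = settle f V t.
Proof.
elim: V t => //= v V IH t; rewrite inE negb_or => /andP[cv cV]; rewrite IH //.
by congr (settle _ _ (_ * _)); rewrite /swap !ffunE eq_sym (negPf cv).
Qed.

Lemma resolve_sum (K : fieldType) (q Q : K) V t : uniq (map (@node D) V) ->
  resolve q Q A t (map quad V)
  = \sum_(f in pffun_on Fuse (mem (map (@node D) V)) predT)
      (\prod_(c <- map (@node D) V) signed_weight q f c) * flow Q A (settle f V t).
Proof.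
elim: V t => [|u V IH] t.
  move=> _; rewrite (big_pred1 [ffun=> Fuse]) ?big_nil ?mul1r // => f.
  apply/mem_states/eqP => [h|-> c _]; last by rewrite ffunE.
  by apply/ffunP => c; rewrite ffunE h.
rewrite map_cons [X in X -> _]/= => /andP[uV uniqV]; rewrite big_states_cons //= !IH //.
rewrite !mulr_sumr -!sumrN -!big_split /=; apply: eq_bigr => f _; rewrite !big_cons.
have prodE x : \prod_(c <- map (@node D) V) signed_weight q (upd f (node u) x) c
    = \prod_(c <- map (@node D) V) signed_weight q f c.
  apply: eq_big_seq => c cV; rewrite /signed_weight !ffunE.
  by have /negPf-> : c != node u by apply: contraNneq uV => <-.
rewrite !prodE !settle_upd // /swap /signed_weight !ffunE eqxx /= mul1g.
by move: (flow _ _ _) (flow _ _ _) (flow _ _ _) (\prod_(c <- _) _) => *; ring.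
Qed.

Lemma yamada_resolve (K : fieldType) (q : K) : q + 2 + q^-1 != 0 ->
  yamada D q = (-1) ^+ (#|porbits r| + size A) * resolve q (q + 2 + q^-1) A r (map quad U).
Proof.
move=> Q0; rewrite resolve_sum ?(U_uniq U_crossings) // mulr_sumr /yamada.
have X (f : state D) : f \in pffun_on Fuse (mem (crossings D)) predT ->
    forall c, c \notin crossings D -> f c = Fuse.
  by move/mem_states.
rewrite U_crossings [RHS](eq_bigl (fun f => f \in pffun_on Fuse (mem (crossings D)) predT)); last first.
  move=> f; apply/idP/idP => /mem_states h; apply/mem_states => c cX; apply: h;
  by move: cX; rewrite ?mem_enum // -topredE /= mem_enum.
apply: eq_bigr => f /X fX.
have E := state_yamada fX Q0; rewrite E exprD.
have enumE (F : {set dart D} -> K) :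
    \prod_(c <- enum (crossings D)) F c = \prod_(c in crossings D) F c.
  by apply: big_enum.
rewrite enumE.
have -> : \prod_(c in crossings D) signed_weight q f c
    = (-1) ^+ #|[set c in crossings D | f c != Fuse]| * \prod_(c in crossings D) weight q (f c).
  rewrite big_split /= prodrXr; congr (_ ^+ _ * _).
  by rewrite -sum1dep_card [RHS]big_mkcondr /=; apply: eq_bigr => c _; case: (_ != _).
move: (flow _ _ _) (\prod_(c in _) _) #|_| (_ ^+ (_ + _)) => F P n e; ring.
Qed.

End StateExpansion.

Section Extension.
Variables (V S : finType).
Implicit Types (s t : {perm V}) (W : seq (V * V)).
Local Notation T := (V + S)%type.

Definition extend_fun t (z : T) : T := if z is inl v then inl (t v) else z.

Lemma extend_fun_inj t : injective (extend_fun t).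
Proof. by case=> [u|x] [v|y] //= [] /perm_inj->. Qed.

Definition extend t : {perm T} := perm (@extend_fun_inj t).

Lemma extend_inl t v : extend t (inl v) = inl (t v).
Proof. by rewrite permE. Qed.

Lemma extend_inr t x : extend t (inr x) = inr x.
Proof. by rewrite permE. Qed.

Lemma extend1 : extend 1 = 1%g.
Proof. by apply/permP => -[v|x]; rewrite ?extend_inl ?extend_inr !perm1. Qed.

Lemma extendM s t : extend (s * t)%g = (extend s * extend t)%g.
Proof. by apply/permP => -[v|x]; rewrite permM ?extend_inl ?extend_inr // permM. Qed.

Lemma extend_tperm u v : extend (tperm u v) = tperm (inl u) (inl v).
Proof.
apply/permP => -[w|x]; last by rewrite extend_inr tpermD.
have i : injective (@inl V S) by move=> ? ? [].
by rewrite extend_inl inj_tperm.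
Qed.

Lemma extend_swaps W : extend (swaps W) = swaps (push inl W).
Proof.
elim: W => [|[u v] W IH]; first by rewrite /swaps !big_nil extend1.
by rewrite [push _ _]/= !swaps_cons extendM extend_tperm IH.
Qed.

Lemma inl_linked u v : linked [::] (inl u : T) (inl v) = (u == v).
Proof. by rewrite linked_nil. Qed.

Lemma push_graph t W :
  linked (push inl W ++ graph (extend t)) =2 linked (push inl (W ++ graph t) ++ [::]).
Proof.
rewrite cats0 /push map_cat; apply: eq_linked_cat => u v; apply/idP/idP; apply: connect_sub => {}u {}v.
  move=> /= /orP[] /mapP[[w|x] _ [-> ->]]; rewrite ?extend_inl ?extend_inr ?connect0 //.
    by apply: linked_mem; apply/mapP; exists (w, t w) => //; apply: mem_graph.
  by rewrite -/(linked _ _ _) linkedC; apply: linked_mem; apply/mapP; exists (w, t w) => //; apply: mem_graph.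
have key w : linked (graph (extend t)) (inl w) (inl (t w)).
  by rewrite -extend_inl; apply: linked_mem; apply: mem_graph.
have key' w : linked (graph (extend t)) (inl (t w)) (inl w) by rewrite linkedC.
by move=> /= /orP[] /mapP[[x y]] /mapP[w _ [-> ->]] [-> ->] /=; [apply: key|apply: key'].
Qed.

Lemma ncl_extend t W : ncl (push inl W ++ graph (extend t)) = (ncl (W ++ graph t) + #|S|)%N.
Proof.
have := ncl_push inl_linked (W ++ graph t); rewrite (eq_ncl (push_graph t W)) ncl_nil card_sum.
by move: (ncl _) (ncl _) #|V| #|S| => a b c d; clear; lia.
Qed.

Lemma porbits_extend t : #|porbits (extend t)| = (#|porbits t| + #|S|)%N.
Proof. by have := ncl_extend t [::]; rewrite /= !ncl_graph. Qed.

Lemma planar_extend t W : planar W t -> planar (push inl W) (extend t).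
Proof.
rewrite /planar ncl_extend -extend_swaps -extendM !porbits_extend size_map doubleD.
by move: (ncl _) #|_| #|_| (size _) #|S| => a b c d e; clear; lia.
Qed.

Lemma flow_extend (K : fieldType) (Q : K) t W : Q != 0 ->
  flow Q (push inl W) (extend t) = flow Q W t.
Proof.
move=> Q0; have Qn n : Q ^+ n != 0 by rewrite expf_neq0.
have := Z_push inl_linked Q W (graph t).
rewrite ncl_nil card_sum -(Z_ext _ _ (push_graph t [::])) /=.
rewrite /flow porbits_extend !exprD.
move: (Qn #|V|) (Qn #|S|) (Qn #|porbits t|) (Z _ _ _) (Z _ _ _).
move: (Q ^+ #|V|) (Q ^+ #|S|) (Q ^+ #|porbits t|) => a b c a0 b0 c0 z z' E.
by apply: (mulIf a0); rewrite mulrAC E; field; rewrite b0 c0.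
Qed.

Lemma ends_push W : ends (push inl W) = map (@inl V S) (ends W).
Proof. by elim: W => // e W IH; rewrite /push map_cons !ends_cons IH. Qed.

Lemma resolve_extend (K : fieldType) (q Q : K) (sp : V -> S * S) C t W : Q != 0 ->
  resolve q Q (push inl W) (extend t)
    [seq (((inl k.1.1.1, inl k.1.1.2), (inl k.1.2.1, inl k.1.2.2)), (inr (sp k.2.1).1, inr (sp k.2.1).2)) | k <- C]
  = resolve q Q W t C.
Proof.
move=> Q0; elim: C t => [|[[[a b] [c d]] [x y]] C IH] t /=; first exact: flow_extend.
by rewrite -!extend_tperm -!extendM !IH.
Qed.

End Extension.

Section DiagramCore.
Variables (D : diagram) (A : seq (dart D * dart D)) (U : seq (dart D)).
Local Notation r := (Defs.rot D).
Local Notation T := (dart D + dart D * bool)%type.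
Hypotheses (uA : uniq (ends A)) (cA : forall z, z \in ends A)
  (aA : {in A, forall e, Defs.arc D e.1 = e.2}).
Hypothesis UX : {in U, forall u, u \in crossing D /\ u \notin Defs.over D}.
Hypothesis U_crossings : map (@node D) U = enum (crossings D).
Hypothesis hdeg : forall v : {set dart D}, v \in vertices D -> #|v| = 2%N \/ #|v| = 3%N.

Lemma arc_swaps : swaps A = Defs.arc D.
Proof.
apply/permP => d; have /mem_ends[e eA dE] := cA d.
have ae := aA eA; have pE : perm_eq (ends A) (ends (e :: rem e A)).
  exact/ends_perm/perm_to_rem.
have := uA; rewrite (perm_uniq pE) ends_cons /= inE negb_or => /and3P[/andP[_ e1] e2 _].
rewrite (swaps_rem eA uA) swaps_cons permM.
by case/orP: dE => /eqP->; rewrite ?tpermL ?tpermR swaps_out // -ae ?arcK.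
Qed.

Lemma porbits_arc : #|porbits (Defs.arc D)| = size A.
Proof.
have E : linked (graph (Defs.arc D)) =2 linked A.
  have key : {in A, forall e, Defs.arc D e.1 = e.2} := aA.
  move=> u v; apply/idP/idP; apply: linked_sub => -[x y].
    case/mapP => w _ [-> ->]; have /mem_ends[e eA] := cA w; have ae := aA eA.
    have e12 : linked A e.1 e.2 by apply: linked_mem; rewrite -surjective_pairing.
    by case/orP => /eqP->; [rewrite ae|rewrite -ae arcK ae linkedC].
  by move=> xyA; apply: linked_mem; have /= <- := aA xyA; apply: mem_graph.
have cardT : #|dart D| = (size A).*2.
  by rewrite -size_ends -(card_uniqP uA); apply: eq_card => z; rewrite cA.
have := ncl_matching uA; rewrite -(eq_ncl E) ncl_graph cardT -addnn.
exact: addIn.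
Qed.

Lemma planar_diagram : planar A r.
Proof.
have := planar_euler D; rewrite porbits_arc /planar arc_swaps => ->; congr (_ + _.*2)%N.
apply: eq_n_comp => u v; apply/idP/idP; apply: connect_sub => {}u {}v.
  move=> /= uv; have arcA w : linked (A ++ graph r) w (Defs.arc D w).
    have /mem_ends[e eA] := cA w; have ae := aA eA.
    have e12 : linked (A ++ graph r) e.1 e.2.
      by apply: linked_mem; rewrite -surjective_pairing mem_cat eA.
    by case/orP => /eqP->; [rewrite ae|rewrite -ae arcK ae linkedC].
  case/orP: uv => /eqP->; first exact: arcA.
  by apply: linked_mem; rewrite mem_cat mem_graph orbT.
set e := [rel x y | _].
have rotE i x : connect e x (iter i r x).
  elim: i => [|i IH]; first exact: connect0.
  by apply: connect_trans IH (connect1 _); rewrite /e /= eqxx orbT.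
have rotC x : connect e (r x) x.
  have /porbitP[i xE] : x \in porbit r (r x) by rewrite porbit_sym (mem_porbit r 1).
  by rewrite {2}xE permX; apply: rotE.
have arcE x : connect e x (Defs.arc D x) by apply: connect1; rewrite /= eqxx.
have arcC x : connect e (Defs.arc D x) x by rewrite -{2}[x](@arcK D); apply: arcE.
move=> /= /orP[]; rewrite mem_cat => /orP[|/mapP[w _ [-> ->]]].
- by move/aA => /= <-; apply: arcE.
- exact: (rotE 1%N).
- by move/aA => /= <-; apply: arcC.
- exact: rotC.
Qed.

Lemma degree_live d : d \notin crossing D ->
  r d != d /\ (r (r d) = d \/ r (r (r d)) = d).
Proof.
move=> dX; have : node d \in vertices D by apply/imsetP; exists d; rewrite ?inE.
have it := iter_porbit r d; have un := uniq_traject_porbit r d.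
by case/hdeg => c; move: it un; rewrite -/(node d) c /= => it; rewrite !inE ?negb_or ?it;
  case/andP => h _; split; rewrite 1?eq_sym; auto; case/andP: h.
Qed.

Definition lift_site (k : site (dart D)) : site T :=
  (((inl k.1.1.1, inl k.1.1.2), (inl k.1.2.1, inl k.1.2.2)),
   (inr (k.2.1, false), inr (k.2.1, true))).

Definition sites : seq (site T) := map lift_site (map (@quad D) U).

Lemma mem_sites_l d : (inl d \in all_darts sites) = (d \in crossing D).
Proof.
apply/flattenP/idP => [[_ /mapP[_ /mapP[_ /mapP[u uU ->] ->] ->]]|dX].
  have [uX _] := UX uU; rewrite /lift_site /= !inE orbF => /or4P[] /eqP[->];
    by rewrite ?crossing_rot.
have [u uU du] := under_dart U_crossings dX; have [uX _] := UX uU.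
exists (darts (lift_site (quad u))); first by do 3!apply: map_f.
have := mem_crossing_node uX du; rewrite !inE.
by case/or4P => /eqP->; rewrite eqxx ?orbT.
Qed.

Lemma mem_ends_push (z : T) : (z \in ends (push inl A)) = (if z is inl _ then true else false).
Proof.
rewrite ends_push; case: z => [d|x]; first by rewrite mem_map ?cA // => ? ? [].
by apply/negP => /mapP[].
Qed.

Lemma good_diagram : good (all_darts sites) (push inl A) (extend (dart D * bool)%type r).
Proof.
split.
- by rewrite ends_push map_inj_uniq // => ? ? [].
- by case=> [d|x]; rewrite mem_ends_push // extend_inr.
case=> [d|x]; rewrite mem_ends_push // mem_sites_l => _ dX; rewrite !extend_inl.
have [rd rr] := degree_live dX; split; first by apply: contra rd => /eqP[->].
by case: rr => e; [left|right]; rewrite ?extend_inl e.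
Qed.

Lemma uniq_sites : uniq (all_darts sites).
Proof.
rewrite /sites.
have : uniq (map (@node D) U) := U_uniq U_crossings.
have : {in U, forall u, u \in crossing D} by move=> u /UX[].
elim: U => // u V IH VX; rewrite map_cons cons_uniq => /andP[uV uniqV].
have uX : u \in crossing D by apply: VX; rewrite mem_head.
have VX' : {in V, forall v, v \in crossing D} by move=> v vV; apply: VX; rewrite inE vV orbT.
rewrite !map_cons all_darts_cons cat_uniq IH // andbT; apply/andP; split.
  rewrite -[darts _]/(map inl [:: u; r u; r (r u); r (r (r u))] ++ map inr [:: (u, false); (u, true)]).
  rewrite cat_uniq !map_inj_uniq; [|by move=> ? ? []|by move=> ? ? []].
  have [_ ->] := crossing_order uX; rewrite andTb; apply/andP; split.
    by apply/hasPn => _ /mapP[x _ ->]; apply/mapP => -[].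
  by rewrite /= inE xpair_eqE eqxx.
pose base (z : T) := match z with inl d => d | inr x => x.1 end.
have baseE v z : z \in darts (lift_site (quad v)) -> node (base z) = node v.
  rewrite -[darts _]/(map inl [:: v; r v; r (r v); r (r (r v))] ++ map inr [:: (v, false); (v, true)]).
  rewrite mem_cat => /orP[] /mapP[x + ->] /=; rewrite !inE; last by case/orP => /eqP->.
  by case/or4P => /eqP->; rewrite ?node_rot.
apply/hasPn => z /flattenP[_ /mapP[_ /mapP[_ /mapP[v vV ->] ->] ->]] /baseE zv.
apply/negP => /baseE zu; move: uV; rewrite -zu zv => /negP; apply; exact: map_f.
Qed.

Lemma sites_ok_diagram : sites_ok (push inl A) (extend (dart D * bool)%type r) sites.
Proof.
split; first exact: uniq_sites.
  move=> _ /mapP[_ /mapP[u uU ->] ->]; have [uX _] := UX uU; have [r4 _] := crossing_order uX.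
  by split; rewrite ?extend_inl ?r4.
move=> a b c d x y /mapP[_ /mapP[u uU ->] [-> -> -> -> -> ->]].
split; rewrite ?extend_inr ?mem_ends_push // => z.
by rewrite !inE => /or4P[] /eqP->; rewrite mem_ends_push.
Qed.

Lemma resolve_diagram (K : fieldType) (q Q : K) : Q != 0 ->
  resolve q Q (push inl A) (extend (dart D * bool)%type r) sites
  = resolve q Q A r (map (@quad D) U).
Proof.
exact: (@resolve_extend _ (dart D * bool)%type K q Q (fun u => ((u, false), (u, true)))).
Qed.

Lemma diagram_golden (K : fieldType) (phi q : K) : phi ^+ 2 = phi + 1 -> phi + 2 != 0 ->
  q != 0 -> q + q^-1 = phi ->
  phi ^+ (nbiv (extend (dart D * bool)%type r) + #|crossings D|.*2)
    * ((-1) ^+ (#|porbits r| + size A) * yamada D q)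
  = (-1) ^+ #|crossings D| * phi ^+ size A * yamada D (q ^- 2) ^+ 2.
Proof.
move=> phi2 phi5 q0 qphi.
have phi0 := phi_neq0 phi2.
have Q1 : q + 2 + q^-1 = phi + 2 by rewrite -qphi; ring.
have Q2 : q ^- 2 + 2 + (q ^- 2)^-1 = phi + 1.
  by rewrite -phi2 -qphi invrK sqrrD mulfV // -exprVn; ring.
have Q20 : phi + 1 != 0 by rewrite -phi2 expf_neq0.
have sizeC : size sites = #|crossings D|.
  by rewrite !size_map cardE -U_crossings size_map.
have := golden_crossings phi2 phi5 q0 qphi good_diagram sites_ok_diagram (planar_extend _ planar_diagram).
rewrite !resolve_diagram // sizeC size_map.
rewrite (yamada_resolve uA cA aA UX U_crossings) ?Q1 //.
rewrite (yamada_resolve uA cA aA UX U_crossings) ?Q2 //.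
by rewrite exprMn signrMK -exprM mulnC exprM sqrrN !expr1n mul1r.
Qed.

End DiagramCore.

Section Counting.
Variables (D : diagram) (A : seq (dart D * dart D)).
Local Notation r := (Defs.rot D).
Hypotheses (uA : uniq (ends A)) (cA : forall z, z \in ends A)
  (aA : {in A, forall e, Defs.arc D e.1 = e.2}).

Let straight (d : dart D) : dart D := if d \in crossing D then r (r d) else d.
Let turn (d : dart D) : dart D := if d \in crossing D then r (r d) else r d.

Lemma turn_inj : injective turn.
Proof.
move=> x y; have tX z : (turn z \in crossing D) = (z \in crossing D).
  by rewrite /turn; case: ifP => zX; rewrite !crossing_rot.
move=> E; have := tX x; rewrite E tX => yX; move: E; rewrite /turn -yX.
by case: ifP => _; repeat move/perm_inj.
Qed.

Lemma straightE d : (straight d == d) = (d \notin crossing D).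
Proof.
rewrite /straight; case: ifP => [dX|]; last by rewrite eqxx.
by have [_ /=] := crossing_order dX; rewrite !inE !negb_or => /and4P[/and3P[_ h _] _ _ _]; rewrite eq_sym (negPf h).
Qed.

Lemma card_crossing_darts : #|crossing D| = (#|crossings D|.*2).*2.
Proof.
have memX d : (node d \in crossings D) = (d \in crossing D).
  apply/imsetP/idP => [[e eX dE]|]; last by exists d.
  by rewrite (node_crossing (_ : d \in node e)) // -dE node_id.
have h : {in porbits r, forall c : {set dart D}, c \in crossings D -> #|c| = 4%N}.
  by move=> c _ /crossings_porbits[].
have := sum_nodes h; have -> : [set c in porbits r | c \in crossings D] = crossings D.
  by apply/finset.setP => c; rewrite inE; case: (boolP (c \in crossings D)) => [/crossings_porbits[->]|_]; rewrite ?andbF.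
have -> : [set d | node d \in crossings D] = crossing D.
  by apply/finset.setP => d; rewrite inE memX.
by move=> ->; rewrite -!muln2 -mulnA.
Qed.

Lemma euler_diagram :
  euler_char (underlying_graph D) = #|vertices D|%:Z + (#|crossings D|.*2)%:Z - (size A)%:Z.
Proof.
have pK : involutive straight.
  move=> d; rewrite /straight; case: (boolP (d \in crossing D)) => dX; last by rewrite (negPf dX).
  by rewrite !crossing_rot dX; have [] := crossing_order dX.
have st d d' : straight d = d -> d' \in node d -> straight d' = d'.
  by move/eqP; rewrite straightE => dX dd'; apply/eqP; rewrite straightE (node_crossing dd').
pose s := perm turn_inj.
have sp d : straight d != d -> s d = straight d.
  by rewrite straightE negbK permE /turn /straight => ->.
have ss d : straight d = d -> porbit s d = node d.
  move/eqP; rewrite straightE => dX; apply: eq_porbit_on => z zd.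
  by rewrite permE /turn (node_crossing zd) (negPf dX).
have m : (#|crossings D|.*2).*2 = #|[set d | straight d != d]|.
  by rewrite -card_crossing_darts; apply: eq_card => d; rewrite inE straightE negbK.
rewrite -[underlying_graph D]/(strand_graph straight) (euler_strand_graph pK uA cA aA st sp ss m).
suff -> : stop_nodes straight = vertices D by [].
by apply/finset.setP => c; apply/imsetP/imsetP => -[d + ->] => dX; exists d => //;
  move: dX; rewrite !inE straightE.
Qed.

Lemma card_porbits_rot : #|porbits r| = (#|vertices D| + #|crossings D|)%N.
Proof.
rewrite -cardsUI; have -> : vertices D :&: crossings D = finset.set0.
  apply/finset.setP => c; rewrite !inE; apply/negP => /andP[/imsetP[d + ->] /imsetP[e eX de]].
  by rewrite inE (node_crossing (_ : d \in node e)) ?eX // -de node_id.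
rewrite finset.cards0 addn0; apply: eq_card => c; rewrite inE; apply/imsetP/orP => [[d _ ->]|].
  by have [dX|dX] := boolP (d \in crossing D); [right|left]; apply/imsetP; exists d; rewrite ?inE.
by case=> /imsetP[d _ ->]; exists d.
Qed.

Hypothesis hdeg : forall v : {set dart D}, v \in vertices D -> #|v| = 2%N \/ #|v| = 3%N.

Lemma nbiv_diagram :
  (nbiv (extend (dart D * bool)%type r) + num_trivalent D)%N = #|vertices D|.
Proof.
rewrite -[RHS](cardsID [set v : {set dart D} | #|v| == 3%N]) addnC; congr (_ + _)%N.
  by apply: eq_card => v; rewrite !inE.
pose Pr (c : {set dart D}) := (c \in vertices D) && (#|c| == 2%N).
have h : {in porbits r, forall c : {set dart D}, Pr c -> #|c| = 2%N} by move=> c _ /andP[_ /eqP].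
have vD d : (node d \in vertices D) = (d \notin crossing D).
  apply/imsetP/idP => [[e + dE]|dX]; last by exists d; rewrite ?inE.
  by rewrite inE (node_crossing (_ : d \in node e)) // -dE node_id.
have bE : #|bivalent (extend (dart D * bool)%type r)| = #|[set d | Pr (node d)]|.
  have inlI : injective (@inl (dart D) (dart D * bool)) by move=> ? ? [].
  rewrite -(fintype.card_image inlI).
  apply: eq_card => -[d|x]; last first.
    rewrite !inE extend_inr eqxx; apply/esym/negP => /mapP[] //.
  rewrite (fintype.mem_image inlI).
  have iE a b : (@inl _ (dart D * bool) a == inl b) = (a == b :> dart D) by [].
  rewrite !inE !extend_inl !iE /Pr vD.
  have [dX|dX] := boolP (d \in crossing D).
    by have := straightE d; rewrite /straight dX => ->; rewrite andbF.
  have it := iter_porbit r d; have un := uniq_traject_porbit r d.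
  have /hdeg[c|c] : node d \in vertices D by rewrite vD.
    move: it un; rewrite -/(node d) c /= => -> /andP[]; rewrite inE eq_sym => ->.
    by rewrite eqxx.
  move: it un; rewrite -/(node d) c /= => _ /andP[]; rewrite !inE negb_or => /andP[_].
  by rewrite eq_sym => /negPf->; rewrite andbF.
rewrite /nbiv bE (sum_nodes h) muln2 doubleK; apply: eq_card => c; rewrite !inE /Pr.
case: (boolP (c \in vertices D)) => cV; last by rewrite !andbF.
have -> : c \in porbits r by case/imsetP: cV => d _ ->; apply: imset_f.
by case: (hdeg cV) => ->.
Qed.

End Counting.

Lemma golden_ratio2 (R : realType) : golden_ratio R ^+ 2 = golden_ratio R + 1.
Proof.
have s5 : Num.sqrt (5 : R) ^+ 2 = 5 by rewrite sqr_sqrtr.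
by rewrite /golden_ratio; field: s5.
Qed.

Lemma golden_ratio_gt0 (R : realType) : 0 < golden_ratio R.
Proof. by rewrite /golden_ratio divr_gt0 // ltr_wpDr ?sqrtr_ge0. Qed.


(** [cos (3 a) = - cos (2 a)] for [a = pi / 5] *)
Lemma cos_pi5 (R : realType) : cos (pi / 5 : R) *+ 2 = golden_ratio R.
Proof.
set a : R := pi / 5; set x := cos a.
have pi0 : 0 < pi :> R := pi_gt0 R.
have xgt : 0 < x.
  by apply: cos_gt0_pihalf; apply/andP; split; rewrite /a; lra.
have c3 : cos (a *+ 2 + a) = - cos (a *+ 2).
  by rewrite -(cosN (a *+ 2)) -cosDpi; congr cos; rewrite /a; lra.
have s2 : sin a ^+ 2 = 1 - x ^+ 2 by rewrite -(cos2Dsin2 a) addrC addKr.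
have : (x + 1) * ((x *+ 2) ^+ 2 - x *+ 2 - 1) = 0.
  move: c3; rewrite cosD cos_mulr2n sin_mulr2n -/x => c3.
  have {}c3 : (x ^+ 2 *+ 2 - 1) * x - (x * sin a ^+ 2) *+ 2 + (x ^+ 2 *+ 2 - 1) = 0.
    by move: c3 => /eqP; rewrite -subr_eq0 => /eqP <-; ring.
  by rewrite s2 in c3; rewrite -[RHS]c3; ring.
move/eqP; rewrite mulf_eq0 gt_eqF ?addr_gt0 //= => /eqP x2.
have g2 := golden_ratio2 R; have g0 := golden_ratio_gt0 R.
have : (x *+ 2 - golden_ratio R) * (x *+ 2 + golden_ratio R - 1) = 0.
  by rewrite -[RHS]x2; ring: g2.
move/eqP; rewrite mulf_eq0 => /orP[|/eqP h]; first by rewrite subr_eq0 => /eqP.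
have g1 : 1 <= golden_ratio R.
  rewrite /golden_ratio ler_pdivlMr // mul1r -[2]/(1 + 1) lerD2l.
  by rewrite -[leLHS]sqrtr1 ler_wsqrtr // ler1n.
move: h xgt g1; rewrite mulr2n; clear; move: x (golden_ratio R) => y g; lra.
Qed.

Section GoldenAngle.
Variable R : realType.
Local Notation q := (expi (pi / 5 : R)).
Local Notation phi := ((golden_ratio R)%:C).

Lemma expi_mulN (t : R) : expi t * expi (- t) = 1.
Proof.
rewrite /expi cosN sinN; apply/eqP; rewrite eq_complex /=.
by rewrite mulrN opprK -!expr2 cos2Dsin2 eqxx /= mulrN mulrC addNr.
Qed.

Lemma expi_neq0 (t : R) : expi t != 0.
Proof.
apply/eqP => t0; have := expi_mulN t; rewrite t0 mul0r => /esym/eqP.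
by rewrite oner_eq0.
Qed.

Lemma expi_inv (t : R) : (expi t)^-1 = expi (- t).
Proof. by apply: (mulfI (expi_neq0 t)); rewrite expi_mulN divff ?expi_neq0. Qed.

Lemma expi_add_inv : q + q^-1 = phi.
Proof.
rewrite expi_inv /expi cosN sinN -cos_pi5; apply/eqP; rewrite eq_complex /=.
by rewrite mulr2n subrr !eqxx.
Qed.

Lemma expi_sqr_inv : expi (- 2 * pi / 5 : R) = q ^- 2.
Proof.
rewrite -exprVn expi_inv (_ : - 2 * pi / 5 = (- (pi / 5)) *+ 2 :> R); last by ring.
rewrite /expi mulr2n cosD sinD expr2.
by apply/eqP; rewrite eq_complex /=; apply/andP; split; apply/eqP; ring.
Qed.
End GoldenAngle.

Lemma under_darts (D : diagram) : exists U : seq (dart D),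
  {in U, forall u, u \in crossing D /\ u \notin Defs.over D}
  /\ map (@node D) U = enum (crossings D).
Proof.
have under c : c \in crossings D ->
    exists2 u, u \in crossing D /\ u \notin Defs.over D & node u = c.
  case/imsetP => d dX ->; have [dO|dO] := boolP (d \in Defs.over D); last by exists d.
  by exists (Defs.rot D d); rewrite ?node_rot // crossing_rot over_rot // dO.
have : {subset enum (crossings D) <= crossings D} by move=> c; rewrite mem_enum.
elim: (enum _) => [|c l IH] lX; first by exists [::].
have [|U [UX <-]] := IH; first by move=> x xl; apply: lX; rewrite inE xl orbT.
have [u uX <-] := under c (lX c (mem_head _ _)).
by exists (u :: U); split=> // x; rewrite inE => /predU1P[->//|/UX].
Qed.

Theorem theorem3p1 (R : realType) (D : diagram)
    (hdeg : forall v : {set dart D},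
       v \in vertices D -> #|v| = 2%N \/ #|v| = 3%N) :
  let G := underlying_graph D in
  let V := #|vertex G|%:Z in
  let E := #|edge G|%:Z in
  let E' := (num_trivalent D)%:Z - euler_char G in
  yamada D (expi (pi / 5 : R))
  = (-1) ^ (V - E) * (golden_ratio R)%:C ^ E'
    * yamada D (expi (- 2 * pi / 5 : R)) ^+ 2.
Proof.
rewrite /= -[_ - _]/(euler_char (underlying_graph D)) expi_sqr_inv.
have [A [uA mA aA]] := involution_pairs (@arcK D).
have cA z : z \in ends A by rewrite mA arc_neq.
have [U [UX U_crossings]] := under_darts D.
set phi : R[i] := (golden_ratio R)%:C.
have phi2 : phi ^+ 2 = phi + 1.
  by rewrite /phi -rmorphXn /= golden_ratio2 rmorphD rmorph1.
have phi5 : phi + 2 != 0.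
  have -> : phi + 2 = (golden_ratio R + 2)%:C by rewrite rmorphD /= rmorph_nat.
  by rewrite fmorph_eq0 gt_eqF // addr_gt0 ?golden_ratio_gt0.
have phi0 := phi_neq0 phi2.
have m1 : (-1 : R[i]) != 0 by rewrite oppr_eq0 oner_eq0.
have := diagram_golden uA cA aA UX U_crossings hdeg phi2 phi5 (expi_neq0 _) (expi_add_inv R).
rewrite (euler_diagram uA cA aA) (card_porbits_rot) -(nbiv_diagram hdeg).
move: (yamada D _) (yamada D _) (nbiv _) (num_trivalent D) #|crossings D| (size A) => Y1 Y2 v2 v3 c a.
clearbody phi; clear -phi0 m1 => H.
have -> : v3%:Z - ((v2 + v3)%N%:Z + (c.*2)%:Z - a%:Z) = a%:Z - (v2 + c.*2)%N%:Z.
  by rewrite !PoszD; ring.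
have sq n : (-1 : R[i]) ^+ n * (-1) ^+ n = 1 by rewrite -expr2 sqrr_sign.
have -> : (-1 : R[i]) ^ ((v2 + v3)%N%:Z + (c.*2)%:Z - a%:Z) = (-1) ^+ (v2 + v3 + a).
  by rewrite !expfzDr // -invr_expz -!exprnP invr_sign -addnn [_ ^+ (c + c)]exprD sq mulr1 -exprD.
have b0 : phi ^+ (v2 + c.*2) != 0 by rewrite expf_neq0.
rewrite expfzDr // -invr_expz -!exprnP; apply: (mulfI b0).
have s0 : (-1 : R[i]) ^+ (v2 + v3 + c + a) != 0 by rewrite signr_eq0.
apply: (mulfI s0); rewrite [LHS]mulrCA H.
have -> : (-1 : R[i]) ^+ c = (-1) ^+ (v2 + v3 + c + a) * (-1) ^+ (v2 + v3 + a).
  by rewrite addnAC exprD mulrAC sq mul1r.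
by move: b0; move: (_ ^+ (v2 + c.*2)) => b b0; field.
Qed.
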